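(* Let $\tilde G_t=\tilde\mu_t/\tilde\mu_t(\mathbb X)$ be a normalized tilted completely random measure on $\mathbb X$ with tilting function $h(x)=h'(x)x^{-q}$; its parameters are the positive Borel measurable function $h'$ on $[0,\infty)$, the measure $\nu(dx,ds)=\eta(dx)\rho_x(ds)$, and the scalar $q\ge 0$, where $E[h'(\tilde\mu(\mathbb X))\,\tilde\mu(\mathbb X)^{-q}]<\infty$ and $\tilde\mu$ is the completely random measure with intensity $\nu$ and law $\mathcal P_{\tilde\mu}$. Let $n\ge 1$ and let $\mathbf X_n=\{X_1,\dots,X_n\}$ be, conditionally on $\tilde G_t$, independent and identically distributed with distribution $\tilde G_t$; write $\mathbf X_n=\{Y_1,\dots,Y_{\aleph(\mathbf p_n)},\mathbf p_n\}$, with cell sizes $n_1,\dots,n_{\aleph(\mathbf p_n)}$. Then, with prior $\tilde G_t$, the posterior random measure of $\tilde G_t$ given $\mathbf X_n$, denoted $\tilde G_t^{(\mathbf X_n)}$, has the same distribution as a normalized tilted completely random measure, such that $$\tilde G_t^{(\mathbf X_n)}\overset{d}{=}\tilde\mu_t^{(\mathbf X_n)}/\tilde\mu_t^{(\mathbf X_n)}(\mathbb X),$$ where: 1. $\tilde\mu_t^{(\mathbf X_n)}$ has the law $$\mathcal P_{\tilde\mu_t}^{(\mathbf X_n)}(A)=\frac{1}{E\big[h'(\tilde\mu^{(\mathbf X_n)}(\mathbb X))\,\tilde\mu^{(\mathbf X_n)}(\mathbb X)^{-(n+q)}\big]}\int_A h'(\mu(\mathbb X))\,\mu(\mathbb X)^{-(n+q)}\,\mathcal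 P_{\tilde\mu}^{(\mathbf X_n)}(d\mu),\qquad A\in\mathcal B(\mathcal M_{\mathbb X}).$$ 2. $\tilde\mu^{(\mathbf X_n)}$ is a completely random measure whose law $\mathcal P_{\tilde\mu}^{(\mathbf X_n)}$ is the same as the law of $$\tilde\mu+\sum_{k=1}^{\aleph(\mathbf p_n)}J_k^{(\mathbf X_n)}\delta_{Y_k},$$ where $\tilde\mu$ is a completely random measure with law $\mathcal P_{\tilde\mu}$ and intensity measure $\nu$, $\{Y_1,\dots,Y_{\aleph(\mathbf p_n)}\}$ is a sequence of fixed points of discontinuity, and $\{J_1^{(\mathbf X_n)},\dots,J_{\aleph(\mathbf p_n)}^{(\mathbf X_n)}\}$ are the corresponding jumps. 3. Conditional on $\mathbf X_n$, each jump $J_k^{(\mathbf X_n)}$ has the conditional distribution $$\mathbb P(J_k^{(\mathbf X_n)}\in ds)=\frac{s^{n_k}\rho_{Y_k}(ds)}{\int_{(0,\infty)}s^{n_k}\rho_{Y_k}(ds)},\qquad k=1,\dots,\aleph(\mathbf p_n).$$ 4. Conditional on $\mathbf X_n$, $\tilde\mu$ and $\{J_1^{(\mathbf X_n)},\dots,J_{\aleph(\mathbf p_n)}^{(\mathbf X_n)}\}$ are independent.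
   Context: Let $\mathbb X$ be a Polish space with Borel $\sigma$-field $\mathcal B(\mathbb X)$, and let $\mathcal M_{\mathbb X}$ be the space of boundedly finite measures on $\mathbb X$ (finite on bounded Borel sets), with the Borel $\sigma$-field $\mathcal B(\mathcal M_{\mathbb X})$ induced by the metric of weak convergence. A random measure $\mu$ is a completely random measure if $\mu(A_1),\dots,\mu(A_k)$ are mutually independent for all finite families of pairwise disjoint bounded Borel sets $A_1,\dots,A_k$. Intensity: $\eta$ is a non-atomic probability measure on $\mathbb X$, $x\mapsto\rho_x$ is a measurable family of $\sigma$-finite measures on $(0,\infty)$, and $\nu(dx,ds)=\eta(dx)\rho_x(ds)$ satisfies $\int_{(0,\infty)}\min\{y,s\}\,\nu(A,dy)<\infty$ for every bounded $A\in\mathcal B(\mathbb X)$ and $s>0$, and $\nu(\{x\},(0,\infty))=0$ for all $x\in\mathbb X$. The completely random measure $\tilde\mu$ with intensity (parameter measure) $\nu$ is $\tilde\mu(A)=\int_{(0,\infty)}y\,N(A,dy)$, where $N$ is a Poisson process on $\mathbb X\times(0,\infty)$ with intensity $\nu$; its law on $\mathcal M_{\mathbb X}$ is $\mathcal P_{\tilde\mu}$. Standing assumption: $0<\tilde\mu(\mathbb X)<\infty$ almost surely. Tilting: for a positive Borel measurable function $h$ on $[0,\infty)$ with $E[h(\tilde\mu(\mathbb X))]<\infty$, the tilted completely random measure $\tilde\mu_t$ with parameters $\nu$ and $h$ is a random measure with law $$\mathcal P_{\tilde\mu_t}(A)=\frac{1}{E[h(\tilde\mu(\mathbb X))]}\int_A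 h(\mu(\mathbb X))\,\mathcal P_{\tilde\mu}(d\mu),\quad A\in\mathcal B(\mathcal M_{\mathbb X}),$$ and the normalized tilted completely random measure with parameters $\nu$ and $h$ is $\tilde G_t(\cdot)=\tilde\mu_t(\cdot)/\tilde\mu_t(\mathbb X)$. In the conclusion, ''normalized tilted completely random measure'' is used in the same sense, with the underlying completely random measure allowed to have the fixed atoms $Y_1,\dots,Y_{\aleph(\mathbf p_n)}$. Partition notation: $Y_1,\dots,Y_{\aleph(\mathbf p_n)}$ are the distinct values among $X_1,\dots,X_n$; $\mathbf p_n=\{C_1,\dots,C_{\aleph(\mathbf p_n)}\}$ is the partition of $\{1,\dots,n\}$ with $C_k=\{i: X_i=Y_k\}$; $\aleph(\mathbf p_n)$ is its number of cells; and $n_k$ is the number of elements of $C_k$. $\delta_a$ is the Dirac measure at $a$.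
   Formalization: The description 1–4 is asserted for almost every sample at which all integrals of s^{n_k} against rho_{Y_k} are finite; otherwise (e.g. sigma-stable rho(ds)=s^{-1-sigma}ds, h'=1, q>0) the jump law in item 3 is undefined. Existence of the posterior is claimed without this condition. *)

(* Defs.v *)
From HB Require Import structures.
From mathcomp Require Import all_boot all_order all_algebra.
From mathcomp Require Import all_classical all_reals all_analysis.
From mathcomp Require Import measurable_realfun.

Set Implicit Arguments.
Unset Strict Implicit.
Unset Printing Implicit Defensive.

Import Order.TTheory GRing.Theory Num.Theory.
Import numFieldNormedType.Exports.

Local Open Scope classical_set_scope.
Local Open Scope ring_scope.
Local Open Scope ereal_scope.

(* Boundedness refers to a metric, so a Polish space comes here with a fixed
   complete separable metric, and with its Borel sets as measurable sets. *)
HB.mixin Record isPolishBorel (R : realType) (d : measure_display) T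
    & Metric R T & Complete T & Measurable d T := {
  polish_separable : exists2 D : set T, countable D & dense D;
  polish_borel : (@measurable d T : set (set T)) = <<s open >>
}.

#[short(type="polishType")]
HB.structure Definition Polish (R : realType) (d : measure_display) :=
  { T of Metric R T & Complete T & Measurable d T & isPolishBorel R d T }.

Section boundedly_finite_measures.
Context {R : realType} {d : measure_display}.

Definition metric_bounded (T : polishType R d) (A : set T) :=
  exists (x : T) (r : R), A `<=` ball x r.

Record bfmeasure (T : polishType R d) := BFMeasure {
  bfmeasure_measure :> {measure set T -> \bar R};
  bfmeasure_finite : forall A : set T,
    measurable A -> metric_bounded A -> bfmeasure_measure A < +oo }.

Variable T : polishType R d.

Lemma mzero_bounded_finite (A : set T) :
  measurable A -> metric_bounded A -> (mzero : {measure set T -> \bar R}) A < +oo.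
Proof. by move=> _ _; exact: ltry. Qed.

HB.instance Definition _ := gen_eqMixin (bfmeasure T).
HB.instance Definition _ := gen_choiceMixin (bfmeasure T).
HB.instance Definition _ :=
  isPointed.Build (bfmeasure T) (BFMeasure mzero_bounded_finite).

Definition weak_test_function (f : T -> R) :=
  [/\ continuous f, exists M : R, forall x, (`|f x| <= M)%R
    & exists2 A : set T, metric_bounded A & forall x, ~ A x -> f x = 0%R].

(* The topology of weak convergence of boundedly finite measures: the coarsest
   one for which mu |-> \int f dmu is continuous for every bounded continuous f
   with bounded support. *)
HB.instance Definition _ := @isSubBaseTopological.Build (bfmeasure T)
  ((T -> R) * set R)%type
  [set i | weak_test_function i.1 /\ open i.2]
  (fun i => [set mu : bfmeasure T | i.2 (\int[mu]_x i.1 x)%R]).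

Definition bfmeasure_display : measure_display.
Proof. by constructor. Qed.

Definition bfmeasure_borel : set (set (bfmeasure T)) := <<s open >>.

Let bfmeasure_borel0 : bfmeasure_borel set0.
Proof. exact: sigma_algebra0. Qed.

Let bfmeasure_borelC U : bfmeasure_borel U -> bfmeasure_borel (~` U).
Proof. exact: sigma_algebraC. Qed.

Let bfmeasure_borelU (F : (set (bfmeasure T))^nat) :
  (forall i, bfmeasure_borel (F i)) -> bfmeasure_borel (\bigcup_i F i).
Proof. exact: sigma_algebra_bigcup. Qed.

HB.instance Definition _ := @isMeasurable.Build bfmeasure_display
  (bfmeasure T) bfmeasure_borel
  bfmeasure_borel0 bfmeasure_borelC bfmeasure_borelU.

Definition total_mass (mu : bfmeasure T) : R := fine (mu [set: T]).

Lemma mnormalize_bounded_finite (mu : bfmeasure T) (A : set T) :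
  measurable A -> metric_bounded A ->
  (mnormalize mu (\d_(point : T)) : {measure set T -> \bar R}) A < +oo.
Proof.
move=> mA _; apply: (@le_lt_trans _ _ 1); last exact: ltry.
exact: probability_le1.
Qed.

(* mu / mu(T); the value is a Dirac mass when mu(T) is 0 or +oo. *)
Definition normalization (mu : bfmeasure T) : bfmeasure T :=
  BFMeasure (mnormalize_bounded_finite mu).

End boundedly_finite_measures.

Arguments normalization {R d T} mu.

Section independence.
Context {R : realType} {dW : measure_display} {W : measurableType dW}.
Variable P : probability W R.

Definition mutually_independent (I : finType) (F : I -> set (set W)) :=
  forall (J : {set I}) (A : I -> set W), (forall i, i \in J -> F i (A i)) ->
    P (\bigcap_(i in [set` J]) A i) = \prod_(i in J) P (A i).

End independence.

Section completely_random_measures.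
Context {R : realType} {d : measure_display} {T : polishType R d}.
Context {dW : measure_display} {W : measurableType dW}.
Variable P : probability W R.

Definition completely_random (mu : {RV P >-> bfmeasure T}) :=
  forall (k : nat) (A : 'I_k -> set T),
    (forall i, measurable (A i)) -> (forall i, metric_bounded (A i)) ->
    trivIset [set: 'I_k] A ->
    mutually_independent P
      (fun i => g_sigma_algebra_preimage (fun w => mu w (A i))).

(* The second argument of poisson_prob is not used. *)
Definition poisson_process (dE : measure_display) (E : measurableType dE)
    (nu : {measure set E -> \bar R}) (N : R.-ker W ~> E) :=
  [/\ forall C, measurable C -> nu C < +oo -> forall U : set nat,
        P [set w | exists2 m, U m & N w C = m%:R%:E] =
        poisson_prob (fine (nu C)) 0%N U,
      forall C, measurable C -> nu C = +oo -> P [set w | N w C = +oo] = 1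
    & forall (k : nat) (C : 'I_k -> set E), (forall i, measurable (C i)) ->
        trivIset [set: 'I_k] C ->
        mutually_independent P
          (fun i => g_sigma_algebra_preimage (fun w => N w (C i)))].

Definition crm_with_intensity (nu : {measure set (T * R) -> \bar R})
    (mu : {RV P >-> bfmeasure T}) :=
  exists2 N : R.-ker W ~> (T * R)%type, poisson_process nu N
    & {ae P, forall w, forall A, measurable A ->
        mu w A = \int[N w]_(z in A `*` `]0%R, +oo[) z.2%:E}.

Definition fixed_atom (mu : {RV P >-> bfmeasure T}) (y : T) :=
  0 < P [set w | 0 < mu w [set y]].

End completely_random_measures.

Section intensity.
Context {R : realType} {d : measure_display} {T : polishType R d}.

(* nu(dx, ds) = eta(dx) rho_x(ds); measures on (0, +oo) are represented by
   measures on R that do not charge the nonpositive numbers. *)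
Record crm_intensity (eta : probability T R) (rho : R.-sigmafker T ~> R)
    (nu : {measure set (T * R) -> \bar R}) : Prop := CrmIntensity {
  eta_nonatomic : forall x, eta [set x] = 0;
  rho_positive : forall x, rho x `]-oo, 0%R]%classic = 0;
  intensityE : forall C, measurable C ->
    nu C = \int[eta]_x rho x (xsection C x);
  intensity_bounded : forall (A : set T) (s : R), measurable A ->
    metric_bounded A -> (0 < s)%R ->
    \int[nu]_(z in A `*` `]0%R, +oo[) (Num.min z.2 s)%:E < +oo;
  intensity_nonatomic : forall x, nu ([set x] `*` `]0%R, +oo[) = 0 }.

End intensity.

Section tilting.
Context {R : realType} {d : measure_display} {T : polishType R d}.

Definition tilting_constant (L : {measure set (bfmeasure T) -> \bar R})
    (h : R -> R) : \bar R :=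
  \int[L]_mu (h (total_mass mu))%:E.

Definition tilted_law (L : {measure set (bfmeasure T) -> \bar R}) (h : R -> R)
    (Lt : set (bfmeasure T) -> \bar R) :=
  0 < tilting_constant L h < +oo /\
  forall A, measurable A ->
    Lt A = (tilting_constant L h)^-1 *
           \int[L]_(mu in A) (h (total_mass mu))%:E.

End tilting.

Section partition.
Context {R : realType} {d : measure_display} {T : polishType R d} {n : nat}.
Variable x : n.-tuple T.

Definition ncells : nat := size (undup x).

Definition distinct_value (k : 'I_ncells) : T := tnth (in_tuple (undup x)) k.

Definition cell (k : 'I_ncells) : {set 'I_n} :=
  [set i | tnth x i == distinct_value k]%SET.

Definition cell_size (k : 'I_ncells) : nat := #|cell k|.

End partition.

Section posterior.
Context {R : realType} {d : measure_display} {T : polishType R d}.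
Context {dW : measure_display} {W : measurableType dW}.
Variables (P : probability W R) (n : nat).

Definition conditionally_iid (G : W -> bfmeasure T)
    (X : {RV P >-> n.-tuple T}) :=
  forall (B : set (bfmeasure T)) (A : 'I_n -> set T),
    measurable B -> (forall i, measurable (A i)) ->
    P [set w | B (G w) /\ forall i, A i (tnth (X w) i)] =
    \int[P]_(w in G @^-1` B) \prod_(i < n) G w (A i).

(* Q is a regular conditional distribution of G given X. *)
Definition posterior_law (G : W -> bfmeasure T) (X : {RV P >-> n.-tuple T})
    (Q : R.-pker (n.-tuple T) ~> (bfmeasure T)) :=
  forall (C : set (n.-tuple T)) (B : set (bfmeasure T)),
    measurable C -> measurable B ->
    P (X @^-1` C `&` G @^-1` B) = \int[distribution P X]_(x in C) Q x B.

End posterior.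

Section jumps.
Context {R : realType} {d : measure_display} {T : polishType R d}.
Variable rho : R.-sigmafker T ~> R.
Context {n : nat} (x : n.-tuple T).

(* The normalizing constant of the law of the k-th jump. It may be infinite, e.g.
   for rho_x(ds) = s^(-1-a) ds with 0 < a < 1, and then that law is undefined. *)
Definition jump_moment (k : 'I_(ncells x)) : \bar R :=
  \int[rho (distinct_value k)]_(s in `]0%R, +oo[) (s ^+ cell_size k)%:E.

Context {dW : measure_display} {W : measurableType dW}.
Variable P : probability W R.

Definition jump_law (k : 'I_(ncells x)) (J : {RV P >-> R}) :=
  (forall w, 0 < J w)%R /\
  forall A : set R, measurable A ->
    P (J @^-1` A) =
    (\int[rho (distinct_value k)]_(s in A `&` `]0%R, +oo[)
      (s ^+ cell_size k)%:E) / jump_moment k.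

(* The sigma-fields generated by mu (index None) and by the jumps. *)
Definition independent_jumps (mu : {RV P >-> bfmeasure T})
    (J : 'I_(ncells x) -> {RV P >-> R}) :=
  mutually_independent P (fun o : option 'I_(ncells x) =>
    if o is Some k then g_sigma_algebra_preimage (J k)
    else g_sigma_algebra_preimage mu).

Definition add_fixed_jumps (mu : {RV P >-> bfmeasure T})
    (J : 'I_(ncells x) -> {RV P >-> R}) (mux : {RV P >-> bfmeasure T}) :=
  forall w A, measurable A ->
    mux w A = mu w A +
      \sum_(k < ncells x) (J k w)%:E * \d_(distinct_value k) A.

End jumps.

(* Main.v *)
Require Import Defs.
From HB Require Import structures.
From mathcomp Require Import all_boot all_order all_algebra.
From mathcomp Require Import all_classical all_reals all_analysis.
From mathcomp Require Import measurable_realfun.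
From mathcomp Require Import ring lra.
From mathcomp Require finmap.
Import HBNNSimple.

Set Implicit Arguments.
Unset Strict Implicit.
Unset Printing Implicit Defensive.

Import Order.TTheory GRing.Theory Num.Theory.
Import numFieldNormedType.Exports.

Local Open Scope classical_set_scope.
Local Open Scope ring_scope.
Local Open Scope ereal_scope.

(** The argument is Bayes' formula for the pair formed by the sample and the
random measure, on top of an explicit disintegration of the moments of the
completely random measure.

Let t denote the total mass of mu.  Sampling independently from mu / t and
tilting by h'(t) t^(-q) give, for Borel sets A_1, ..., A_n and B,

  P(X_i in A_i for all i, G in B)
    = (1/c) E[mu(A_1) ... mu(A_n) 1_B(mu / t) h'(t) t^(-(n+q))],

each of the n factors mu(A_i) / t contributing one power of t; this is why the
exponent q becomes n + q in the posterior (joint_rect, weight_norm).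

The factors mu(A_i) are removed one after the other by the Palm formula

  E[mu(A) F(mu)] = int_A eta(dx) int rho_x(ds) s E[F(mu + s delta_x)]

(palm), which comes from the Mecke equation of the Poisson process (mecke) and
ultimately from the recurrence m p_m = lambda p_(m-1) between Poisson
probabilities (cnt_recurrence).  After some steps a factor mu(A) stands in
front of a function of mu + sum_k s_k delta_(y_k).  The Palm formula applied to
mu creates a new atom; the mass s_k, for y_k in A, raises the power of s_k by
one (mixed_ev).  Since eta has no atoms, a new atom almost surely differs from
the previous ones.  After n steps the power of s_k is the number n_k of sample
points located at y_k, and there is a measure Lam on n-tuples such that
E[mu(A_1) ... mu(A_n) F(mu)] is the integral over A_1 x ... x A_n with respect
to Lam(dx) of

  int prod_k s_k^(n_k) rho_(y_k)(ds_k) E[F(mu + sum_k s_k delta_(y_k))],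

the y_k being the distinct entries of x (moment_measure, with the inner
expression written mixed).

With F = 1_B(m / t) h'(t) t^(-(n+q)) the inner expression is an unnormalized
posterior law of G given x, as a function of B, and normalizing it gives a
version of the posterior (posterior_exists).  Any other version agrees with it
for almost every x, because the Borel sets of the space of measures are
generated by a countable family closed under intersections
(bf_measurableE, posterior_unique).  For a fixed x whose jump moments are
finite, division by the product of these moments turns the measures
s^(n_k) rho_(y_k)(ds) into the laws of independent jumps, which are realized,
together with a copy of mu, on a product space (jump_space).  There the mixed
moment is an expectation of F(mu + sum_k J_k delta_(y_k)), and the normalized
weight h'(t) t^(-(n+q)) is the tilting (posterior_structure).

Two points of measure theory intervene.  The Borel sets of the weak topology
are those generated by the evaluations mu |-> mu(A) (ev_measurable,
measurable_to_bf).  And the interchanges of integrals require s-finite kernels,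
whereas rho is only sigma-finite at each point: the finiteness of nu on strips
B x (e, +oo), with B bounded, provides an s-finite kernel r which equals rho
almost everywhere, and is zero at the other points (good_kernel).  The latter
points do not occur in samples, since the unnormalized posterior would vanish
there (posterior_cells_good). *)

(** * Integrals as positive functionals *)

Section generic.
Context {R : realType}.

Lemma cvg_integral_nd d (T : measurableType d) (m : {measure set T -> \bar R})
    (f : nat -> T -> \bar R) (g : T -> \bar R) :
  (forall n, measurable_fun setT (f n)) -> (forall n x, 0 <= f n x) ->
  (forall x, nondecreasing_seq (f ^~ x)) -> (forall x, f n x @[n --> \oo] --> g x) ->
  \int[m]_x f n x @[n --> \oo] --> \int[m]_x g x.
Proof.
move=> mf f0 ndf fg.
have -> : g = fun x => limn (f ^~ x).
  by apply/funext => x; apply/esym/cvg_lim.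
exact: cvg_monotone_convergence.
Qed.

(** Monotonicity excludes the indeterminate product of 0 and +oo: a zero limit
forces the sequence to vanish identically. *)
Lemma cvgeMr_nd (f : nat -> \bar R) (a y : \bar R) : (forall n, 0 <= f n) ->
  nondecreasing_seq f -> 0 <= y -> f n @[n --> \oo] --> a ->
  f n * y @[n --> \oo] --> a * y.
Proof.
move=> f0 ndf y0 fa.
have fle n : f n <= a.
  rewrite -(cvg_lim _ fa)//; apply: lime_ge; first by apply/cvg_ex; exists a.
  by near=> m; apply: ndf; near: m; exists n.
have [->|yn0] := eqVneq y 0.
  by under eq_fun do rewrite mule0; rewrite mule0; exact: cvg_cst.
have [a0|an0] := eqVneq a 0.
  have {fle} f_0 n : f n = 0 by apply/eqP; rewrite eq_le f0 -a0 fle.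
  by under eq_fun do rewrite f_0 mul0e; rewrite a0 mul0e; exact: cvg_cst.
apply: (cvgeM _ fa); last exact: cvg_cst.
by rewrite neq0_mule_def// mule_neq0.
Unshelve. all: by end_near. Qed.

(** Nonnegative measurable functions are increasing limits of simple ones, and
simple functions are finite sums of multiples of indicators. *)
Lemma ge0_measurable_ind d (T : measurableType d) (P : (T -> \bar R) -> Prop) :
  (forall A, measurable A -> P (fun x => (\1_A x)%:E)) ->
  (forall (a : R) f g, (0 <= a)%R -> measurable_fun setT f -> (forall x, 0 <= f x) ->
     measurable_fun setT g -> (forall x, 0 <= g x) -> P f -> P g ->
     P (fun x => a%:E * f x + g x)) ->
  (forall (f : nat -> T -> \bar R) g, (forall n, measurable_fun setT (f n)) ->
     (forall n x, 0 <= f n x) -> (forall x, nondecreasing_seq (f ^~ x)) ->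
     (forall x, f n x @[n --> \oo] --> g x) -> (forall n, P (f n)) -> P g) ->
  forall f, measurable_fun setT f -> (forall x, 0 <= f x) -> P f.
Proof.
move=> P1 PD Plim f mf f0.
pose h := nnsfun_approx measurableT mf.
refine (Plim (fun n x => (h n x)%:E) f _ _ _ _ _).
- by move=> n; exact/measurable_EFinP.
- by move=> n x; rewrite lee_fin.
- by move=> x m n mn; rewrite lee_fin; exact/lefP/nd_nnsfun_approx.
- by move=> x; exact: cvg_nnsfun_approx.
move=> n; move: (h n) => {}h.
suff H (s : seq R) : all (fun r => 0 <= r)%R s ->
    P (fun x => \sum_(r <- s) r%:E * (\1_(h @^-1` [set r]) x)%:E).
  have := H [seq r <- finmap.enum_fset (fset_set (range h)) | (0 <= r)%R].
  rewrite filter_all => /(_ isT); congr P; apply/funext => x.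
  rewrite fimfunE fsbig_finite//= -sumEFin big_filter big_mkcond/=.
  apply: eq_bigr => r _; case: ifPn => // r0.
  rewrite preimage_nnfun0 ?ltNge//.
  by rewrite indicE in_set0 mulr0.
elim: s => [_|r s ih /= /andP[r0 s0]].
  have := P1 set0 measurable0; congr P; apply/funext => x.
  by rewrite big_nil indicE in_set0.
under eq_fun do rewrite big_cons.
apply: (PD r) => //; last 2 first.
- by apply: P1.
- exact: ih.
- exact/measurable_EFinP.
- apply: emeasurable_sum => r' _.
  have mi : measurable_fun setT (fun x => (\1_(h @^-1` [set r']) x)%:E : \bar R).
    exact/measurable_EFinP.
  exact: measurable_funeM.
- move=> x; elim: s s0 {ih} => [_|r' s IH /= /andP[r'0 s0]]; rewrite ?big_nil// big_cons.
  by rewrite adde_ge0 ?IH// mule_ge0// lee_fin.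
Qed.

Lemma cvg_nd_sup (f : nat -> \bar R) l : nondecreasing_seq f -> (forall n, 0 <= f n <= l) ->
  (forall s : R, s%:E < l -> exists n, s%:E < f n) -> f n @[n --> \oo] --> l.
Proof.
move=> ndf fl fs; have := ereal_nondecreasing_cvgn ndf.
suff -> : ereal_sup (range f) = l by [].
apply/eqP; rewrite eq_le; apply/andP; split.
  by apply: ge_ereal_sup => _ [n _ <-]; have /andP[] := fl n.
rewrite leNgt; apply/negP => supl.
have sup0 : 0 <= ereal_sup (range f).
  apply: (@le_trans _ _ (f 0%N)); first by have /andP[] := fl 0%N.
  by apply: ereal_sup_ubound; exists 0%N.
have supfin : ereal_sup (range f) \is a fin_num.
  by rewrite ge0_fin_numE// (lt_le_trans supl)// leey.
have [|n] := fs (fine (ereal_sup (range f))); first by rewrite fineK.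
rewrite fineK// ltNge => /negP; apply; apply: ereal_sup_ubound; by exists n.
Qed.

Lemma integral_indicM d (T : measurableType d) (m : {measure set T -> \bar R}) A
    (f : T -> \bar R) : \int[m]_x ((\1_A x)%:E * f x) = \int[m]_(x in A) f x.
Proof.
by rewrite [RHS]integral_mkcond epatch_indic; apply: eq_integral => x _; rewrite muleC.
Qed.

Lemma finite_measure_unique d (T : measurableType d) (G : set (set T))
    (m1 m2 : {measure set T -> \bar R}) :
  measurable = <<s G >> -> setI_closed G -> G setT -> m1 setT < +oo ->
  (forall A, G A -> m1 A = m2 A) -> forall A, measurable A -> m1 A = m2 A.
Proof.
move=> mG GI GT m1oo m12 A mA.
apply: (measure_unique G (fun=> setT)) => //.
by apply/seteqP; split => // x _; exists 0%N.
Qed.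

End generic.

Section positive_functionals.
Context {R : realType} d (T : measurableType d).
Implicit Types (I : (T -> \bar R) -> \bar R) (f g : T -> \bar R).

(** The common properties of the iterated integrals used below, in a form that
sums, multiples and mixtures inherit.  Convergence is required along increasing
sequences, whose images increase by the monotonicity clause. *)
Definition integral_like I := [/\ I (cst 0) = 0,
  forall f, (forall x, 0 <= f x) -> 0 <= I f,
  forall f g, measurable_fun setT f -> measurable_fun setT g ->
    (forall x, 0 <= f x) -> (forall x, f x <= g x) -> I f <= I g,
  forall (a : R) f g, (0 <= a)%R ->
    measurable_fun setT f -> (forall x, 0 <= f x) ->
    measurable_fun setT g -> (forall x, 0 <= g x) ->
    I (fun x => a%:E * f x + g x) = a%:E * I f + I g
  & forall (f : nat -> T -> \bar R) g,
    (forall n, measurable_fun setT (f n)) -> (forall n x, 0 <= f n x) ->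
    (forall x, nondecreasing_seq (f ^~ x)) ->
    (forall x, f n x @[n --> \oo] --> g x) -> I (f n) @[n --> \oo] --> I g].

(** By induction on nonnegative measurable functions; an identity between two
iterated integrals thus needs to be checked on indicators only. *)
Lemma integral_like_unique I J : integral_like I -> integral_like J ->
  (forall A, measurable A -> I (fun x => (\1_A x)%:E) = J (fun x => (\1_A x)%:E)) ->
  forall f, measurable_fun setT f -> (forall x, 0 <= f x) -> I f = J f.
Proof.
move=> [I0 Ige0 Ile ID Icvg] [J0 Jge0 Jle JD Jcvg] IJ; apply: ge0_measurable_ind => //.
- by move=> a f g a0 mf f0 mg g0 If Ig; rewrite ID// JD// If Ig.
- move=> f g mf f0 ndf fg IH; apply: (cvg_unique _ (Icvg _ _ mf f0 ndf fg)) => //.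
  by rewrite (_ : (fun n => _) = (fun n => J (f n))); [exact: Jcvg|apply/funext].
Qed.

Lemma integral_likeD I J : integral_like I -> integral_like J ->
  integral_like (fun f => I f + J f).
Proof.
move=> [I0 Ige0 Ile ID Icvg] [J0 Jge0 Jle JD Jcvg]; split.
- by rewrite I0 J0 adde0.
- by move=> f f0; rewrite adde_ge0 ?Ige0 ?Jge0.
- by move=> f g mf mg f0 fg; apply: leeD; [exact: Ile|exact: Jle].
- move=> a f g a0 mf f0 mg g0; rewrite ID// JD// ge0_muleDr ?Ige0 ?Jge0//.
  by rewrite addeACA.
- move=> f g mf f0 ndf fg.
  have mg : measurable_fun setT g by apply: emeasurable_fun_cvg => // x _; exact: fg.
  have g0 x : 0 <= g x.
    rewrite -(cvg_lim _ (fg x))//; apply: lime_ge; last exact: nearW.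
    by apply/cvg_ex; exists (g x); exact: fg.
  apply: cvgeD; [|exact: Icvg|exact: Jcvg].
  by apply: ge0_adde_def; rewrite inE; [exact: Ige0|exact: Jge0].
Qed.

Lemma integral_likeZ (c : \bar R) I : 0 <= c -> integral_like I ->
  integral_like (fun f => c * I f).
Proof.
move=> c0 [I0 Ige0 Ile ID Icvg]; split.
- by rewrite I0 mule0.
- by move=> f f0; rewrite mule_ge0 ?Ige0.
- by move=> f g mf mg f0 fg; apply: lee_wpmul2l => //; exact: Ile.
- move=> a f g a0 mf f0 mg g0; rewrite ID// ge0_muleDr ?mule_ge0 ?Ige0//.
  by rewrite muleCA.
- move=> f g mf f0 ndf fg; under eq_fun do rewrite muleC; rewrite muleC.
  apply: cvgeMr_nd => //; last exact: Icvg.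
  + by move=> n; exact: Ige0.
  + by move=> m n mn; apply: Ile => // x; exact: ndf.
Qed.

Lemma integral_like_sum (J : Type) (s : seq J) (I : J -> (T -> \bar R) -> \bar R) :
  (forall j, integral_like (I j)) -> integral_like (fun f => \sum_(j <- s) I j f).
Proof.
move=> HI; elim: s => [|j s ih].
  rewrite (_ : (fun f => _) = (fun=> 0)); last by apply/funext => f; rewrite big_nil.
  split => //.
  - by move=> a f g *; rewrite mule0 adde0.
  - by move=> f g *; exact: cvg_cst.
rewrite (_ : (fun f => _) = (fun f => I j f + \sum_(j <- s) I j f)).
  exact: integral_likeD.
by apply/funext => f; rewrite big_cons.
Qed.

Lemma integral_like_int d' (Y : measurableType d') (m : {measure set Y -> \bar R})
    (I : Y -> (T -> \bar R) -> \bar R) :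
  (forall y, integral_like (I y)) ->
  (forall f, measurable_fun setT f -> (forall x, 0 <= f x) ->
    measurable_fun setT (I ^~ f)) ->
  integral_like (fun f => \int[m]_y I y f).
Proof.
move=> HI mI.
have I0 y f : (forall x, 0 <= f x) -> 0 <= I y f by have [_ h _ _ _] := HI y; exact: h.
split.
- by rewrite integral0_eq// => y _; have [] := HI y.
- by move=> f f0; apply: integral_ge0 => y _; exact: I0.
- move=> f g mf mg f0 fg.
  have g0 x : 0 <= g x by rewrite (le_trans (f0 x)).
  apply: ge0_le_integral => //.
  + by move=> y _; exact: I0.
  + exact: mI.
  + exact: mI.
  + by move=> y _; have [_ _ h _ _] := HI y; exact: h.
- move=> a f g a0 mf f0 mg g0.
  under eq_integral => y _ do have [_ _ _ -> //] := HI y.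
  rewrite ge0_integralD//.
  + rewrite ge0_integralZl//; first exact: mI.
    by move=> y _; exact: I0.
  + by move=> y _; rewrite mule_ge0// I0.
  + by apply: measurable_funeM; exact: mI.
  + by move=> y _; exact: I0.
  + exact: mI.
- move=> f g mf f0 ndf fg; apply: cvg_integral_nd.
  + by move=> n; exact: mI.
  + by move=> n y; exact: I0.
  + by move=> y a b ab; have [_ _ h _ _] := HI y; apply: h => // x; exact: ndf.
  + by move=> y; have [_ _ _ _ h] := HI y; exact: h.
Qed.

Lemma integral_like_eval x : integral_like (fun f => f x).
Proof. by split => // f g mf f0 ndf fg; exact: fg. Qed.
Lemma integral_like_integral (m : {measure set T -> \bar R}) :
  integral_like (fun f => \int[m]_x f x).
Proof. by apply: (integral_like_int m (I := fun x f => f x)) => [x|f mf f0 //]; exact: integral_like_eval. Qed.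

(** The values on indicators are sigma-additive by continuity along increasing
sequences.  Measures defined by a recursive integral formula are obtained in
this way. *)
Lemma integral_like_measure I : integral_like I ->
  exists m : {measure set T -> \bar R},
    forall f, measurable_fun setT f -> (forall x, 0 <= f x) -> I f = \int[m]_x f x.
Proof.
move=> [I0 Ige0 Ile ID Icvg].
pose m U := I (fun x => (\1_U x)%:E).
have mi (U : set T) : measurable U -> measurable_fun setT (fun x => (\1_U x)%:E : \bar R).
  by move=> mU; exact/measurable_EFinP.
have i0 (U : set T) x : 0 <= (\1_U x)%:E :> \bar R by rewrite lee_fin.
have m0 : m set0 = 0.
  by rewrite /m -[RHS]I0; congr I; apply/funext => x; rewrite indicE in_set0.
have mge0 U : 0 <= m U by exact: Ige0.
have msa : semi_sigma_additive m.
  move=> F mF tF mUF.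
  have mS n : measurable_fun setT (fun x => \sum_(0 <= i < n) (\1_(F i) x)%:E : \bar R).
    by apply: emeasurable_sum => i _; exact: mi.
  rewrite (_ : (fun n => _) = (fun n => I (fun x => \sum_(0 <= i < n) (\1_(F i) x)%:E))).
    apply: Icvg => //.
    - by move=> n x; exact: sume_ge0.
    - by move=> x; apply: ereal_nondecreasing_series => n _ _; exact: i0.
    - move=> x.
      exact: (@measure_semi_sigma_additive _ _ _ (\d_x : {measure set T -> \bar R}) F mF tF mUF).
  apply/funext; elim=> [|n ih].
    by rewrite big_nil -[LHS]I0; congr I; apply/funext => x; rewrite big_nil.
  rewrite big_nat_recr//= ih /m -[X in _ + X]mul1e addeC -ID//.
  - by congr I; apply/funext => x; rewrite big_nat_recr//= mul1e addeC.
  - exact: mi.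
  - by move=> x; exact: sume_ge0.
pose m' : {measure set T -> \bar R} :=
  HB.pack_for (Measure.type T R) m (isMeasure.Build d T R m m0 mge0 msa).
exists m'; apply: integral_like_unique => //; first exact: integral_like_integral.
by move=> A mA; rewrite integral_indic// setIT.
Qed.

End positive_functionals.

Lemma integral_like_comp {R : realType} d d' (T : measurableType d) (Y : measurableType d')
    (phi : T -> Y) (I : (T -> \bar R) -> \bar R) :
  measurable_fun setT phi -> integral_like I -> integral_like (fun f => I (f \o phi)).
Proof.
move=> mphi [I0 Ige0 Ile ID Icvg].
have mc (f : Y -> \bar R) : measurable_fun setT f -> measurable_fun setT (f \o phi).
  by move=> mf; exact: measurableT_comp.
split => //.
- by move=> f f0; apply: Ige0 => x /=.
- by move=> f g mf mg f0 fg; apply: Ile; [exact: mc|exact: mc| |] => x /=.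
- by move=> a f g a0 mf f0 mg g0; rewrite -ID//; [exact: mc|by move=> x /=|exact: mc|by move=> x /=].
- move=> f g mf f0 ndf fg; apply: Icvg.
  + by move=> n; exact: mc.
  + by move=> n x /=.
  + by move=> x m n mn /=; exact: ndf.
  + by move=> x; exact: fg.
Qed.

Definition mdens {R : realType} d (T : measurableType d) (m : {measure set T -> \bar R})
    (g : T -> \bar R) (A : set T) : \bar R := \int[m]_(x in A) g x.

Section mdens.
Context {R : realType} d (T : measurableType d) (m : {measure set T -> \bar R}) (g : T -> \bar R).
Hypotheses (mg : measurable_fun setT g) (g0 : forall x, 0 <= g x).

Let mdens0 : mdens m g set0 = 0.
Proof. by rewrite /mdens integral_set0. Qed.

Let mdens_ge0 A : 0 <= mdens m g A.
Proof. by apply: integral_ge0. Qed.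

Let mdens_sigma_additive : semi_sigma_additive (mdens m g).
Proof.
move=> F mF tF mUF; rewrite /mdens ge0_integral_bigcup//; last 1 first.
  exact: measurable_funTS.
apply: is_cvg_nneseries => n _ _; exact: integral_ge0.
Qed.

Definition mdens_measure : {measure set T -> \bar R} :=
  HB.pack_for (Measure.type T R) (mdens m g)
    (isMeasure.Build d T R (mdens m g) mdens0 mdens_ge0 mdens_sigma_additive).

Lemma mdens_measureE A : mdens_measure A = \int[m]_(x in A) g x.
Proof. by []. Qed.

Lemma integral_mdens (f : T -> \bar R) : measurable_fun setT f -> (forall x, 0 <= f x) ->
  \int[mdens_measure]_x f x = \int[m]_x (f x * g x).
Proof.
move=> mf f0; transitivity (\int[m]_x (g x * f x)); last first.
  by apply: eq_integral => x _; rewrite muleC.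
move: f mf f0; apply: integral_like_unique; first exact: integral_like_integral.
- apply: (integral_like_int m (I := fun x f => g x * f x)).
    by move=> x; apply: integral_likeZ => //; exact: integral_like_eval.
  by move=> f mf f0; exact: emeasurable_funM.
- move=> A mA; rewrite integral_indic// setIT mdens_measureE -integral_indicM.
  by apply: eq_integral => x _; rewrite muleC.
Qed.
End mdens.

(** * Lower semicontinuous functions and weak test functions *)

Section bfmeasure_borel.
Context {R : realType} {d : measure_display} {T : polishType R d}.
Local Notation M := (bfmeasure T).

Lemma mdist_ball_open (y : T) (r : R) : open [set x : T | (mdist y x < r)%R].
Proof.
rewrite openE => x /= yxr; apply/nbhs_ballP; exists (r - mdist y x)%R => /=.
  by rewrite subr_gt0.
move=> z; rewrite ballEmdist /= ltrBrDl => h.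
exact: le_lt_trans (metric_triangle _ _ _) h.
Qed.

Lemma measurable_open (U : set T) : open U -> measurable U.
Proof. by move=> oU; rewrite polish_borel; exact: sub_sigma_algebra. Qed.

Lemma metric_ball_open (y : T) (r : R) : open (ball y r).
Proof. by rewrite ballEmdist; exact: mdist_ball_open. Qed.

Lemma dense_sequence : exists e : nat -> T,
  forall x (r : R), (0 < r)%R -> exists n, (mdist (e n) x < r)%R.
Proof.
have [D /countable_injP[f finj] dD] := @polish_separable R d T.
exists (fun n => xget point [set x | D x /\ f x = n]) => x r r0.
have [y [xy Dy]] : [set y | (mdist x y < r)%R] `&` D !=set0.
  apply: dD; last exact: mdist_ball_open.
  by exists x; rewrite /= mdistxx.
exists (f y).
have /(_ _)/= [|Dz fz] := @xgetPex T point [set z | D z /\ f z = f y].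
  by exists y.
suff -> : xget point [set z | D z /\ f z = f y] = y by rewrite metric_sym.
by apply: finj => //; rewrite inE.
Qed.

Definition dense_pt : nat -> T := projT1 (cid dense_sequence).

Lemma dense_ptP x (r : R) : (0 < r)%R -> exists n, (mdist (dense_pt n) x < r)%R.
Proof. exact: (projT2 (cid dense_sequence)). Qed.

(** The cone q (1/(m+1) - d(e_n, x))^+ around a point of a dense sequence, cut at
height |t|.  The rational and integer parameters make the family countable. *)
Definition hat (c : rat * nat * nat * nat) (x : T) : R :=
  let: (t, q, m, n) := c in
  (Num.min `|ratr t| (q%:R * Num.max 0 (m.+1%:R^-1 - mdist (dense_pt n) x)))%R.

Lemma hat_ge0 c x : (0 <= hat c x)%R.
Proof.
case: c => [[[t q] m] n] /=.
by rewrite le_min normr_ge0/= mulr_ge0// le_max lexx.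
Qed.

Lemma continuous_mdist (y : T) : continuous (mdist y : T -> R).
Proof.
move=> x; apply/cvgrPdist_lt => e e0; apply/nbhs_ballP; exists e => //= z.
rewrite ballEmdist /= => xz; apply: le_lt_trans xz.
rewrite ler_norml; apply/andP; split.
  by rewrite lerNl opprB lerBlDr addrC; exact: metric_triangle.
by rewrite lerBlDr addrC (metric_sym x); exact: metric_triangle.
Qed.

Lemma continuous_hat c : continuous (hat c).
Proof.
case: c => [[[t q] m] n] x /=.
apply: (@continuous_min _ _ _ (fun x => q%:R * Num.max 0 (m.+1%:R^-1 - mdist (dense_pt n) x))%R).
  exact: cvg_cst.
apply: cvgM; first exact: cvg_cst.
apply: (@continuous_max _ _ _ (fun x => (m.+1%:R^-1 - mdist (dense_pt n) x))%R).
  exact: cvg_cst.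
apply: cvgB; first exact: cvg_cst.
exact: continuous_mdist.
Qed.

Lemma hat_test c : weak_test_function (hat c).
Proof.
split; first exact: continuous_hat.
  case: c => [[[t q] m] n]; exists `|ratr t|%R => x.
  by rewrite (ger0_norm (hat_ge0 _ _)) /hat ge_min lexx.
case: c => [[[t q] m] n]; exists (ball (dense_pt n) (m.+1%:R^-1 : R)).
  by exists (dense_pt n), (m.+1%:R^-1)%R.
move=> x; rewrite ballEmdist/= => /negP; rewrite -leNgt => h.
have -> : (Num.max 0 (m.+1%:R^-1 - mdist (dense_pt n) x) = 0)%R.
  by apply/max_idPl; rewrite subr_le0.
by rewrite mulr0; apply/min_idPr.
Qed.

Definition hats (L : seq (rat * nat * nat * nat)) (x : T) : R :=
  \big[Num.max/0%R]_(c <- L) hat c x.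

Lemma hats_ge0 L x : (0 <= hats L x)%R.
Proof. by rewrite /hats; elim: L => [|c L IH]; rewrite ?big_nil// big_cons le_max hat_ge0. Qed.

Lemma hats_le L x (s : R) : (0 <= s)%R -> (forall c, c \in L -> (hat c x <= s)%R) ->
  (hats L x <= s)%R.
Proof.
rewrite /hats => s0; elim: L => [|c L IH] H; rewrite ?big_nil// big_cons ge_max.
rewrite H ?mem_head//=; apply: IH => c' c'L; apply: H; by rewrite inE c'L orbT.
Qed.

Lemma hats_ge L x c : c \in L -> (hat c x <= hats L x)%R.
Proof.
rewrite /hats; elim: L => // c' L IH; rewrite inE big_cons le_max => /orP[/eqP->|/IH ->].
  by rewrite lexx.
by rewrite orbT.
Qed.

Lemma metric_boundedU (A B : set T) : metric_bounded A -> metric_bounded B ->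
  metric_bounded (A `|` B).
Proof.
move=> [x [r Ar]] [y [s Bs]]; exists x, (Num.max r (s + mdist x y))%R.
move=> z [/Ar|/Bs]; rewrite !ballEmdist /= lt_max => h; first by rewrite h.
apply/orP; right; apply: le_lt_trans (metric_triangle _ y _) _.
by rewrite addrC ltrD2r.
Qed.

Lemma hats_test L : weak_test_function (hats L).
Proof.
elim: L => [|c L [IHc [K IHK] [A bA IHA]]].
  have -> : hats [::] = cst 0%R by apply/funext => x; rewrite /hats big_nil.
  split; first exact: cst_continuous.
    by exists 0%R => x; rewrite normr0.
  by exists set0 => //; exists point, 0%R.
have -> : hats (c :: L) = (fun x => Num.max (hat c x) (hats L x)).
  by apply/funext => x; rewrite /hats big_cons.
have [cc [K' HK'] [A' bA' HA']] := hat_test c.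
split.
- by move=> x; apply: (@continuous_max _ _ (hat c) (hats L)); [exact: cc|exact: IHc].
- exists (Num.max K' K) => x; rewrite ger0_norm; last by rewrite le_max hat_ge0.
  rewrite ge_max !le_max -[X in (X <= K')%R || _]ger0_norm ?hat_ge0// HK' /=.
  by rewrite -[X in _ || (X <= K)%R]ger0_norm ?hats_ge0// IHK orbT.
- exists (A' `|` A); first exact: metric_boundedU.
  by move=> x /not_orP[nA' nA]; rewrite HA'// IHA// maxxx.
Qed.

(** Nonnegative lower semicontinuity. *)
Definition lsc0 (u : T -> R) := (forall x, (0 <= u x)%R) /\
  forall t, (0 <= t)%R -> open [set x | (t < u x)%R].

(** A rational level t between s and u x is exceeded by u on a ball around x.  A
cone of height t, centred at a point of the dense sequence close to x and
supported in that ball, stays below u; a steep enough slope makes it reach t at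
x. *)
Lemma lsc0_hat u x (s : R) : lsc0 u -> (s < u x)%R -> exists c,
  (forall z, (hat c z <= u z)%R) /\ (s < hat c x)%R.
Proof.
move=> [u0 uo] sux.
have [s0|s0] := leP 0%R s; last first.
  exists (0%Q, 0%N, 0%N, 0%N); split => [z|]; last exact: lt_le_trans (hat_ge0 _ _).
  by rewrite /hat/= ge_min raddf0 normr0 u0.
have [t0 /itvP ht] := rat_in_itvoo sux.
have t_gt0 : (0 < ratr t0 :> R)%R by rewrite (le_lt_trans s0)// ht.
have := uo _ (ltW t_gt0); rewrite openE => /(_ x) /=; rewrite ht => /(_ isT).
move=> /nbhs_ballP[del /= del0 hdel].
have [m] : exists k, (0 + k.+1%:R^-1 < del / 2)%R by apply: ltr_add_invr; rewrite divr_gt0.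
rewrite add0r => hm.
have [n hn] := @dense_ptP x m.+1%:R^-1 ltac:(by rewrite invr_gt0).
pose w := (m.+1%:R^-1 - mdist (dense_pt n) x)%R.
have w0 : (0 < w)%R by rewrite subr_gt0.
pose q := Num.bound (ratr t0 / w).
exists (t0, q, m, n); split => [z|]; last first.
  rewrite /hat gtr0_norm// lt_min ht /= -/w.
  rewrite (@lt_le_trans _ _ (ratr t0)) ?ht//.
  rewrite (@le_trans _ _ (q%:R * w)%R)//.
    by rewrite -ler_pdivrMr// ltW// archi_boundP// divr_ge0// ltW.
  by rewrite ler_wpM2l// le_max lexx orbT.
rewrite /hat gtr0_norm// ge_min.
have [zb|zb] := ltP (mdist (dense_pt n) z) (m.+1%:R^-1)%R; last first.
  apply/orP; right; have -> : (Num.max 0 (m.+1%:R^-1 - mdist (dense_pt n) z) = 0)%R.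
    by apply/max_idPl; rewrite subr_le0.
  by rewrite mulr0.
apply/orP; left; apply/ltW/hdel; rewrite ballEmdist /=.
apply: le_lt_trans (metric_triangle _ (dense_pt n) _) _.
rewrite (splitr del) ltrD//; last exact: lt_trans zb hm.
by rewrite metric_sym (lt_trans hn).
Qed.

(** Finite parts, increasing with N, of the countable set of hats below u. *)
Definition hats_below (u : T -> R) (N : nat) : seq (rat * nat * nat * nat) :=
  [seq c <- pmap unpickle (iota 0 N) | `[< forall z, (hat c z <= u z)%R >]].

Lemma hats_below_le u N x : (forall x, 0 <= u x)%R -> (hats (hats_below u N) x <= u x)%R.
Proof.
by move=> u0; apply: hats_le => // c; rewrite mem_filter => /andP[/asboolP].
Qed.

Lemma hats_below_nd u x : nondecreasing_seq (fun N => hats (hats_below u N) x).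
Proof.
move=> N N' NN'; apply: hats_le; first exact: hats_ge0.
move=> c cN; apply: hats_ge; move: cN; rewrite !mem_filter => /andP[-> /=].
rewrite !mem_pmap => /mapP[i]; rewrite mem_iota /= add0n => iN ->.
by apply: map_f; rewrite mem_iota /= add0n (leq_trans iN).
Qed.

(** By lsc0_hat, u is the supremum of the hats below it. *)
Lemma cvg_hats_below u x : lsc0 u -> (hats (hats_below u N) x)%:E @[N --> \oo] --> (u x)%:E.
Proof.
move=> lu; have [u0 _] := lu; apply: cvg_nd_sup.
- by move=> N N' NN'; rewrite lee_fin; exact: hats_below_nd.
- by move=> n; rewrite !lee_fin hats_ge0 hats_below_le.
- move=> s; rewrite lte_fin => /(lsc0_hat lu)[c [cu sc]].
  exists (pickle c).+1; rewrite lte_fin (lt_le_trans sc)//; apply: hats_ge.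
  rewrite mem_filter; apply/andP; split; first exact/asboolP.
  rewrite mem_pmap; apply/mapP; exists (pickle c); last by rewrite pickleK.
  by rewrite mem_iota /= add0n.
Qed.

Lemma continuous_measurable (f : T -> R) : continuous f -> measurable_fun setT f.
Proof.
move=> cf; apply/measurable_EFinP.
apply: (measurability _ (ErealGenOInfty.measurableE R)) => // _ [_ [x ->] <-].
rewrite setTI; apply: measurable_open.
rewrite [X in open X](_ : _ = f @^-1` [set y | (x < y)%R]).
  by move/continuousP : cf; apply; exact: open_gt.
by apply/seteqP; split => y /=; rewrite in_itv/= ?lte_fin andbT.
Qed.

Lemma test_integrable (mu : M) (f : T -> R) : weak_test_function f ->
  mu.-integrable setT (EFin \o f).
Proof.
move=> [cf [K HK] [A [x [r Ar]] HA]].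
have mB : measurable (ball x r) by apply: measurable_open; exact: metric_ball_open.
apply: (@le_integrable _ _ _ _ _ measurableT _ (fun y => (K * \1_(ball x r) y)%:E)).
- by apply/measurable_EFinP; exact: continuous_measurable.
- move=> y _ /=; rewrite lee_fin.
  have K0 : (0 <= K)%R := le_trans (normr_ge0 _) (HK y).
  have [yb|yb] := boolP (y \in (ball x r : set T)).
    by rewrite indicE yb mulr1 (le_trans (HK y))// ler_norm.
  rewrite HA ?normr0// => Ay; move/negP: yb; apply; rewrite inE; exact: Ar.
- have K0 : (0 <= K)%R := le_trans (normr_ge0 _) (HK point).
  have mi : measurable_fun setT (fun y => (K * \1_(ball x r) y)%:E : \bar R).
    by apply/measurable_EFinP; apply: measurable_funM => //; exact: measurable_indic.
  apply/integrableP; split => //.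
  under eq_integral => y _ do rewrite gee0_abs ?lee_fin ?mulr_ge0// EFinM.
  rewrite ge0_integralZl//; last exact/measurable_EFinP/measurable_indic.
  rewrite integral_indic// setIT lte_mul_pinfty//.
  by apply: bfmeasure_finite => //; exists x, r.
Qed.

Lemma open_test (f : T -> R) (V : set R) : weak_test_function f -> open V ->
  open [set mu : M | V (\int[mu]_x f x)%R].
Proof.
move=> tf oV; exists [set [set mu : M | V (\int[mu]_x f x)%R]]; last by rewrite bigcup_set1.
move=> _ ->; exists (finmap.fset1 (f, V)); last by rewrite set_fset1 bigcap_set1.
by move=> i; rewrite finmap.in_fset1 => /eqP ->; rewrite inE.
Qed.

Lemma measurable_open_bf (U : set M) : open U -> measurable U.
Proof. by move=> oU; exact: sub_sigma_algebra. Qed.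

Lemma measurable_int_test (f : T -> R) : weak_test_function f ->
  measurable_fun setT (fun mu : M => \int[mu]_x (f x)%:E).
Proof.
move=> tf.
have -> : (fun mu : M => \int[mu]_x (f x)%:E) = EFin \o (fun mu : M => (\int[mu]_x f x)%R).
  apply/funext => mu /=; rewrite /Rintegral fineK//.
  by apply: integrable_fin_num => //; exact: test_integrable.
apply: (measurability _ (ErealGenOInfty.measurableE R)) => // _ [_ [x ->] <-].
rewrite setTI; apply: measurable_open_bf.
rewrite [X in open X](_ : _ = [set mu : M | [set y | (x < y)%R] (\int[mu]_x f x)%R]).
  by apply: open_test => //; exact: open_gt.
by apply/seteqP; split => y /=; rewrite in_itv/= ?lte_fin andbT.
Qed.

(** Finite maxima of hats are test functions of the weak topology, so that their
integrals are continuous in the measure; monotone convergence then reaches u. *)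
Lemma measurable_int_lsc0 u : lsc0 u ->
  measurable_fun setT (fun mu : M => \int[mu]_x (u x)%:E).
Proof.
move=> lu.
apply: (@emeasurable_fun_cvg _ _ _ _
  (fun N (mu : M) => \int[mu]_x (hats (hats_below u N) x)%:E)).
  by move=> N; apply: measurable_int_test; exact: hats_test.
move=> mu _; apply: cvg_integral_nd.
- move=> n; apply/measurable_EFinP; apply: continuous_measurable.
  by have [] := hats_test (hats_below u n).
- by move=> n x; rewrite lee_fin hats_ge0.
- by move=> x N N' NN'; rewrite lee_fin; exact: hats_below_nd.
- by move=> x; exact: cvg_hats_below.
Qed.
End bfmeasure_borel.

(** * The Borel sets of the space of measures *)

Section bfmeasure_generators.
Context {R : realType} {d : measure_display} {T : polishType R d}.
Local Notation M := (bfmeasure T).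

Lemma measurable_hats L : measurable_fun [set: T] (hats L : T -> R).
Proof. by apply: continuous_measurable; have [] := @hats_test R d T L. Qed.

Definition cball (k : nat) : set T := ball (point : T) (k%:R : R).

Lemma measurable_cball k : measurable (cball k).
Proof. by apply: measurable_open; exact: metric_ball_open. Qed.

Lemma cball_nd : nondecreasing_seq cball.
Proof.
move=> m n mn; rewrite subsetEset => x; rewrite /cball !ballEmdist/= => h.
by rewrite (lt_le_trans h)// ler_nat.
Qed.

Lemma cball_cover : \bigcup_k cball k = setT.
Proof.
apply/seteqP; split => // x _; exists (Num.bound (mdist (point : T) x)) => //.
by rewrite /cball ballEmdist /= archi_boundP// mdist_ge0.
Qed.

Lemma cball_sup (A : set T) : metric_bounded A -> exists k, A `<=` cball k.
Proof.
move=> [x [r Ar]]; exists (Num.bound `|mdist (point : T) x + r|%R) => y /Ar.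
rewrite /cball !ballEmdist /= => xy.
apply: le_lt_trans (metric_triangle _ x _) _.
apply: (@le_lt_trans _ _ `|mdist (point : T) x + r|%R); last exact: archi_boundP.
by rewrite (le_trans _ (ler_norm _))// lerD2l ltW.
Qed.

Lemma cball_finite (mu : M) k : mu (cball k) < +oo.
Proof. by apply: bfmeasure_finite; [exact: measurable_cball|exists point, k%:R]. Qed.

Lemma cvg_cball (m : {measure set T -> \bar R}) A : measurable A ->
  m (A `&` cball k) @[k --> \oo] --> m A.
Proof.
move=> mA; rewrite -[in X in _ --> X](setIT A) -cball_cover setI_bigcupr.
apply: nondecreasing_cvg_mu.
- by move=> k; apply: measurableI => //; exact: measurable_cball.
- by apply: bigcupT_measurable => k; apply: measurableI => //; exact: measurable_cball.
- move=> m' n mn; rewrite subsetEset; apply: setIS.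
  by rewrite -subsetEset; exact: cball_nd.
Qed.

Lemma indic_lsc0 (U : set T) : open U -> @lsc0 R d T \1_U.
Proof.
move=> oU; split => // t t0.
have [t1|t1] := ltP t 1%R.
  rewrite (_ : [set x | _] = U)//; apply/seteqP; split => x /=; rewrite indicE.
    by apply: contraPP => xU; rewrite memNset// => /lt_geF; rewrite t0.
  by move=> Ux; rewrite mem_set.
rewrite (_ : [set x | _] = set0); first exact: open0.
apply/seteqP; split => x //=; rewrite indicE => h.
have := lt_le_trans (le_lt_trans t1 h) (ltac:(by case: (x \in U)) : ((x \in U)%:R <= 1 :> R)%R).
by rewrite ltxx.
Qed.

Lemma ev_open (U : set T) : open U -> measurable_fun setT (fun mu : M => mu U).
Proof.
move=> oU; rewrite (_ : (fun mu : M => mu U) = (fun mu : M => \int[mu]_x (\1_U x)%:E)).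
  exact: (measurable_int_lsc0 (indic_lsc0 oU)).
by apply/funext => mu; rewrite integral_indic ?setIT//; exact: measurable_open.
Qed.

(** For an open set the evaluation is the integral of a lower semicontinuous
function.  The Dynkin argument is carried out inside a ball, where the measures
are finite and masses of complements are differences. *)
Lemma ev_measurable (A : set T) : measurable A -> measurable_fun setT (fun mu : M => mu A).
Proof.
pose H := [set A | measurable A /\ forall k, measurable_fun setT (fun mu : M => mu (A `&` cball k))].
move=> mA; suff : H A.
  move=> [_ HA]; apply: (@emeasurable_fun_cvg _ _ _ _ (fun k (mu : M) => mu (A `&` cball k))) => //.
  by move=> mu _; exact: cvg_cball.
move: A mA; rewrite [X in forall A, X A -> _](polish_borel : (@measurable d T : set (set T)) = _).
apply: lambda_system_subset => //.
- by move=> A B; exact: openI.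
- split => //.
  + split => // k; rewrite setTI; apply: ev_open; exact: metric_ball_open.
  + move=> A B BA [mA HA] [mB HB]; split; first exact: measurableD.
    move=> k; rewrite (_ : (fun mu : M => _) =
      (fun mu : M => mu (A `&` cball k) - mu (B `&` cball k))).
      exact: emeasurable_funB.
    apply/funext => mu.
    rewrite (_ : (A `\` B) `&` cball k = (A `&` cball k) `\` B); last by rewrite !setDE setIAC.
    rewrite measureD; last 3 first.
    * by apply: measurableI => //; exact: measurable_cball.
    * exact: mB.
    * apply: le_lt_trans (cball_finite mu k); apply: le_measure; rewrite ?inE//.
      - by apply: measurableI => //; exact: measurable_cball.
      - exact: measurable_cball.
    rewrite (_ : A `&` cball k `&` B = B `&` cball k)//.
    by rewrite setIAC (setIidr BA).
  + move=> F ndF HF; split; first by apply: bigcupT_measurable => n; have [] := HF n.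
    move=> k; apply: (@emeasurable_fun_cvg _ _ _ _ (fun n (mu : M) => mu (F n `&` cball k))).
      by move=> n; have [_] := HF n.
    move=> mu _; rewrite setI_bigcupl; apply: nondecreasing_cvg_mu.
    * by move=> n; apply: measurableI; [by have [] := HF n|exact: measurable_cball].
    * by apply: bigcupT_measurable => n; apply: measurableI; [by have [] := HF n|exact: measurable_cball].
    * by move=> m n mn; rewrite subsetEset; apply: setSI; rewrite -subsetEset; exact: ndF.
- move=> U oU; split; first exact: measurable_open.
  by move=> k; apply: ev_open; apply: openI => //; exact: metric_ball_open.
Qed.

Definition gcode := ((seq (rat * nat * nat * nat) * rat) + (nat * rat))%type.

(** Elementary events, countably many.  Those of the first kind bound integrals
from below; the second kind supplies upper bounds on masses, which integrals of
lower semicontinuous functions do not give. *)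
Definition gevent (c : gcode) : set M :=
  match c with
  | inl (L, q) => [set mu | (ratr q)%:E < \int[mu]_x (hats L x)%:E]
  | inr (k, q) => [set mu | mu (cball k) < (ratr q)%:E]
  end.

Definition gevents (l : seq gcode) : set M := [set mu | forall c, c \in l -> gevent c mu].

Lemma gevents_nil : gevents [::] = setT.
Proof. by apply/seteqP; split. Qed.

Lemma gevents_cat l1 l2 : gevents (l1 ++ l2) = gevents l1 `&` gevents l2.
Proof.
apply/seteqP; split => mu.
  by move=> h; split => c cl; apply: h; rewrite mem_cat cl ?orbT.
by move=> [h1 h2] c; rewrite mem_cat => /orP[/h1|/h2].
Qed.

Lemma gevents_cons c l : gevents (c :: l) = gevent c `&` gevents l.
Proof.
rewrite -cat1s gevents_cat; congr (_ `&` _).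
by apply/seteqP; split => mu => [|h c']; [apply; rewrite mem_head|rewrite inE => /eqP ->].
Qed.

Lemma measurable_gevent c : measurable (gevent c).
Proof.
case: c => [[L q]|[k q]] /=.
  rewrite -[X in measurable X]setTI; apply: emeasurable_fun_o_infty => //.
  exact: (measurable_int_test (hats_test L)).
rewrite -[X in measurable X]setTI; apply: emeasurable_fun_infty_o => //.
exact: (ev_measurable (measurable_cball k)).
Qed.

(** A test function f may take negative values, but f + K 1_B is nonnegative and
lower semicontinuous if B is an open ball containing the support of f and K is
a bound of |f|.  Its integral is that of f plus K mu(B): a lower bound for a
maximum of hats below f + K 1_B and an upper bound for mu(B) bound the integral
of f from below. *)
Lemma test_lower (f : T -> R) (a : R) (mu0 : M) : weak_test_function f ->
  (a < \int[mu0]_x f x)%R ->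
  exists l, gevents l mu0 /\ forall mu, gevents l mu -> (a < \int[mu]_x f x)%R.
Proof.
move=> tf aI; have [cf [K' HK'] [A bA HA]] := tf.
have [k Ak] := cball_sup bA.
pose K := (`|K'| + 1)%R.
have K0 : (0 < K)%R by rewrite ltr_wpDl.
have HK x : (- K <= f x)%R.
  have := HK' x; rewrite ler_norml => /andP[h _]; apply: le_trans h.
  by rewrite lerN2 (le_trans (ler_norm _))// lerDl.
pose B := cball k; have mB : measurable B := measurable_cball k.
pose u x := (f x + K * \1_B x)%R.
have fB0 x : ~ B x -> f x = 0%R by move=> nB; apply: HA => /Ak.
have lu : lsc0 u.
  split => [x|t t0].
    rewrite /u indicE; have [/set_mem xB|xB] := boolP (x \in B).
      by rewrite mulr1 -lerBlDr sub0r.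
    by rewrite mulr0 addr0 fB0//; move/negP : xB => + xB; apply; rewrite inE.
  rewrite (_ : [set x | _] = B `&` f @^-1` [set y | (t - K < y)%R]).
    apply: openI; first exact: metric_ball_open.
    by move/continuousP : cf; apply; exact: open_gt.
  apply/seteqP; split => x /=; rewrite /u indicE.
    have [/set_mem xB|xB] := boolP (x \in B).
      by rewrite mulr1 ltrBlDr; split.
    rewrite mulr0 addr0 fB0; last by move/negP : xB => + xB; apply; rewrite inE.
    by rewrite ltNge t0.
  by move=> [xB h]; rewrite mem_set// mulr1 -ltrBlDr.
pose I (mu : M) := (\int[mu]_x f x)%R.
pose m (mu : M) := fine (mu B).
have mE (mu : M) : mu B = (m mu)%:E.
  by rewrite fineK// ge0_fin_numE//; exact: cball_finite.
have IE (mu : M) : \int[mu]_x (f x)%:E = (I mu)%:E.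
  by rewrite fineK//; apply: integrable_fin_num => //; exact: test_integrable.
have uE (mu : M) : \int[mu]_x (u x)%:E = (I mu + K * m mu)%:E.
  have iB : mu.-integrable setT (fun x => (K * \1_B x)%:E).
    have mi : measurable_fun setT (fun y => (K * \1_B y)%:E : \bar R).
      by apply/measurable_EFinP; apply: measurable_funM => //; exact: measurable_indic.
    apply/integrableP; split => //.
    under eq_integral => y _ do rewrite gee0_abs ?lee_fin ?mulr_ge0// ?ltW// EFinM.
    rewrite ge0_integralZl//; [|exact/measurable_EFinP/measurable_indic|by rewrite lee_fin ltW].
    by rewrite integral_indic// setIT lte_mul_pinfty ?lee_fin ?ltW//; exact: cball_finite.
  rewrite /u; under eq_integral => x _ do rewrite EFinD.
  rewrite integralD//; last exact: test_integrable.
  rewrite IE EFinD; congr (_ + _).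
  under eq_integral => y _ do rewrite EFinM.
  rewrite ge0_integralZl//; [|exact/measurable_EFinP/measurable_indic|by rewrite lee_fin ltW].
  by rewrite integral_indic// setIT mE.
pose del := (I mu0 - a)%R; have del0 : (0 < del)%R by rewrite subr_gt0.
(* The thresholds c1 and c2 share the gap between the integral of f and a
   equally. *)
have [c2 /itvP hc2] : exists q : rat, ratr q \in `](m mu0), (m mu0 + del / (2 * K))%R[.
  by apply: rat_in_itvoo; rewrite ltrDl divr_gt0// mulr_gt0.
pose lo := (I mu0 + K * m mu0 - del / 2)%R.
have [N hN] : exists N, lo%:E < \int[mu0]_x (hats (hats_below u N) x)%:E.
  apply: contrapT => /forallNP h.
  have : \int[mu0]_x (hats (hats_below u N) x)%:E @[N --> \oo] --> \int[mu0]_x (u x)%:E.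
    apply: cvg_integral_nd.
    - move=> n; apply/measurable_EFinP; exact: measurable_hats.
    - by move=> n x; rewrite lee_fin hats_ge0.
    - by move=> x n n' nn'; rewrite lee_fin; exact: hats_below_nd.
    - by move=> x; exact: cvg_hats_below.
  move=> cv; have : \int[mu0]_x (u x)%:E <= lo%:E.
    by apply: cvge_le cv; apply: nearW => N; rewrite leNgt; exact/negP.
  by rewrite uE lee_fin /lo; lra.
pose L := hats_below u N; rewrite -/L in hN.
have LuE (mu : M) : \int[mu]_x (hats L x)%:E <= \int[mu]_x (u x)%:E.
  apply: ge0_le_integral => //.
  - by move=> x _; rewrite lee_fin hats_ge0.
  - apply/measurable_EFinP; exact: measurable_hats.
  - apply/measurable_EFinP; apply: measurable_funD; first exact: continuous_measurable.
    by apply: measurable_funM => //; exact: measurable_indic.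
  - by move=> x _; rewrite lee_fin; apply: hats_below_le; case: lu.
pose v := (\int[mu0]_x hats L x)%R.
have vE : \int[mu0]_x (hats L x)%:E = v%:E.
  by rewrite fineK//; apply: integrable_fin_num => //; exact: (test_integrable _ (hats_test L)).
have [c1 /itvP hc1] : exists q : rat, ratr q \in `]lo, v[.
  by apply: rat_in_itvoo; rewrite -lte_fin -vE.
exists [:: inl (L, c1); inr (k, c2)]; split.
  move=> c; rewrite !inE => /orP[/eqP ->|/eqP ->] /=.
    by rewrite vE lte_fin hc1.
  by rewrite -/B mE lte_fin hc2.
move=> mu hmu.
have := hmu (inl (L, c1)) ltac:(by rewrite inE eqxx) => /= h1.
have := hmu (inr (k, c2)) ltac:(by rewrite !inE eqxx orbT) => /=; rewrite -/B mE lte_fin => h2.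
have := lt_le_trans h1 (LuE mu); rewrite uE lte_fin => h3.
have h4 : (ratr c2 < m mu0 + del / (2 * K))%R by rewrite hc2.
have h5 : (lo < ratr c1)%R by rewrite hc1.
have h6 : (K * ratr c2 < K * m mu0 + del / 2)%R.
  rewrite (_ : del / 2 = K * (del / (2 * K)))%R.
    by rewrite -mulrDr ltr_pM2l.
  by field; rewrite lt0r_neq0.
have h7 : (K * m mu < K * ratr c2)%R by rewrite ltr_pM2l.
rewrite -/(I mu); move: h3 h5 h6 h7; rewrite /lo /del; lra.
Qed.

(** Upper bounds for the integral of f are lower bounds for that of - f. *)
Lemma test_nbhs (f : T -> R) (V : set R) (mu0 : M) : weak_test_function f -> open V ->
  V (\int[mu0]_x f x)%R ->
  exists l, gevents l mu0 /\ forall mu, gevents l mu -> V (\int[mu]_x f x)%R.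
Proof.
move=> tf; rewrite openE => /[apply] /nbhs_ballP[e /= e0 he].
have tNf : weak_test_function (fun x => - f x)%R.
  have [cf [K HK] [A bA HA]] := tf; split.
  - by move=> x; apply: cvgN; exact: cf.
  - by exists K => x; rewrite normrN.
  - by exists A => // x /HA ->; rewrite oppr0.
have NE (mu : M) : (\int[mu]_x (- f x) = - \int[mu]_x f x)%R.
  rewrite /Rintegral; under eq_integral do rewrite EFinN.
  rewrite integralN ?fineN//.
  exact: integrable_add_def (test_integrable mu tf).
have [|l1 [l1mu h1]] := @test_lower f (\int[mu0]_x f x - e)%R mu0 tf.
  by rewrite ltrBlDr ltrDl.
have [|l2 [l2mu h2]] := @test_lower _ (\int[mu0]_x (- f x) - e)%R mu0 tNf.
  by rewrite ltrBlDr ltrDl.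
exists (l1 ++ l2); rewrite gevents_cat; split => // mu [/h1 + /h2].
rewrite !NE => H1 H2; apply: he; rewrite /ball/= ltr_norml.
by move: H1 H2; lra.
Qed.

(** The weak topology thus has a countable base, and each of its open sets is a
countable union of elementary events. *)
Lemma open_gevents (U : set M) (mu0 : M) : open U -> U mu0 ->
  exists l, gevents l mu0 /\ gevents l `<=` U.
Proof.
move=> [D' D'sub <-] [V D'V Vmu].
have [F FD FV] := D'sub _ D'V.
suff [l [lmu lV]] : exists l, gevents l mu0 /\ gevents l `<=` V.
  by exists l; split => // mu /lV Vmu'; exists V.
rewrite -FV in Vmu *.
have {FD Vmu} H (i : (T -> R) * set R) : i \in finmap.enum_fset F ->
    exists l, gevents l mu0 /\ forall mu, gevents l mu -> i.2 (\int[mu]_x i.1 x)%R.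
  move=> iF; have := FD _ iF; rewrite inE => -[t1 o2].
  by apply: test_nbhs => //; exact: Vmu.
suff : exists l, gevents l mu0 /\ forall mu, gevents l mu ->
    forall i : (T -> R) * set R, i \in finmap.enum_fset F -> i.2 (\int[mu]_x i.1 x)%R.
  by move=> [l [lmu h]]; exists l; split => // mu /h hmu i /= iF; exact: hmu.
elim: (finmap.enum_fset F) H => [_|i s ih H].
  by exists [::]; rewrite gevents_nil.
have [|l [lmu hl]] := ih; first by move=> j js; apply: H; rewrite inE js orbT.
have [l' [l'mu hl']] := H i (mem_head _ _).
exists (l' ++ l); rewrite gevents_cat; split => // mu [m1 m2] j.
by rewrite inE => /orP[/eqP ->|js]; [exact: hl'|exact: hl].
Qed.

Lemma sub_gevents (G : set (set M)) : sigma_algebra setT G -> (forall c, G (gevent c)) ->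
  forall A : set M, measurable A -> G A.
Proof.
move=> sG Gc; apply: smallest_sub => // U oU.
pose GT := g_sigma_algebraType G.
have GE : <<s G >> = G.
  by apply/seteqP; split; [exact: smallest_sub|exact: sub_sigma_algebra].
have Gl l : @measurable _ GT (gevents l).
  elim: l => [|c l ih]; first by rewrite gevents_nil; exact: (@measurableT _ GT).
  by rewrite gevents_cons; apply: (@measurableI _ GT) => //; exact: sub_sigma_algebra.
pose F (n : nat) := if (unpickle n : option (seq gcode)) is Some l then
  if `[< gevents l `<=` U >] then gevents l else set0 else set0.
have mF n : @measurable _ GT (F n).
  rewrite /F; case: unpickle => [l|]; last exact: (@measurable0 _ GT).
  by case: ifPn => _; [exact: Gl|exact: (@measurable0 _ GT)].
suff -> : U = \bigcup_n F n.
  by rewrite -[G]GE; exact: (@bigcupT_measurable _ GT).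
apply/seteqP; split => mu.
  move=> Umu; have [l [lmu lU]] := open_gevents oU Umu.
  by exists (pickle l) => //; rewrite /F pickleK asboolT.
by move=> [n _]; rewrite /F; case: unpickle => // l; case: ifPn => // /asboolP; apply.
Qed.

(** The generator is countable and closed under intersection: laws which agree on
it are equal, and the almost sure equality of two kernels can be checked on
countably many events. *)
Lemma bf_measurableE : (@measurable _ M : set (set M)) = <<s range gevents >>.
Proof.
apply/seteqP; split.
  apply: sub_gevents; first exact: smallest_sigma_algebra.
  move=> c; apply: sub_sigma_algebra; exists [:: c] => //.
  by rewrite gevents_cons gevents_nil setIT.
apply: smallest_sub; first exact: sigma_algebra_measurable.
move=> _ [l _ <-]; elim: l => [|c l ih]; first by rewrite gevents_nil.
by rewrite gevents_cons; apply: measurableI => //; exact: measurable_gevent.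
Qed.

Lemma gevents_setI_closed : setI_closed (range gevents).
Proof. by move=> _ _ [l1 _ <-] [l2 _ <-]; exists (l1 ++ l2) => //; rewrite gevents_cat. Qed.

(** Elementary events involve the measure through integrals, which are limits of
combinations of evaluations. *)
Lemma measurable_to_bf dY (Y : measurableType dY) (f : Y -> M) :
  (forall A, measurable A -> measurable_fun setT (fun y => f y A)) -> measurable_fun setT f.
Proof.
move=> mf _ B mB; rewrite setTI; move: B mB; apply: sub_gevents.
  split => [|A mA|F mF].
  - by rewrite preimage_set0.
  - by rewrite setTD preimage_setC; exact: measurableC.
  - by rewrite preimage_bigcup; exact: bigcupT_measurable.
case => [[L q]|[k q]] /=.
  rewrite [X in measurable X](_ : _ = setT `&` [set y | (ratr q)%:E < \int[f y]_x (hats L x)%:E]); last by rewrite setTI.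
  apply: emeasurable_fun_o_infty => //.
  apply: (@measurable_fun_integral_kernel _ _ _ _ _ (fun y => f y : {measure set T -> \bar R})).
  - exact: mf.
  - by move=> x; rewrite lee_fin hats_ge0.
  - by apply/measurable_EFinP; exact: measurable_hats.
rewrite [X in measurable X](_ : _ = setT `&` [set y | f y (cball k) < (ratr q)%:E]); last by rewrite setTI.
by apply: emeasurable_fun_infty_o => //; apply: mf; exact: measurable_cball.
Qed.

(** A second generator closed under intersection.  Its events compare values
mu(A_i) with thresholds, which is the form of the events in the Mecke equation. *)
Definition ray_events : set (set M) := [set E | exists k (A : 'I_k -> set T) (b : 'I_k -> R),
  (forall i, measurable (A i)) /\ E = [set mu : M | forall i, (b i)%:E < mu (A i)]].

Lemma ray_events_setI_closed : setI_closed ray_events.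
Proof.
move=> _ _ [k1 [A1 [b1 [mA1 ->]]]] [k2 [A2 [b2 [mA2 ->]]]].
exists (k1 + k2)%N, (fun i => match fintype.split i with inl j => A1 j | inr j => A2 j end),
  (fun i => match fintype.split i with inl j => b1 j | inr j => b2 j end).
split; first by move=> i; case: fintype.split.
apply/seteqP; split => mu.
  by move=> [h1 h2] i; case: fintype.split.
move=> h; split => i.
  by have := h (lshift k2 i); rewrite (unsplitK (inl i)).
by have := h (rshift k1 i); rewrite (unsplitK (inr i)).
Qed.

Lemma ray_eventsT : ray_events setT.
Proof. by exists 0%N, (fun=> set0), (fun=> 0%R); split => //; apply/seteqP; split => // mu _ []. Qed.

Lemma measurable_ray_events : (@measurable _ M : set (set M)) = <<s ray_events >>.
Proof.
apply/seteqP; split.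
  move=> B mB.
  suff /(_ measurableT B mB) : @measurable_fun _ _ (g_sigma_algebraType ray_events) M setT id.
    by rewrite setTI.
  apply: measurable_to_bf => A mA.
  apply: (measurability _ (ErealGenOInfty.measurableE R)) => // _ [_ [x ->] <-].
  rewrite setTI; apply: sub_sigma_algebra; exists 1%N, (fun=> A), (fun=> x); split => //.
  apply/seteqP; split => y /=; rewrite in_itv/= ?andbT.
    by move=> h _.
  by move=> /(_ ord0).
apply: smallest_sub; first exact: sigma_algebra_measurable.
move=> _ [k [A [b [mA ->]]]].
rewrite (_ : [set mu | _] = \bigcap_(i in [set: 'I_k]) [set mu : M | (b i)%:E < mu (A i)]).
  apply: fin_bigcap_measurable => // i _.
  rewrite -[X in measurable X]setTI; apply: emeasurable_fun_o_infty => //.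
  exact: ev_measurable.
by apply/seteqP; split => mu h i; [move=> _|]; exact: h.
Qed.
End bfmeasure_generators.

(** * Atoms, total mass and normalization *)

Section bfmeasure_maps.
Context {R : realType} {d : measure_display} {T : polishType R d}.
Local Notation M := (bfmeasure T).

(** Truncation at zero makes the addition of an atom of mass s a total operation. *)
Definition pos (s : R) : R := Num.max s 0%R.

Lemma pos_ge0 s : (0 <= pos s)%R.
Proof. by rewrite /pos le_max lexx orbT. Qed.

Lemma measurable_pos : measurable_fun setT pos.
Proof. exact: measurable_maxr. Qed.

Lemma eq_bfmeasure (mu nu : M) : (forall A, mu A = nu A) -> mu = nu.
Proof.
case: mu nu => [m1 f1] [m2 f2] /= E.
have ? : m1 = m2 by apply: eq_measure; apply/funext.
by subst m2; congr BFMeasure; exact: Prop_irrelevance.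
Qed.

Section addatom.
Variables (mu : M) (x : T) (s : R).

Definition addatom_measure : {measure set T -> \bar R} :=
  measure_add mu (mscale (NngNum (pos_ge0 s)) (dirac x)).

Lemma addatom_measureE A : addatom_measure A = mu A + (pos s)%:E * \d_x A.
Proof. exact: measure_addE. Qed.

Lemma addatom_bounded A : measurable A -> metric_bounded A -> addatom_measure A < +oo.
Proof.
move=> mA bA; rewrite addatom_measureE lte_add_pinfty//; first exact: bfmeasure_finite.
by rewrite diracE -EFinM ltry.
Qed.

Definition addatom : M := BFMeasure addatom_bounded.

Lemma addatomE A : addatom A = mu A + (pos s)%:E * (\1_A x)%:E.
Proof. by rewrite [LHS]addatom_measureE diracE indicE. Qed.
End addatom.

Lemma addatomC mu x s y t : addatom (addatom mu x s) y t = addatom (addatom mu y t) x s.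
Proof. by apply: eq_bfmeasure => A; rewrite !addatomE addeAC. Qed.

Lemma measurable_addatom dY (Y : measurableType dY) (f : Y -> M) (g : Y -> T) (h : Y -> R) :
  measurable_fun setT f -> measurable_fun setT g -> measurable_fun setT h ->
  measurable_fun setT (fun y => addatom (f y) (g y) (h y)).
Proof.
move=> mf mg mh; apply: measurable_to_bf => A mA.
under eq_fun do rewrite addatomE.
apply: emeasurable_funD; first exact: measurableT_comp (ev_measurable mA) mf.
apply: emeasurable_funM.
  apply/measurable_EFinP; exact: measurableT_comp measurable_pos mh.
apply/measurable_EFinP; exact: measurableT_comp (measurable_indic mA) mg.
Qed.

Lemma measurable_total_mass : measurable_fun setT (@total_mass R d T).
Proof. exact: measurableT_comp (ev_measurable measurableT). Qed.

Lemma total_mass_ge0 (mu : M) : (0 <= total_mass mu)%R.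
Proof. exact: fine_ge0. Qed.

Lemma normalizationE (mu : M) A : 0 < mu setT -> mu setT < +oo ->
  normalization mu A = mu A * ((total_mass mu)^-1)%:E.
Proof.
move=> mu0 muoo; rewrite /normalization/= /mnormalize/=.
by rewrite gt_eqF// lt_eqF.
Qed.

Lemma measurable_normalization : measurable_fun setT (@normalization R d T).
Proof.
apply: measurable_to_bf => A mA.
have mT := @ev_measurable R d T _ measurableT.
rewrite (_ : (fun mu : M => _) = (fun mu : M =>
  if (mu setT == 0) || (mu setT == +oo) then \d_(point : T) A
  else mu A * ((total_mass mu)^-1)%:E)); last first.
  by apply/funext => mu; rewrite /normalization/= /mnormalize/=; case: ifP.
apply: measurable_fun_ifT.
- apply: measurable_or; [exact: measurable_fun_eqe|exact: measurable_fun_eqe].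
- exact: measurable_cst.
- apply: emeasurable_funM; first exact: ev_measurable.
  apply/measurable_EFinP.
  rewrite (_ : (fun mu : M => _) = (fun mu => total_mass mu `^ (-1))%R); last first.
    by apply/funext => mu; rewrite powR_inv1// total_mass_ge0.
  exact: measurableT_comp (measurable_powR _) measurable_total_mass.
Qed.
End bfmeasure_maps.

(** * Mutual independence *)

Section independence_theory.
Context {R : realType} {dW : measure_display} {W : measurableType dW}.
Variable P : probability W R.

Lemma mutually_independentS (I : finType) (F G : I -> set (set W)) :
  (forall i, F i `<=` G i) -> mutually_independent P G -> mutually_independent P F.
Proof. by move=> FG iG J A FA; apply: iG => i iJ; exact/FG/FA. Qed.

Lemma bigcapsD1 (I : finType) (J : {set I}) (A : I -> set W) i0 : i0 \in J ->
  \bigcap_(i in [set` J]) A i = A i0 `&` \bigcap_(i in [set` (J :\ i0)%SET]) A i.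
Proof.
move=> iJ; apply/seteqP; split => w.
  by move=> h; split => [|i /=]; [exact: h|rewrite finset.inE => /andP[_ ?]; exact: h].
move=> [h0 h] i /= ij; have [->//|ni] := eqVneq i i0.
by apply: h => /=; rewrite finset.inE finset.in_set1 ni.
Qed.

Lemma measurable_bigcaps (I : finType) (J : {set I}) (A : I -> set W) :
  (forall i, i \in J -> measurable (A i)) -> measurable (\bigcap_(i in [set` J]) A i).
Proof. by move=> mA; apply: fin_bigcap_measurable => // i /=; exact: mA. Qed.

(** Both sides are finite measures in A, whence the Dynkin argument. *)
Lemma independent_ext1 (Pi : set (set W)) (B : set W) (p : \bar R) :
  setI_closed Pi -> Pi `<=` measurable -> measurable B -> p \is a fin_num ->
  P B = p -> (forall A, Pi A -> P (A `&` B) = P A * p) ->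
  forall A, <<s Pi >> A -> P (A `&` B) = P A * p.
Proof.
move=> PiI Pim mB pfin PB PiE.
pose H := [set A | measurable A /\ P (A `&` B) = P A * p].
suff HH : <<s Pi >> `<=` H by move=> A /HH[].
have Pfin A : measurable A -> P A \is a fin_num by move=> mA; exact: fin_num_measure.
apply: lambda_system_subset => //.
  split => //.
  - by split; [exact: measurableT|rewrite setTI probability_setT mul1e].
  - move=> X Y YX [mX hX] [mY hY]; split; first exact: measurableD.
    rewrite (_ : (X `\` Y) `&` B = (X `&` B) `\` (Y `&` B)); last first.
      apply/seteqP; split => w /=; first by move=> [[Xw nYw] Bw]; split => // -[].
      by move=> [[Xw Bw] nYB]; split => //; split => // Yw; exact: nYB.
    have PD A1 A2 : measurable A1 -> measurable A2 -> A2 `<=` A1 ->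
        P (A1 `\` A2) = P A1 - P A2.
      move=> m1 m2 A21; rewrite measureD// ?(setIidr A21)//.
      by rewrite ltey_eq Pfin.
    rewrite !PD//; [|exact: measurableI|exact: measurableI|exact: setSI].
    by rewrite hX hY muleBl// fin_num_adde_defl// fin_numN Pfin.
  - move=> F ndF HF.
    have mF n : measurable (F n) by have [] := HF n.
    have mU : measurable (\bigcup_n F n) by exact: bigcupT_measurable.
    split => //.
    have c1 : P (F n `&` B) @[n --> \oo] --> P (\bigcup_n F n `&` B).
      rewrite setI_bigcupl; apply: nondecreasing_cvg_mu.
      + by move=> n; exact: measurableI.
      + by apply: bigcupT_measurable => n; exact: measurableI.
      + by move=> m n mn; rewrite subsetEset; apply: setSI; rewrite -subsetEset; exact: ndF.
    have c2 : P (F n) * p @[n --> \oo] --> P (\bigcup_n F n) * p.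
      by apply: cvgeZr => //; exact: nondecreasing_cvg_mu.
    apply: (cvg_unique _ c1) => //.
    rewrite (_ : (fun n => P (F n `&` B)) = (fun n => P (F n) * p))//.
    by apply/funext => n; have [] := HF n.
by move=> A PA; split; [exact: Pim|exact: PiE].
Qed.

Lemma fin_num_prodP (I : finType) (J : {set I}) (A : I -> set W) :
  (forall i, i \in J -> measurable (A i)) ->
  \prod_(i in J) P (A i) \is a fin_num.
Proof.
move=> mA; apply: (big_ind (fun x => x \is a fin_num)) => //.
  by move=> x y; exact: fin_numM.
by move=> i iJ; apply: fin_num_measure; exact: mA.
Qed.

(** The families are replaced by the sigma-algebras that they generate one index
at a time, independent_ext1 being applied with the remaining events fixed. *)
Lemma mutually_independent_ext (I : finType) (Pi : I -> set (set W)) :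
  (forall i, Pi i `<=` measurable) -> (forall i, setI_closed (Pi i)) ->
  mutually_independent P Pi -> mutually_independent P (fun i => <<s Pi i >>).
Proof.
move=> Pim PiI iPi.
have sPim i : <<s Pi i >> `<=` measurable.
  by apply: smallest_sub; [exact: sigma_algebra_measurable|exact: Pim].
pose F (s : seq I) i := if i \in s then <<s Pi i >> else Pi i.
have Fm s i : F s i `<=` measurable by rewrite /F; case: ifPn.
suff H s : mutually_independent P (F s).
  by apply: mutually_independentS (H (enum I)) => i; rewrite /F mem_enum.
elim: s => [|i0 s ih]; first exact: iPi.
move=> J A FA.
have [i0J|i0J] := boolP (i0 \in J); last first.
  apply: ih => i iJ; have := FA i iJ; rewrite /F inE; case: eqVneq => //= ii0.
  by rewrite -ii0 iJ in i0J.
rewrite (bigcapsD1 _ i0J) (big_setD1 _ i0J)/=.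
have mA i : i \in J -> measurable (A i) by move=> iJ; apply: Fm; exact: FA.
have FA' i : i \in (J :\ i0)%SET -> F s i (A i).
  rewrite finset.in_setD1 => /andP[ni iJ]; have := FA i iJ.
  by rewrite /F inE (negbTE ni).
have := FA i0 i0J; rewrite {1}/F inE eqxx /= => sA0.
have [i0s|i0s] := boolP (i0 \in s).
  rewrite -(big_setD1 _ i0J) -(bigcapsD1 _ i0J); apply: ih => i iJ.
  have := FA i iJ; rewrite /F inE; case: eqVneq => //= ->.
  by rewrite i0s.
apply: (@independent_ext1 (Pi i0)) => //.
- by apply: measurable_bigcaps => i /finset.setD1P[_ ?]; exact: mA.
- by apply: fin_num_prodP => i /finset.setD1P[_ ?]; exact: mA.
- exact: ih.
- move=> X PX.
  pose A' i := if i == i0 then X else A i.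
  have h1 : \bigcap_(i in [set` J]) A' i = X `&` \bigcap_(i in [set` (J :\ i0)%SET]) A i.
    rewrite (bigcapsD1 _ i0J) {1}/A' eqxx; congr (_ `&` _).
    by apply: eq_bigcapr => i /= /finset.setD1P[ni _]; rewrite /A' (negbTE ni).
  rewrite -h1 ih.
    rewrite (big_setD1 _ i0J)/= {1}/A' eqxx; congr (_ * _).
    by apply: eq_bigr => i /finset.setD1P[ni _]; rewrite /A' (negbTE ni).
  move=> i iJ; rewrite /A'; case: eqVneq => [->|ni]; first by rewrite /F (negbTE i0s).
  by apply: FA'; rewrite finset.in_setD1 ni.
Qed.

(** The intersections of one event for each index of a group are closed under
intersection and generate the sigma-algebra of the group. *)
Lemma mutually_independent_group (I K : finType) (g : I -> K) (F : I -> set (set W)) :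
  (forall i, F i `<=` measurable) -> (forall i, setI_closed (F i)) -> (forall i, F i setT) ->
  mutually_independent P F ->
  mutually_independent P (fun k => <<s \bigcup_(i in [set i | g i = k]) F i >>).
Proof.
move=> Fm FI FT iF.
pose Pi k := [set B | exists A : I -> set W, (forall i, F i (A i)) /\
  B = \bigcap_(i in [set` [set i | g i == k]%SET]) A i].
have Pim k : Pi k `<=` measurable.
  by move=> _ [A [FA ->]]; apply: measurable_bigcaps => i _; exact/Fm/FA.
have PiI k : setI_closed (Pi k).
  move=> _ _ [A [FA ->]] [B [FB ->]]; exists (fun i => A i `&` B i).
  by split; [move=> i; exact: FI|rewrite bigcapI].
suff iPi : mutually_independent P Pi.
  have := mutually_independent_ext Pim PiI iPi.
  apply: mutually_independentS => k; apply: sub_smallest2r; first exact: smallest_sigma_algebra.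
  move=> B [i /= gi FB]; exists (fun j => if j == i then B else setT); split.
    by move=> j; case: eqVneq => [->|].
  apply/seteqP; split => w; first by move=> Bw j _; case: eqVneq.
  by move/(_ i); rewrite /= finset.inE gi !eqxx; apply.
move=> J B PiB.
have /choice[A HA] : forall k, exists A : I -> set W, k \in J -> (forall i, F i (A i)) /\
    B k = \bigcap_(i in [set` [set i | g i == k]%SET]) A i.
  move=> k; have [kJ|kJ] := boolP (k \in J); last by exists (fun=> setT).
  by have [A hA] := PiB k kJ; exists A.
pose A' i := A (g i) i.
have BE k : k \in J -> B k = \bigcap_(i in [set` [set i | g i == k]%SET]) A' i.
  move=> kJ; rewrite (HA k kJ).2; apply: eq_bigcapr => i /=.
  by rewrite finset.inE => /eqP gi; rewrite /A' gi.
have -> : \bigcap_(k in [set` J]) B k = \bigcap_(i in [set` [set i | g i \in J]%SET]) A' i.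
  apply/seteqP; split => w h.
    move=> i /=; rewrite finset.inE => gJ; have := h _ gJ; rewrite BE//; apply => /=.
    by rewrite finset.inE.
  move=> k /= kJ; rewrite BE// => i /=; rewrite finset.inE => /eqP gi.
  by apply: h => /=; rewrite finset.inE gi.
rewrite iF; last by move=> i; rewrite finset.inE => gJ; exact: (HA _ gJ).1.
rewrite (partition_big g (mem J))/=; last by move=> i; rewrite finset.inE.
apply: eq_bigr => k kJ; rewrite BE// iF; last first.
  by move=> i; rewrite finset.inE => /eqP gi; rewrite /A' gi; exact: (HA _ kJ).1.
apply: eq_bigl => i; rewrite !finset.inE; case: eqVneq => [->|]; rewrite ?andbF//.
by rewrite kJ.
Qed.

Lemma mutually_independent_pair (I : finType) (F : I -> set (set W)) i j A B :
  i != j -> mutually_independent P F -> F i A -> F j B -> P (A `&` B) = P A * P B.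
Proof.
move=> ij iF FA FB.
pose C k := if k == i then A else B.
have := iF [set i; j]%SET C.
have -> : \bigcap_(k in [set` [set i; j]%SET]) C k = A `&` B.
  apply/seteqP; split => w.
    move=> h; split.
      by have := h i; rewrite /= finset.in_set2 eqxx /C eqxx => /(_ isT).
    by have := h j; rewrite /= finset.in_set2 eqxx orbT /C eq_sym (negbTE ij) => /(_ isT).
  by move=> [wA wB] k _; rewrite /C; case: ifP.
move=> ->.
  rewrite big_setU1/=; last by rewrite finset.in_set1.
  by rewrite big_set1 /C eqxx eq_sym (negbTE ij).
by move=> k; rewrite finset.in_set2 => /orP[]/eqP ->; rewrite /C ?eqxx// eq_sym (negbTE ij).
Qed.

Lemma preimage_generated (C : set (set W)) d (V : measurableType d) (f : W -> V) :
  @measurable_fun _ _ (g_sigma_algebraType C) V setT f ->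
  g_sigma_algebra_preimage f `<=` <<s C >>.
Proof. by move=> mf _ [B mB <-]; exact: mf. Qed.

Lemma generated_measurable (C : set (set W)) d (V : measurableType d) (f : W -> V) :
  g_sigma_algebra_preimage f `<=` C ->
  @measurable_fun _ _ (g_sigma_algebraType C) V setT f.
Proof. by move=> fC _ B mB; apply: sub_sigma_algebra; apply: fC; exists B. Qed.

Lemma preimage_measurable d (V : measurableType d) (f : W -> V) :
  measurable_fun setT f -> g_sigma_algebra_preimage f `<=` measurable.
Proof. by move=> mf _ [B mB <-]; exact: mf. Qed.

Lemma preimage_field_setI_closed d (V : measurableType d) (f : W -> V) :
  setI_closed (g_sigma_algebra_preimage f).
Proof.
move=> _ _ [A mA <-] [B mB <-]; exists (A `&` B); first exact: measurableI.
by rewrite !setTI preimage_setI.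
Qed.

Lemma preimage_field_setT d (V : measurableType d) (f : W -> V) :
  g_sigma_algebra_preimage f setT.
Proof. by exists setT => //; rewrite preimage_setT setTI. Qed.

End independence_theory.

(** * The Mecke equation of a Poisson process *)

Section finite_partition.
Context {R : realType} {dE : measure_display} {E : measurableType dE}.

Lemma integral_fin_map (m : {measure set E -> \bar R}) (J : finType) (kap : E -> J)
    (F : J -> \bar R) : (forall j, measurable (kap @^-1` [set j])) -> (forall j, 0 <= F j) ->
  measurable_fun setT (F \o kap) /\
  \int[m]_z F (kap z) = \sum_j F j * m (kap @^-1` [set j]).
Proof.
move=> mk F0.
have FE z : F (kap z) = \sum_j F j * (\1_(kap @^-1` [set j]) z)%:E.
  rewrite (bigD1 (kap z))//= indicE mem_set// mule1 big1 ?adde0// => j jk.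
  by rewrite indicE memNset ?mule0// => /= /esym/eqP; rewrite (negbTE jk).
have mi j : measurable_fun setT (fun z => (\1_(kap @^-1` [set j]) z)%:E : \bar R).
  by apply/measurable_EFinP; exact: measurable_indic.
have mFi j : measurable_fun setT (fun z => F j * (\1_(kap @^-1` [set j]) z)%:E).
  exact: emeasurable_funM.
split.
  rewrite (_ : F \o kap = fun z => \sum_j F j * (\1_(kap @^-1` [set j]) z)%:E).
    exact: emeasurable_sum.
  by apply/funext => z; exact: FE.
under eq_integral do rewrite FE.
rewrite ge0_integral_sum//; last by move=> j z _; rewrite mule_ge0.
apply: eq_bigr => j _; rewrite ge0_integralZl// integral_indic// setIT//.
Qed.

(** The cells record the values of all the functions together with membership in
D. *)
Lemma common_partition (k : nat) (g : 'I_k -> {nnsfun E >-> R}) (D : set E) : measurable D ->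
  exists (J : finType) (kap : E -> J) (a : 'I_k -> J -> R) (DJ : pred J),
    [/\ forall j, measurable (kap @^-1` [set j]), forall i j, (0 <= a i j)%R,
        forall i z, g i z = a i (kap z) & forall z, DJ (kap z) = (z \in D)].
Proof.
move=> mD.
pose V := flatten [seq finmap.enum_fset (fset_set (range (g i))) | i <- enum 'I_k].
have VE i z : g i z \in V.
  apply/flattenP; exists (finmap.enum_fset (fset_set (range (g i)))).
    by apply/mapP; exists i; rewrite ?mem_enum.
  have -> : (g i z \in finmap.enum_fset (fset_set (range (g i)))) = (g i z \in range (g i)).
    exact: in_fset_set.
  by rewrite mem_set//; exists z.
pose n := size V.
pose J : finType := ({ffun 'I_k -> 'I_n.+1} * bool)%type.
pose kap z : J := ([ffun i => inord (index (g i z) V)], z \in D).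
exists J, kap, (fun i (j : J) => `|nth 0%R V (j.1 i)|%R), snd; split => //.
- move=> [f b].
  rewrite (_ : kap @^-1` [set (f, b)] = (\bigcap_(i in [set: 'I_k])
      \bigcup_(v in [set v | v \in V /\ inord (index v V) = f i]) (g i @^-1` [set v])) `&`
      (if b then D else ~` D)).
    apply: measurableI.
      apply: fin_bigcap_measurable => // i _.
      apply: fin_bigcup_measurable => //.
      apply: (@sub_finite_set _ _ [set` V]); last exact: finite_seq.
      by move=> v [].
    by case: (b) => //; exact: measurableC.
  apply/seteqP; split => z.
    move=> /= [fE bE]; split.
      by move=> i _; exists (g i z) => //=; split => //; rewrite -fE ffunE.
    by rewrite -bE; case: ifPn => [/set_mem//|]; rewrite notin_setE.
  move=> [h hb]; rewrite /= /kap; congr (_, _).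
    apply/ffunP => i; rewrite ffunE; have [v [vV vi] gv] := h i Logic.I.
    by rewrite gv.
  by case: (b) hb => [zD|nzD]; [rewrite mem_set|rewrite memNset].
- move=> i z; rewrite /kap /= ffunE inordK ?nth_index//; last by rewrite ltnS index_size.
  by rewrite ger0_norm.
Qed.

End finite_partition.

Section ray_limits.
Context {R : realType}.

(** A strict lower bound on an increasing limit is already satisfied at some stage;
with weak inequalities this would fail. *)
Lemma ray_bigcup {W : Type} (k : nat) (x : nat -> 'I_k -> W -> \bar R) (y : 'I_k -> W -> \bar R)
    (b : 'I_k -> \bar R) :
  (forall i w, nondecreasing_seq (fun n => x n i w)) ->
  (forall i w, x n i w @[n --> \oo] --> y i w) ->
  nondecreasing_seq (fun n => [set w | forall i, b i < x n i w]) /\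
  \bigcup_n [set w | forall i, b i < x n i w] = [set w | forall i, b i < y i w].
Proof.
move=> ndx xy.
have xley n i w : x n i w <= y i w.
  rewrite -(cvg_lim _ (xy i w))//; apply: lime_ge; first by apply/cvg_ex; exists (y i w).
  by near=> m; apply: ndx; near: m; exists n.
split.
  move=> m n mn; rewrite subsetEset => w h i; apply: lt_le_trans (h i) _; exact: ndx.
apply/seteqP; split => [w [n _ h] i|w h]; first exact: lt_le_trans (h i) _.
have /choice[N HN] : forall i, exists n, b i < x n i w.
  move=> i; apply: contrapT => /forallNP nx.
  suff : y i w <= b i by rewrite leNgt h.
  by apply: cvge_le (xy i w); apply: nearW => n; rewrite leNgt; exact/negP.
exists (\max_i N i)%N => // i; apply: lt_le_trans (HN i) _; apply: ndx; exact: leq_bigmax.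
Unshelve. all: by end_near. Qed.

Lemma measurable_rays dW (W : measurableType dW) (k : nat) (x : 'I_k -> W -> \bar R)
    (b : 'I_k -> \bar R) : (forall i, measurable_fun setT (x i)) ->
  measurable [set w | forall i, b i < x i w].
Proof.
move=> mx; rewrite (_ : [set w | _] = \bigcap_(i in [set: 'I_k]) [set w | b i < x i w]).
  apply: fin_bigcap_measurable => // i _.
  by rewrite -[X in measurable X]setTI; exact: emeasurable_fun_o_infty.
by apply/seteqP; split => w h i; [move=> _|]; exact: h.
Qed.

Lemma cvg_integral_bigcup dW (W : measurableType dW) (P : {measure set W -> \bar R})
   (S : nat -> set W) (f : W -> \bar R) :
  (forall n, measurable (S n)) -> nondecreasing_seq S -> measurable_fun setT f ->
  (forall w, 0 <= f w) ->
  \int[P]_(w in S n) f w @[n --> \oo] --> \int[P]_(w in \bigcup_n S n) f w.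
Proof.
move=> mS ndS mf f0.
have := @nondecreasing_cvg_mu _ _ _ (mdens_measure P mf f0) S mS _ ndS; apply.
exact: bigcupT_measurable.
Qed.
End ray_limits.

Lemma probability_setI1 {R : realType} dW (W : measurableType dW) (P : {measure set W -> \bar R})
  (A B : set W) : measurable A -> measurable B -> P (~` B) = 0 -> P A = P (A `&` B).
Proof.
move=> mA mB PB; rewrite (measureDI P mA mB) -[RHS]add0e; congr (_ + _).
apply/eqP; rewrite eq_le measure_ge0 andbT -PB; apply: le_measure; rewrite ?inE//.
- exact: measurableD.
- exact: measurableC.
Qed.

Section mecke.
Context {R : realType} {dW : measure_display} {W : measurableType dW}.
Variable P : probability W R.
Context {dE : measure_display} {E : measurableType dE}.
Variables (nu : {measure set E -> \bar R}) (N : R.-ker W ~> E).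
Hypothesis HN : poisson_process P nu N.

Lemma measurable_count C : measurable C -> measurable_fun setT (fun w => N w C).
Proof. exact: measurable_kernel. Qed.

Lemma poisson_independent (J : finType) (C : J -> set E) :
  (forall j, measurable (C j)) -> (forall i j, i != j -> C i `&` C j = set0) ->
  mutually_independent P (fun j => g_sigma_algebra_preimage (fun w => N w (C j))).
Proof.
move=> mC dC; have [_ _ indep] := HN.
pose C' (i : 'I_#|J|) := C (enum_val i).
have trC : trivIset [set: 'I_#|J|] C'.
  apply/trivIsetP => i j _ _ ij; apply: dC.
  by apply: contra ij => /eqP/enum_val_inj ->.
have iC := indep #|J| C' (fun i => mC _) trC.
move=> J0 A FA.
have := iC [set enum_rank j | j in J0]%SET (fun i => A (enum_val i)).
rewrite big_imset/=; last by move=> i j _ _; exact: enum_rank_inj.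
under eq_bigr do rewrite enum_rankK.
rewrite (_ : \bigcap_(i in [set` [set enum_rank j | j in J0]%SET]) A (enum_val i) =
  \bigcap_(i in [set` J0]) A i).
  by apply=> i /imsetP[j jJ ->]; rewrite /C' enum_rankK; exact: FA.
apply/seteqP; split => w h i /= iJ.
  have := h (enum_rank i); rewrite enum_rankK; apply => /=.
  by apply/imsetP; exists i.
by move/imsetP : iJ => [j jJ ->]; rewrite enum_rankK; exact: h.
Qed.

Section one_cell.
Variable C : set E.
Hypotheses (mC : measurable C) (Coo : nu C < +oo).

Definition cnt (m : nat) : set W := [set w | N w C = m%:R%:E].

Lemma measurable_cnt m : measurable (cnt m).
Proof.
rewrite -[X in measurable X]setTI.
exact: (measurable_count mC measurableT (emeasurable_set1 m%:R%:E)).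
Qed.

Lemma cnt_preimage m : g_sigma_algebra_preimage (fun w => N w C) (cnt m).
Proof. by exists [set m%:R%:E]; [exact: emeasurable_set1|rewrite setTI]. Qed.

Lemma cnt_disj : trivIset setT cnt.
Proof.
apply/trivIsetP => m n _ _ mn; apply/seteqP; split => // w [].
by rewrite /cnt/= => -> [/eqP]; rewrite eqr_nat (negbTE mn).
Qed.

Lemma cnt_total : P (\bigcup_m cnt m) = 1.
Proof.
have [H _ _] := HN; have := H C mC Coo setT; rewrite probability_setT => <-.
congr (P _); apply/seteqP; split => [w [m _ h]|w [m _ h]]; by exists m.
Qed.

(** The property of the Poisson law on which the Mecke equation rests. *)
Lemma cnt_recurrence m : m.+1%:R%:E * P (cnt m.+1) = nu C * P (cnt m).
Proof.
have [H _ _] := HN.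
have PE k : P (cnt k) = poisson_prob (fine (nu C)) 0%N [set k].
  rewrite -H//; congr (P _); apply/seteqP; split => [w h|w [_ -> //]].
  by exists k.
rewrite !PE /poisson_prob; case: ifPn => [r0|].
  rewrite !esum_set1 ?lee_fin ?poisson_pmf_ge0// -[X in _ = X * _]fineK ?ge0_fin_numE//.
  rewrite -!EFinM /poisson_pmf r0; congr EFin.
  rewrite factS exprS natrM; field.
  by rewrite nat1r !pnatr_eq0 -lt0n fact_gt0.
move=> r0; have -> : nu C = 0.
  apply/eqP; rewrite eq_le measure_ge0 andbT.
  by rewrite -[nu C]fineK ?ge0_fin_numE// lee_fin leNgt.
by rewrite mul0e diracE memNset ?mule0// => /= /eqP; rewrite eq_sym.
Qed.

(** Size-biasing a Poisson count shifts it by one.  On the event that the count is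
m, the sets S and S' agree with Tm m and Tm m.+1, which are independent of the
count, and the recurrence matches the m.+1-st term of the left series with the
m-th term of the right one. *)
Lemma cnt_mecke (S S' : set W) (Tm : nat -> set W) :
  measurable S -> measurable S' -> (forall m, measurable (Tm m)) ->
  (forall m k, P (cnt m `&` Tm k) = P (cnt m) * P (Tm k)) ->
  (forall m, S `&` cnt m = cnt m `&` Tm m) ->
  (forall m, S' `&` cnt m = cnt m `&` Tm m.+1) ->
  \int[P]_(w in S) N w C = nu C * P S'.
Proof.
move=> mS mS' mT iT SE S'E.
have mcnt := measurable_cnt.
have mU : measurable (\bigcup_m cnt m) by exact: bigcupT_measurable.
have P0 : P (~` \bigcup_m cnt m) = 0.
  by rewrite probability_setC// cnt_total subee.
have tI (X : set W) : trivIset [set: nat] (fun m => X `&` cnt m).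
  by apply: trivIset_setIl; exact: cnt_disj.
have -> : \int[P]_(w in S) N w C = \sum_(0 <= m <oo) m%:R%:E * (P (cnt m) * P (Tm m)).
  rewrite (ge0_negligible_integral (measurableC mU))//; last exact: measurable_funTS (measurable_count mC).
  rewrite setDE setCK setI_bigcupr ge0_integral_bigcup//; last 2 first.
  - by move=> m; exact: measurableI.
  - exact: measurable_funTS (measurable_count mC).
  apply: eq_eseriesr => m _.
  rewrite (eq_integral (cst m%:R%:E)).
    by rewrite integral_cst; [rewrite -iT -SE|exact: measurableI].
  by move=> w /set_mem[_].
have -> : P S' = \sum_(0 <= m <oo) P (cnt m) * P (Tm m.+1).
  transitivity (P (S' `&` \bigcup_m cnt m)).
    exact: (probability_setI1 mS' mU P0).
  rewrite setI_bigcupr measure_semi_bigcup//; last 2 first.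
  - by move=> m; exact: measurableI.
  - by apply: bigcupT_measurable => m; exact: measurableI.
  by apply: eq_eseriesr => m _; rewrite S'E; exact: iT.
rewrite nneseries_recl//; last by move=> m _; rewrite !mule_ge0// lee_fin.
rewrite mul0e add0e -(nneseries_addn 1); last by move=> m; rewrite !mule_ge0// lee_fin.
rewrite -[nu C]fineK ?ge0_fin_numE// -nneseriesZl; last by move=> m _; rewrite mule_ge0.
apply: eq_eseriesr => m _; rewrite addn1 !muleA fineK ?ge0_fin_numE//.
by rewrite cnt_recurrence.
Qed.
End one_cell.

Section partition.
Variables (J : finType) (kap : E -> J).
Hypothesis mk : forall j, measurable (kap @^-1` [set j]).
Let C j := kap @^-1` [set j].
Variables (k : nat) (a : 'I_k -> J -> R) (b : 'I_k -> \bar R).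
Hypothesis a0 : forall i j, (0 <= a i j)%R.

(** The counts of the other cells are independent of the count of j0, and one more
point in the cell j0 increases the i-th sum by a i j0. *)
Lemma partition_mecke j0 : nu (C j0) < +oo ->
  \int[P]_(w in [set w | forall i, b i < \sum_j (a i j)%:E * N w (C j)]) N w (C j0) =
  nu (C j0) * P [set w | forall i, b i < \sum_j (a i j)%:E * N w (C j) + (a i j0)%:E].
Proof.
move=> Coo.
pose rest i w := \sum_(j | j != j0) (a i j)%:E * N w (C j).
pose Tm (m : nat) := [set w | forall i, b i < rest i w + (a i j0 * m%:R)%:E].
have mN j : measurable_fun setT (fun w => N w (C j)).
  exact: (measurable_count (mk j)).
have msum i : measurable_fun setT (fun w => \sum_j (a i j)%:E * N w (C j)).
  by apply: emeasurable_sum => j; exact: emeasurable_funM.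
have restE i : rest i = (fun w => \sum_j (if j != j0 then (a i j)%:E * N w (C j) else 0)).
  by apply/funext => w; rewrite /rest big_mkcond.
have mrest i : measurable_fun setT (rest i).
  rewrite restE.
  by apply: emeasurable_sum => j; case: (j != j0); [exact: emeasurable_funM|exact: measurable_cst].
have dC i j : i != j -> C i `&` C j = set0.
  by move=> ij; apply/seteqP; split => // z [/= zi zj]; rewrite -zi -zj eqxx in ij.
pose F j := g_sigma_algebra_preimage (fun w => N w (C j)).
have iF : mutually_independent P F := poisson_independent mk dC.
have iG := @mutually_independent_group _ _ _ P _ _ (fun j => j == j0) F
  (fun j => preimage_measurable (mN j)) (fun j => @preimage_field_setI_closed _ _ _ _ _)
  (fun j => preimage_field_setT _) iF.
have mTm m : measurable (Tm m).
  by apply: measurable_rays => i; exact: emeasurable_funD.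
have sumE i w : \sum_j (a i j)%:E * N w (C j) = rest i w + (a i j0)%:E * N w (C j0).
  by rewrite (bigD1 j0)//= addeC.
have shiftE i w m : rest i w + (a i j0 * m.+1%:R)%:E =
    rest i w + (a i j0 * m%:R)%:E + (a i j0)%:E.
  by rewrite -natr1 mulrDr mulr1 EFinD addeA.
apply: (cnt_mecke (mk j0) Coo (Tm := Tm)) => //.
- by apply: measurable_rays.
- by apply: measurable_rays => i; exact: emeasurable_funD.
- move=> m m'; apply: (@mutually_independent_pair _ _ _ P _ _ true false _ _ _ iG) => //.
    apply: sub_sigma_algebra; exists j0 => /=; first by rewrite eqxx.
    exact: cnt_preimage.
  apply: (@measurable_rays _ _ (g_sigma_algebraType _)) => i.
  apply: emeasurable_funD; last exact: measurable_cst.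
  rewrite restE.
  apply: emeasurable_sum => j; have [_|jj0] := eqVneq j j0; first exact: measurable_cst.
  apply: emeasurable_funM; first exact: measurable_cst.
  apply: generated_measurable => B FB; exists j => //=; exact: negbTE.
- move=> m; apply/seteqP; split => w [].
    move=> Sw cw; split => // i; have := Sw i; rewrite sumE.
    by rewrite (cw : N w (C j0) = _) -EFinM.
  move=> cw Tw; split => // i; have := Tw i; rewrite sumE.
  by rewrite (cw : N w (C j0) = _) -EFinM.
- move=> m; apply/seteqP; split => w [].
    move=> Sw cw; split => // i; have := Sw i; rewrite sumE.
    by rewrite (cw : N w (C j0) = _) -EFinM shiftE.
  move=> cw Tw; split => // i; have := Tw i; rewrite sumE.
  by rewrite (cw : N w (C j0) = _) -EFinM shiftE.
Qed.
End partition.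

(** Integrals of simple functions are linear combinations of the counts of a
partition adapted to D, and N(D) is a sum of such counts. *)
Lemma nnsfun_mecke (k : nat) (g : 'I_k -> {nnsfun E >-> R}) (b : 'I_k -> \bar R) (D : set E) :
  measurable D -> nu D < +oo ->
  measurable_fun setT (fun z => P [set w | forall i, b i < \int[N w]_y (g i y)%:E + (g i z)%:E]) /\
  \int[P]_(w in [set w | forall i, b i < \int[N w]_y (g i y)%:E]) N w D =
  \int[nu]_(z in D) P [set w | forall i, b i < \int[N w]_y (g i y)%:E + (g i z)%:E].
Proof.
move=> mD Doo.
have [J [kap [a [DJ [mk a0 ga DE]]]]] := common_partition g mD.
pose C j := kap @^-1` [set j].
have mN j : measurable_fun setT (fun w => N w (C j)).
  exact: (measurable_count (mk j)).
have IE w i : \int[N w]_y (g i y)%:E = \sum_j (a i j)%:E * N w (C j).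
  have [_ <-] := @integral_fin_map _ _ _ (N w) J kap (fun j => (a i j)%:E) mk
    (fun j => ltac:(by rewrite lee_fin)).
  by apply: eq_integral => z _; rewrite ga.
pose Phi j := P [set w | forall i, b i < \sum_j (a i j)%:E * N w (C j) + (a i j)%:E].
have PhiE z : P [set w | forall i, b i < \int[N w]_y (g i y)%:E + (g i z)%:E] = Phi (kap z).
  by congr (P _); apply/seteqP; split => w h i; have := h i; rewrite IE ga.
have -> : (fun z => P [set w | forall i, b i < \int[N w]_y (g i y)%:E + (g i z)%:E]) = Phi \o kap.
  by apply/funext => z; exact: PhiE.
split; first by have [] := @integral_fin_map _ _ _ nu J kap Phi mk (fun j => measure_ge0 _ _).
set S := [set w | _].
have SE : S = [set w | forall i, b i < \sum_j (a i j)%:E * N w (C j)].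
  by apply/seteqP; split => w h i; have := h i; rewrite IE.
have mS : measurable S.
  rewrite SE; apply: measurable_rays => i.
  by apply: emeasurable_sum => j; exact: emeasurable_funM.
pose DR j : \bar R := ((DJ j)%:R : R)%:E.
have DR0 j : 0 <= DR j by rewrite lee_fin.
have indE (z : E) : (\1_D z)%:E = DR (kap z) by rewrite indicE /DR DE.
have NDE w : N w D = \sum_j DR j * N w (C j).
  have [_ <-] := @integral_fin_map _ _ _ (N w) J kap DR mk DR0.
  rewrite -[D in LHS]setIT -integral_indic//.
  by apply: eq_integral => z _; rewrite indE.
under [LHS]eq_integral do rewrite NDE.
rewrite ge0_integral_sum//; last 2 first.
- by move=> j; apply: measurable_funTS; exact: emeasurable_funM.
- by move=> j w _; rewrite mule_ge0.
have -> : \int[nu]_(z in D) (Phi \o kap) z = \int[nu]_z (DR (kap z) * Phi (kap z)).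
  by rewrite -integral_indicM; apply: eq_integral => z _; rewrite indE.
have [_ ->] := @integral_fin_map _ _ _ nu J kap (fun j => DR j * Phi j) mk
  (fun j => mule_ge0 (DR0 j) (measure_ge0 _ _)).
apply: eq_bigr => j _.
rewrite ge0_integralZl//; last exact: measurable_funTS.
rewrite -muleA /DR.
have [DJj|nDJ] := boolP (DJ j); last by rewrite !mul0e.
congr (_ * _); rewrite muleC SE; apply: partition_mecke => //.
apply: le_lt_trans Doo; apply: le_measure; rewrite ?inE//.
by move=> z /= zj; apply/set_mem; rewrite -DE zj.
Qed.

Lemma cvg_integral_ndD (m : {measure set E -> \bar R}) (D : set E) (h : nat -> E -> \bar R) h' :
  measurable D -> (forall n, measurable_fun D (h n)) -> (forall n x, D x -> 0 <= h n x) ->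
  (forall x, D x -> nondecreasing_seq (h ^~ x)) ->
  (forall x, D x -> h n x @[n --> \oo] --> h' x) ->
  \int[m]_(x in D) h n x @[n --> \oo] --> \int[m]_(x in D) h' x.
Proof.
move=> mD mh h0 ndh hh'.
rewrite (_ : \int[m]_(x in D) h' x = \int[m]_(x in D) limn (h ^~ x)).
  exact: cvg_monotone_convergence.
by apply: eq_integral => x /set_mem Dx; apply/esym/cvg_lim => //; exact: hh'.
Qed.

(** The Mecke equation for the events that integrals exceed given thresholds.
Both sides are continuous along increasing sequences of such events, so that
simple functions suffice. *)
Theorem mecke (k : nat) (f : 'I_k -> E -> \bar R) (b : 'I_k -> \bar R) (D : set E) :
  (forall i, measurable_fun setT (f i)) -> (forall i z, 0 <= f i z) ->
  measurable D -> nu D < +oo ->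
  \int[P]_(w in [set w | forall i, b i < \int[N w]_y f i y]) N w D =
  \int[nu]_(z in D) P [set w | forall i, b i < \int[N w]_y f i y + f i z].
Proof.
move=> mf f0 mD Doo.
pose g n i := nnsfun_approx measurableT (mf i) n.
have gnd i z : nondecreasing_seq (fun n => (g n i z)%:E).
  by move=> m n mn; rewrite lee_fin; exact/lefP/nd_nnsfun_approx.
have gf i z : (g n i z)%:E @[n --> \oo] --> f i z by exact: cvg_nnsfun_approx.
have mg n i : measurable_fun setT (fun z => (g n i z)%:E) by exact/measurable_EFinP.
have Ind i w : nondecreasing_seq (fun n => \int[N w]_y (g n i y)%:E).
  move=> m n mn; apply: ge0_le_integral => //.
  - by move=> x _; rewrite lee_fin.
  - by move=> x _; exact: gnd.
have If i w : \int[N w]_y (g n i y)%:E @[n --> \oo] --> \int[N w]_y f i y.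
  by apply: cvg_integral_nd => // n z; rewrite lee_fin.
have mI n i : measurable_fun setT (fun w => \int[N w]_y (g n i y)%:E).
  apply: measurable_fun_integral_kernel => //.
  - exact: measurable_kernel.
  - by move=> z; rewrite lee_fin.
have [ndS US] := ray_bigcup b Ind If.
have c1 := @cvg_integral_bigcup _ _ _ P _ (fun w => N w D)
  (fun n => measurable_rays b (mI n)) ndS (measurable_count mD) (fun w => measure_ge0 _ _).
rewrite US in c1.
have H z := @ray_bigcup R W k (fun n i w => \int[N w]_y (g n i y)%:E + (g n i z)%:E)
  (fun i w => \int[N w]_y f i y + f i z) b.
have mS n z : measurable [set w | forall i, b i < \int[N w]_y (g n i y)%:E + (g n i z)%:E].
  by apply: measurable_rays => i; exact: emeasurable_funD.
have H1 z i w : nondecreasing_seq (fun n => \int[N w]_y (g n i y)%:E + (g n i z)%:E).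
  by move=> m n mn; apply: leeD; [exact: Ind|exact: gnd].
have H2 z i w : \int[N w]_y (g n i y)%:E + (g n i z)%:E @[n --> \oo] --> \int[N w]_y f i y + f i z.
  by apply: cvgeD => //; apply: ge0_adde_def; rewrite inE// integral_ge0.
have c2 : \int[nu]_(z in D) P [set w | forall i, b i < \int[N w]_y (g n i y)%:E + (g n i z)%:E]
   @[n --> \oo] --> \int[nu]_(z in D) P [set w | forall i, b i < \int[N w]_y f i y + f i z].
  apply: cvg_integral_ndD => //.
  - by move=> n; apply: measurable_funTS; have [] := nnsfun_mecke (g n) b mD Doo.
  - move=> z _ m n mn; apply: le_measure; rewrite ?inE//.
    by rewrite -subsetEset; exact: (H z (H1 z) (H2 z)).1.
  - move=> z _; rewrite -(H z (H1 z) (H2 z)).2; apply: nondecreasing_cvg_mu => //.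
    + exact: bigcupT_measurable.
    + exact: (H z (H1 z) (H2 z)).1.
apply: (cvg_unique _ c1) => //.
rewrite (_ : (fun n => _) = (fun n => \int[nu]_(z in D) P [set w | forall i, b i < \int[N w]_y (g n i y)%:E + (g n i z)%:E]))//.
by apply/funext => n; have [_ ->] := nnsfun_mecke (g n) b mD Doo.
Qed.
End mecke.

(** * Independence of Poisson integrals *)

Section pushm.
Context d d' (R : realType) (T1 : measurableType d) (T2 : measurableType d') (m : {measure set T1 -> \bar R}) (f : T1 -> T2) (mf : measurable_fun setT f).
Definition pushm : {measure set T2 -> \bar R} := measure_function_pushforward__canonical__measure_function_Measure m mf.
End pushm.
Section mmix.
Context d d' (R : realType) (Y : measurableType d) (V : measurableType d') (m : {measure set Y -> \bar R}) (k : Y -> {measure set V -> \bar R}).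
Hypothesis mk : forall U, measurable U -> measurable_fun setT (k ^~ U).
Definition mmix (U : set V) := \int[m]_y k y U.
Let mmix0 : mmix set0 = 0.
Proof. by rewrite /mmix; under eq_integral do rewrite measure0; rewrite integral0. Qed.
Let mmix_ge0 U : 0 <= mmix U.
Proof. exact: integral_ge0. Qed.
Let mmix_sa : semi_sigma_additive mmix.
Proof.
move=> U mU tU mUU; rewrite [X in _ --> X](_ : _ = \int[m]_y (\sum_(n <oo) k y (U n))); last first.
  by apply: eq_integral => y _; apply/esym/cvg_lim => //; exact/measure_semi_sigma_additive.
apply/cvg_closeP; split; first by apply: is_cvg_nneseries => n _ _; exact: integral_ge0.
by rewrite closeE// integral_nneseries// => n; exact: mk.
Qed.
Definition mmix_measure : {measure set V -> \bar R} :=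
  HB.pack_for (Measure.type V R) mmix (isMeasure.Build d' V R mmix mmix0 mmix_ge0 mmix_sa).
End mmix.

Section ae_tools.
Context {R : realType} {dW : measure_display} {W : measurableType dW}.
Variable P : probability W R.

Lemma cvg_prode (I : Type) (s : seq I) (u : nat -> I -> \bar R) (l : I -> \bar R) :
  (forall i, l i \is a fin_num) -> (forall i, u n i @[n --> \oo] --> l i) ->
  \prod_(i <- s) u n i @[n --> \oo] --> \prod_(i <- s) l i.
Proof.
move=> lfin ul; elim: s => [|i s ih].
  by under eq_fun do rewrite big_nil; rewrite big_nil; exact: cvg_cst.
under eq_fun do rewrite big_cons; rewrite big_cons; apply: cvgeM => //.
apply: mule_def_fin => //.
by apply: (big_ind (fun x => x \is a fin_num)) => // x y; exact: fin_numM.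
Qed.

Lemma probability_ae_eq (A B : set W) : measurable A -> measurable B ->
  {ae P, forall w, A w <-> B w} -> P A = P B.
Proof.
move=> mA mB [N0 [mN0 PN0 sub]].
have PC : P (~` ~` N0) = 0 by rewrite setCK.
rewrite (probability_setI1 mA (measurableC mN0) PC) (probability_setI1 mB (measurableC mN0) PC).
congr (P _); apply/seteqP; split => w [wX wN].
  by have [h1 h2] : A w <-> B w; [apply: contrapT => h; apply: wN; exact: sub|split => //; exact: h1].
by have [h1 h2] : A w <-> B w; [apply: contrapT => h; apply: wN; exact: sub|split => //; exact: h2].
Qed.

Lemma mutually_independent_ae (I : finType) (X Y : I -> W -> \bar R) :
  (forall i, measurable_fun setT (X i)) -> (forall i, measurable_fun setT (Y i)) ->
  {ae P, forall w, forall i, X i w = Y i w} ->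
  mutually_independent P (fun i => g_sigma_algebra_preimage (X i)) ->
  mutually_independent P (fun i => g_sigma_algebra_preimage (Y i)).
Proof.
move=> mX mY XY iX J A HA.
have /choice[B HB] : forall i, exists B : set (\bar R), measurable B /\
    (i \in J -> A i = Y i @^-1` B).
  move=> i; have [iJ|iJ] := boolP (i \in J); last by exists setT.
  by have [B mB <-] := HA i iJ; exists B; split => // _; rewrite setTI.
have mXB i : measurable (X i @^-1` B i).
  by rewrite -[X in measurable X]setTI; apply: mX => //; have [] := HB i.
have mYB i : measurable (Y i @^-1` B i).
  by rewrite -[X in measurable X]setTI; apply: mY => //; have [] := HB i.
have -> : \bigcap_(i in [set` J]) A i = \bigcap_(i in [set` J]) (Y i @^-1` B i).
  by apply: eq_bigcapr => i /= iJ; rewrite (HB i).2.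
transitivity (P (\bigcap_(i in [set` J]) (X i @^-1` B i))).
  apply: probability_ae_eq.
  - exact: measurable_bigcaps.
  - exact: measurable_bigcaps.
  - by apply: filterS XY => w XYw; split => h i iJ; have := h i iJ; rewrite /= XYw.
rewrite iX; last first.
  by move=> i _; exists (B i); [have [] := HB i|rewrite setTI].
apply: eq_bigr => i iJ; rewrite (HB i).2//.
by apply: probability_ae_eq => //; apply: filterS XY => w XYw; rewrite /= XYw.
Qed.

(** A threshold -oo imposes no condition, so that the product rule for all indices
contains the rules for the subfamilies. *)
Lemma mutually_independent_rays (k : nat) (X : 'I_k -> W -> \bar R) :
  (forall i, measurable_fun setT (X i)) -> (forall i w, 0 <= X i w) ->
  (forall b : 'I_k -> \bar R, P [set w | forall i, b i < X i w] = \prod_i P [set w | b i < X i w]) ->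
  mutually_independent P (fun i => g_sigma_algebra_preimage (X i)).
Proof.
move=> mX X0 H.
pose Pi i := [set A | exists b : \bar R, A = [set w | b < X i w]].
have mray i b : measurable [set w | b < X i w].
  by rewrite -[X in measurable X]setTI; exact: emeasurable_fun_o_infty.
have iPi : mutually_independent P Pi.
  move=> J A HA.
  have /choice[b Hb] : forall i, exists b : \bar R,
      (i \in J -> A i = [set w | b < X i w]) /\ (i \notin J -> b = -oo).
    move=> i; have [iJ|iJ] := boolP (i \in J); last by exists -oo.
    by have [b ->] := HA i iJ; exists b.
  have -> : \bigcap_(i in [set` J]) A i = [set w | forall i, b i < X i w].
    apply/seteqP; split => w h.
      move=> i; have [iJ|iJ] := boolP (i \in J); first by have := h i iJ; rewrite (Hb i).1.
      by rewrite (Hb i).2// (lt_le_trans _ (X0 i w)).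
    by move=> i /= iJ; rewrite (Hb i).1//=.
  rewrite H (bigID (mem J))/= [X in _ * X]big1 ?mule1; last first.
    move=> i iJ; rewrite (Hb i).2// (_ : [set w | _] = setT) ?probability_setT//.
    by apply/seteqP; split => // w _; rewrite /= (lt_le_trans _ (X0 i w)).
  by apply: eq_bigr => i iJ; rewrite (Hb i).1.
have := mutually_independent_ext (P := P) (Pi := Pi).
move=> /(_ _ _ iPi) iE.
apply: mutually_independentS (iE _ _).
- move=> i; apply: preimage_generated.
  apply: (measurability _ (ErealGenOInfty.measurableE R)) => // _ [_ [x ->] <-].
  rewrite setTI; apply: sub_sigma_algebra; exists x%:E.
  by apply/seteqP; split => w /=; rewrite in_itv/= andbT.
- by move=> i _ [b ->].
- move=> i _ _ [b ->] [b' ->]; exists (Order.max b b').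
  by apply/seteqP; split => w /=; rewrite gt_max; [move=> [-> ->]|move=> /andP[]].
Qed.
End ae_tools.

Section poisson_integrals.
Context {R : realType} {dW : measure_display} {W : measurableType dW}.
Variable P : probability W R.
Context {dE : measure_display} {E : measurableType dE}.
Variables (nu : {measure set E -> \bar R}) (N : R.-ker W ~> E).
Hypothesis HN : poisson_process P nu N.

(** The sets S_i cut by a common partition have independent counts, and the i-th
integral is a combination of those of the i-th group. *)
Lemma nnsfun_independent (k : nat) (g : 'I_k -> {nnsfun E >-> R}) (S : 'I_k -> set E) :
  (forall i, measurable (S i)) -> (forall i j, i != j -> S i `&` S j = set0) ->
  (forall i z, ~ S i z -> g i z = 0%R) ->
  mutually_independent P
    (fun i => g_sigma_algebra_preimage (fun w => \int[N w]_z (g i z)%:E)).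
Proof.
move=> mS dS g0.
have [J [kap [a [DJ [mk a0 ga DE]]]]] := common_partition g measurableT.
pose C (p : 'I_k * J) := S p.1 `&` kap @^-1` [set p.2].
have mC p : measurable (C p) by apply: measurableI => //; exact: mk.
have dC p q : p != q -> C p `&` C q = set0.
  move=> pq; apply/seteqP; split => // z [[/= Sp kp] [Sq kq]].
  have p1 : p.1 = q.1.
    apply/eqP; apply: contraT => /dS h.
    by have : (S p.1 `&` S q.1) z by []; rewrite h.
  by move/eqP : pq; apply; case: p q kp kq p1 {Sp Sq} => [? ?] [? ?] /= -> -> ->.
have iF := poisson_independent HN mC dC.
have mN p : measurable_fun setT (fun w => N w (C p)) by exact: (measurable_count N (mC p)).
have := @mutually_independent_group _ _ _ P _ _ (fun p : 'I_k * J => p.1) _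
  (fun j => preimage_measurable (mN j)) (fun j => @preimage_field_setI_closed _ _ _ _ _)
  (fun j => preimage_field_setT _) iF.
apply: mutually_independentS => i.
have IE w : \int[N w]_z (g i z)%:E = \sum_j (a i j)%:E * N w (C (i, j)).
  have gE z : (g i z)%:E = \sum_j (a i j)%:E * (\1_(C (i, j)) z)%:E.
    have [Sz|nSz] := pselect (S i z); last first.
      rewrite g0// big1// => j _; rewrite indicE memNset ?mule0//.
      by move=> [].
    rewrite (bigD1 (kap z))//= indicE mem_set// mule1 -ga big1 ?adde0// => j jk.
    rewrite indicE memNset ?mule0// => -[_ /= kj]; by rewrite kj eqxx in jk.
  under eq_integral do rewrite gE.
  have mi j : measurable_fun setT (fun z => (\1_(C (i, j)) z)%:E : \bar R).
    by apply/measurable_EFinP; exact: measurable_indic.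
  rewrite ge0_integral_sum//; last 2 first.
  - by move=> j; exact: emeasurable_funM.
  - by move=> j z _; rewrite mule_ge0// lee_fin.
  apply: eq_bigr => j _; rewrite ge0_integralZl//; last by rewrite lee_fin.
  by rewrite integral_indic// setIT.
apply: preimage_generated.
rewrite (_ : (fun w => \int[N w]_z (g i z)%:E) = (fun w => \sum_j (a i j)%:E * N w (C (i, j)))); last first.
  by apply/funext.
apply: emeasurable_sum => j; apply: emeasurable_funM; first exact: measurable_cst.
by apply: generated_measurable => B FB; exists (i, j).
Qed.

(** Simple functions below f i have the support of f i, and the probabilities of
rays are continuous along increasing sequences. *)
Theorem poisson_integral_independent (k : nat) (f : 'I_k -> E -> \bar R) (S : 'I_k -> set E) :
  (forall i, measurable_fun setT (f i)) -> (forall i z, 0 <= f i z) ->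
  (forall i, measurable (S i)) -> (forall i j, i != j -> S i `&` S j = set0) ->
  (forall i z, ~ S i z -> f i z = 0) ->
  mutually_independent P
    (fun i => g_sigma_algebra_preimage (fun w => \int[N w]_z f i z)).
Proof.
move=> mf f0 mS dS fS.
pose g n i := nnsfun_approx measurableT (mf i) n.
have gnd i z : nondecreasing_seq (fun n => (g n i z)%:E).
  by move=> m n mn; rewrite lee_fin; exact/lefP/nd_nnsfun_approx.
have gf i z : (g n i z)%:E @[n --> \oo] --> f i z by exact: cvg_nnsfun_approx.
have mg n i : measurable_fun setT (fun z => (g n i z)%:E) by exact/measurable_EFinP.
have gS n i z : ~ S i z -> g n i z = 0%R.
  move=> /fS fz; have : (g n i z)%:E <= f i z.
    by rewrite /g nnsfun_approxE; exact: le_approx.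
  by rewrite fz lee_fin => gle; apply/eqP; rewrite eq_le gle fun_ge0.
have Ind i w : nondecreasing_seq (fun n => \int[N w]_y (g n i y)%:E).
  move=> m n mn; apply: ge0_le_integral => //.
  - by move=> x _; rewrite lee_fin.
  - by move=> x _; exact: gnd.
have If i w : \int[N w]_y (g n i y)%:E @[n --> \oo] --> \int[N w]_y f i y.
  by apply: cvg_integral_nd => // n z; rewrite lee_fin.
have mI n i : measurable_fun setT (fun w => \int[N w]_y (g n i y)%:E).
  apply: measurable_fun_integral_kernel => //.
  - exact: measurable_kernel.
  - by move=> z; rewrite lee_fin.
have mIf i : measurable_fun setT (fun w => \int[N w]_y f i y).
  by apply: measurable_fun_integral_kernel => //; exact: measurable_kernel.
apply: mutually_independent_rays => //; first by move=> i w; exact: integral_ge0.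
move=> b.
have [ndS US] := ray_bigcup b Ind If.
have mray n i : measurable [set w | b i < \int[N w]_y (g n i y)%:E].
  by rewrite -[X in measurable X]setTI; exact: emeasurable_fun_o_infty.
have mray' i : measurable [set w | b i < \int[N w]_y f i y].
  by rewrite -[X in measurable X]setTI; exact: emeasurable_fun_o_infty.
have c1 : P [set w | forall i, b i < \int[N w]_y (g n i y)%:E] @[n --> \oo] -->
    P [set w | forall i, b i < \int[N w]_y f i y].
  rewrite -US; apply: nondecreasing_cvg_mu => //.
  - by move=> n; apply: measurable_rays.
  - by apply: bigcupT_measurable => n; apply: measurable_rays.
have c2 : \prod_i P [set w | b i < \int[N w]_y (g n i y)%:E] @[n --> \oo] -->
    \prod_i P [set w | b i < \int[N w]_y f i y].
  apply: cvg_prode; first by move=> i; exact: fin_num_measure.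
  move=> i.
  have [ndS1 US1] := @ray_bigcup R W 1 (fun n _ w => \int[N w]_y (g n i y)%:E)
    (fun _ w => \int[N w]_y f i y) (fun=> b i) (fun _ => Ind i) (fun _ => If i).
  have rE (h : W -> \bar R) : [set w | forall j : 'I_1, b i < h w] = [set w | b i < h w].
    by apply/seteqP; split => w; [move=> /(_ ord0)|move=> ? _].
  rewrite rE in US1.
  have -> : (fun n => P [set w | b i < \int[N w]_y (g n i y)%:E]) =
      (fun n => P [set w | forall j : 'I_1, b i < \int[N w]_y (g n i y)%:E]).
    by apply/funext => n; rewrite rE.
  rewrite -US1; apply: nondecreasing_cvg_mu => //.
  - by move=> n; rewrite rE.
  - by apply: bigcupT_measurable => n; rewrite rE.
apply: (cvg_unique _ c1) => //.
rewrite (_ : (fun n => _) = (fun n => \prod_i P [set w | b i < \int[N w]_y (g n i y)%:E]))//.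
apply/funext => n.
have := nnsfun_independent mS dS (gS n).
move=> /(_ [set: 'I_k]%SET (fun i => [set w | b i < \int[N w]_y (g n i y)%:E])).
rewrite (eq_bigl _ _ (fun i => finset.in_setT i)) => <-.
  congr (P _); apply/seteqP; split => w h i; first by move=> _; exact: h.
  by apply: h => /=; rewrite finset.in_setT.
move=> i _; exists `]b i, +oo[%classic; first exact: emeasurable_itv.
by rewrite setTI; apply/seteqP; split => w /=; rewrite in_itv/= andbT.
Qed.
End poisson_integrals.

(** * The Mecke equation of a completely random measure *)

Lemma integral_ae_dom {R : realType} dW (W : measurableType dW) (P : {measure set W -> \bar R})
    (S1 S2 : set W) (f : W -> \bar R) : measurable S1 -> measurable S2 ->
  measurable_fun setT f -> (forall w, 0 <= f w) -> {ae P, forall w, S1 w <-> S2 w} ->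
  \int[P]_(w in S1) f w = \int[P]_(w in S2) f w.
Proof.
move=> m1 m2 mf f0 S12; rewrite integral_mkcond [RHS]integral_mkcond.
apply: ge0_ae_eq_integral => //.
- by apply/(measurable_restrictT _ m1); exact: measurable_funTS.
- by apply/(measurable_restrictT _ m2); exact: measurable_funTS.
- by move=> w _; rewrite patchE; case: ifP.
- by move=> w _; rewrite patchE; case: ifP.
apply: filterS S12 => w Sw _; rewrite !patchE.
by have -> : (w \in S1) = (w \in S2) by apply/idP/idP; rewrite !inE => /Sw.
Qed.

Section crm.
Context {R : realType} {d : measure_display} {T : polishType R d}.
Local Notation M := (bfmeasure T).
Variables (eta : probability T R) (rho : R.-sigmafker T ~> R).
Variable (nu : {measure set (T * R) -> \bar R}).
Hypothesis Hnu : crm_intensity eta rho nu.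
Context {dW : measure_display} {W : measurableType dW}.
Variables (P : probability W R) (mu : {RV P >-> M}).
Hypothesis Hmu : crm_with_intensity nu mu.

(** Its integral against the Poisson process is the value at A of the random
measure. *)
Definition jump_fun (A : set T) (z : T * R) : \bar R := (pos z.2)%:E * (\1_A z.1)%:E.

Lemma jump_fun_ge0 A z : 0 <= jump_fun A z.
Proof. by rewrite mule_ge0// lee_fin ?pos_ge0. Qed.

Lemma measurable_jump_fun A : measurable A -> measurable_fun setT (jump_fun A).
Proof.
move=> mA; apply: emeasurable_funM; apply/measurable_EFinP.
  exact: measurableT_comp measurable_pos measurable_snd.
exact: measurableT_comp (measurable_indic mA) measurable_fst.
Qed.

Lemma measurable_strip (A : set T) : measurable A ->
  measurable (A `*` `]0%R, +oo[%classic : set (T * R)).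
Proof. by move=> mA; apply: measurableX. Qed.

Lemma int_jump_fun (m : {measure set (T * R) -> \bar R}) (A : set T) : measurable A ->
  \int[m]_(z in A `*` `]0%R, +oo[) z.2%:E = \int[m]_z jump_fun A z.
Proof.
move=> mA; rewrite integral_mkcond; apply: eq_integral => z _.
rewrite patchE /jump_fun indicE; have [|] := boolP (z \in A `*` _).
  move=> /set_mem[/= zA]; rewrite in_itv/= andbT => z0.
  by rewrite mem_set// mule1 /pos; congr EFin; apply/esym/max_idPl; exact: ltW.
have [zA|zA] := boolP (z.1 \in A); last by rewrite mule0.
rewrite notin_setE => zn; rewrite mule1 /pos.
have [z0|z0] := ltP 0%R z.2.
  by exfalso; apply: zn; split => /=; [exact/set_mem|rewrite in_itv/= z0].
by congr EFin; apply/esym/max_idPr.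
Qed.

Lemma crm_poisson : exists2 N : R.-ker W ~> (T * R)%type, poisson_process P nu N &
  {ae P, forall w, forall A, measurable A -> mu w A = \int[N w]_z jump_fun A z}.
Proof.
have [N HN HA] := Hmu; exists N => //.
by apply: filterS HA => w Hw A mA; rewrite Hw// int_jump_fun.
Qed.

Lemma measurable_mu_ev A : measurable A -> measurable_fun setT (fun w => mu w A).
Proof. by move=> mA; exact: measurableT_comp (ev_measurable mA) _. Qed.

(** Disjoint sets give integrands with disjoint supports. *)
Lemma crm_independent (k : nat) (A : 'I_k -> set T) :
  (forall i, measurable (A i)) -> trivIset [set: 'I_k] A ->
  mutually_independent P (fun i => g_sigma_algebra_preimage (fun w => mu w (A i))).
Proof.
move=> mA /trivIsetP tA; have [N HN HA] := crm_poisson.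
apply: (@mutually_independent_ae _ _ _ _ _ (fun i w => \int[N w]_z jump_fun (A i) z)).
- move=> i; apply: measurable_fun_integral_kernel.
  + exact: measurable_kernel.
  + exact: jump_fun_ge0.
  + exact: measurable_jump_fun.
- by move=> i; exact: measurable_mu_ev.
- by apply: filterS HA => w Hw i; rewrite Hw.
apply: (@poisson_integral_independent _ _ _ _ _ _ _ _ HN _ _ (fun i => A i `*` setT)).
- by move=> i; exact: measurable_jump_fun.
- by move=> i z; exact: jump_fun_ge0.
- by move=> i; apply: measurableX.
- move=> i j ij; have := tA i j Logic.I Logic.I ij => AA.
  by rewrite -setXI AA set0X.
- move=> i z nz; rewrite /jump_fun indicE memNset ?mule0// => zA.
  by apply: nz.
Qed.

Lemma measurable_addatom_mu :
  measurable_fun setT (fun p : (T * R) * W => addatom (mu p.2) p.1.1 p.1.2).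
Proof.
apply: (measurable_addatom (f := fun p : (T * R) * W => mu p.2)
  (g := fun p => p.1.1) (h := fun p => p.1.2)); exact: measurableT_comp.
Qed.

Lemma measurable_prob_addatom (F : set M) : measurable F ->
  measurable_fun setT (fun z => P [set w | F (addatom (mu w) z.1 z.2)]).
Proof.
move=> mF; have mG := measurable_addatom_mu measurableT mF; rewrite setTI in mG.
have := measurable_fun_xsection P mG; congr measurable_fun; apply/funext => z.
by congr (P _); apply/seteqP; split => w; rewrite /xsection/= inE.
Qed.

(** A ray event about mu is an event about Poisson integrals, where an additional
point (x, s) of the process is an additional atom of mass s at x.  Both sides
are finite measures in F, so that ray events suffice. *)
Lemma mecke_crm : exists2 N : R.-ker W ~> (T * R)%type,
  (forall D (F : set M), measurable D -> nu D < +oo -> measurable F ->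
   \int[P]_(w in mu @^-1` F) N w D =
   \int[nu]_(z in D) P [set w | F (addatom (mu w) z.1 z.2)]) &
  {ae P, forall w, forall A, measurable A -> mu w A = \int[N w]_z jump_fun A z}.
Proof.
have [N HN HA] := crm_poisson; exists N => // D F mD Doo mF.
have mND := measurable_count N mD.
have maa z : measurable_fun setT (fun w => addatom (mu w) z.1 z.2).
  by apply: measurable_addatom => //; exact: measurable_cst.
pose m1 := pushm (mdens_measure P mND (fun w => measure_ge0 (N w) D)) (measurable_funPT mu).
pose k z := pushm P (maa z).
have mk U : measurable U -> measurable_fun setT (fun z => k z U).
  exact: measurable_prob_addatom.
have mi : measurable_fun setT (fun z => (\1_D z)%:E : \bar R).
  by apply/measurable_EFinP; exact: measurable_indic.
have i0 z : 0 <= (\1_D z)%:E :> \bar R by rewrite lee_fin.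
pose m2 := mmix_measure (mdens_measure nu mi i0) mk.
have m2E U : measurable U -> m2 U = \int[nu]_(z in D) P [set w | U (addatom (mu w) z.1 z.2)].
  move=> mU; rewrite -integral_indicM; rewrite [LHS]integral_mdens//; last exact: (mk _ mU).
  by apply: eq_integral => z _; rewrite muleC.
have m12 A : ray_events A -> m1 A = m2 A.
  move=> rA; have mA : measurable A.
    by rewrite measurable_ray_events; exact: sub_sigma_algebra.
  rewrite m2E//; move: rA mA => [j [B [b [mB ->]]]] mA.
  have := mecke HN (fun i => (b i)%:E) (fun i => measurable_jump_fun (mB i))
    (fun i => jump_fun_ge0 (B i)) mD Doo.
  have mI i : measurable_fun setT (fun w => \int[N w]_z jump_fun (B i) z).
    apply: measurable_fun_integral_kernel.
    - exact: measurable_kernel.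
    - exact: jump_fun_ge0.
    - exact: measurable_jump_fun.
  have mmu i : measurable_fun setT (fun w => mu w (B i)) by exact: measurable_mu_ev.
  rewrite (integral_ae_dom (S2 := [set w | forall i, (b i)%:E < mu w (B i)]))//; last 3 first.
  - exact: measurable_rays.
  - exact: measurable_rays.
  - by apply: filterS HA => w Hw; split => h i; have := h i; rewrite Hw.
  move=> IE; transitivity (\int[P]_(w in [set w | forall i, (b i)%:E < mu w (B i)]) N w D).
    by [].
  rewrite IE; apply: eq_integral => z _.
  apply: probability_ae_eq.
  - by apply: measurable_rays => i; apply: emeasurable_funD => //; exact: measurable_cst.
  - by have := maa z measurableT _ mA; rewrite setTI.
  - by apply: filterS HA => w Hw; split => h i; have := h i; rewrite /= addatomE Hw.
rewrite -m2E//; suff : m1 F = m2 F by [].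
apply: (finite_measure_unique (G := ray_events)) => //.
- exact: measurable_ray_events.
- exact: ray_events_setI_closed.
- exact: ray_eventsT.
rewrite m12; last exact: ray_eventsT.
rewrite m2E//; under eq_integral do rewrite probability_setT.
by rewrite integral_cst// mul1e.
Qed.

Definition strip_seq (n : nat) : set (T * R) := cball n `*` `]n.+1%:R^-1%R, +oo[%classic.

Lemma measurable_strip_seq n : measurable (strip_seq n).
Proof. by apply: measurableX => //; exact: measurable_cball. Qed.

Lemma strip_seq_nd : nondecreasing_seq strip_seq.
Proof.
move=> m n mn; rewrite subsetEset => z [/= z1 z2]; split => /=.
  by have := @cball_nd R d T _ _ mn; rewrite subsetEset; apply.
move: z2; rewrite !in_itv/= !andbT; apply: le_lt_trans.
by rewrite lef_pV2 ?posrE// ler_nat ltnS.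
Qed.

Lemma strip_seq_cover : \bigcup_n strip_seq n = setT `*` `]0%R, +oo[%classic.
Proof.
apply/seteqP; split => z.
  move=> [n _ [/= _ z2]]; split => //=; move: z2; rewrite !in_itv/= !andbT.
  by apply: lt_trans; rewrite invr_gt0.
move=> [_ /=]; rewrite in_itv/= andbT => z0.
have [m hm] : exists k, (0 + k.+1%:R^-1 < z.2)%R by exact: ltr_add_invr.
have : (\bigcup_k cball k) z.1 by rewrite cball_cover.
move=> [k _ zk]; exists (maxn k m) => //; split => /=.
  by have := @cball_nd R d T _ _ (leq_maxl k m); rewrite subsetEset; apply.
rewrite in_itv/= andbT; apply: le_lt_trans hm; rewrite add0r.
by rewrite lef_pV2 ?posrE// ler_nat ltnS leq_maxr.
Qed.

(** Markov's inequality for min(s, 1), which is at least 1/(n+1) on the strip. *)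
Lemma strip_seq_finite n : nu (strip_seq n) < +oo.
Proof.
have := intensity_bounded Hnu (measurable_cball n) (ex_intro _ point (ex_intro _ n%:R (@subset_refl _ _))) ltr01.
set I := \int[nu]_(z in _) _ => Ioo.
have : (n.+1%:R^-1)%:E * nu (strip_seq n) <= I.
  rewrite -integral_cst; last exact: measurable_strip_seq.
  have mm : measurable_fun setT (fun z : T * R => (Num.min z.2 1)%:E).
    apply/measurable_EFinP; apply: measurable_minr => //; exact: measurable_cst.
  apply: (@le_trans _ _ (\int[nu]_(z in strip_seq n) (Num.min z.2 1)%:E)).
    apply: ge0_le_integral.
    - exact: measurable_strip_seq.
    - by move=> z _; rewrite lee_fin invr_ge0.
    - exact: measurable_cst.
    - exact: measurable_funTS.
    - move=> z [/= _]; rewrite in_itv/= andbT => z2; rewrite lee_fin le_min (ltW z2)/=.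
      by rewrite invf_le1 ?ler1n// ltr0n.
  apply: ge0_subset_integral.
  - exact: measurable_strip_seq.
  - by apply: measurable_strip; exact: measurable_cball.
  - exact: measurable_funTS.
  - move=> z [/= _]; rewrite in_itv/= andbT => z2; rewrite lee_fin le_min ler01 andbT.
    exact: ltW.
  - move=> z [/= z1]; rewrite !in_itv/= !andbT => z2; split => //=; rewrite ?in_itv/= ?andbT.
    by apply: lt_trans z2; rewrite invr_gt0.
move=> h; have {h} := le_lt_trans h Ioo.
move: (measure_ge0 nu (strip_seq n)); case: (nu (strip_seq n)) => [x _ _||//]; first exact: ltry.
by move=> _; rewrite gt0_muley// lte_fin invr_gt0.
Qed.

(** As mu(A) is an integral against the process N, the equation for the counts N(D)
is extended from indicators of sets D to functions.  The sets D are exhausted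
by sets of finite intensity. *)
Lemma palm_event (A : set T) (F : set M) : measurable A -> measurable F ->
  \int[P]_(w in mu @^-1` F) mu w A =
  \int[nu]_z (jump_fun A z * P [set w | F (addatom (mu w) z.1 z.2)]).
Proof.
move=> mA mF; have [N HN HA] := mecke_crm.
have := measurable_prob_addatom mF.
set G := fun z => P _ => mG; have G0 z : 0 <= G z by exact: measure_ge0.
have mmuF : measurable (mu @^-1` F) by rewrite -[X in measurable X]setTI; exact: measurable_funPT.
pose Pos : set (T * R) := setT `*` `]0%R, +oo[%classic.
have mPos : measurable Pos by exact: measurable_strip.
have mi d' (Y : measurableType d') (U : set Y) : measurable U ->
    measurable_fun setT (fun y => (\1_U y)%:E : \bar R).
  by move=> mU; exact/measurable_EFinP.
have mIN (u : T * R -> \bar R) : measurable_fun setT u -> (forall z, 0 <= u z) ->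
    measurable_fun setT (fun w => \int[N w]_z ((\1_Pos z)%:E * u z)).
  move=> mu' u0; apply: measurable_fun_integral_kernel; first exact: measurable_kernel.
  - by move=> z; rewrite mule_ge0// lee_fin.
  - by apply: emeasurable_funM => //; exact: mi.
have H (u : T * R -> \bar R) : measurable_fun setT u -> (forall z, 0 <= u z) ->
    \int[P]_w ((\1_(mu @^-1` F) w)%:E * \int[N w]_z ((\1_Pos z)%:E * u z)) =
    \int[nu]_z ((\1_Pos z)%:E * G z * u z).
  move: u; apply: integral_like_unique.
  - apply: (integral_like_int P (I := fun w u =>
        (\1_(mu @^-1` F) w)%:E * \int[N w]_z ((\1_Pos z)%:E * u z))) => [w|u mu' u0].
      apply: integral_likeZ; first by rewrite lee_fin.
      apply: (integral_like_int (N w) (I := fun z u => (\1_Pos z)%:E * u z)) => [z|u mu' u0].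
        by apply: integral_likeZ; [rewrite lee_fin|exact: integral_like_eval].
      by apply: emeasurable_funM => //; exact: mi.
    by apply: emeasurable_funM; [exact: mi|exact: mIN].
  - apply: (integral_like_int nu (I := fun z u => (\1_Pos z)%:E * G z * u z)) => [z|u mu' u0].
      by apply: integral_likeZ; [rewrite mule_ge0// lee_fin|exact: integral_like_eval].
    by apply: emeasurable_funM => //; apply: emeasurable_funM => //; exact: mi.
  move=> D mD.
  have mDn n : measurable (D `&` strip_seq n) by apply: measurableI => //; exact: measurable_strip_seq.
  have ndD : nondecreasing_seq (fun n => D `&` strip_seq n).
    by move=> m n mn; rewrite subsetEset; apply: setIS; rewrite -subsetEset; exact: strip_seq_nd.
  have UD : \bigcup_n (D `&` strip_seq n) = D `&` Pos by rewrite -setI_bigcupr strip_seq_cover.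
  have -> : \int[nu]_z ((\1_Pos z)%:E * G z * (\1_D z)%:E) = \int[nu]_(z in D `&` Pos) G z.
    rewrite -[RHS]integral_indicM; apply: eq_integral => z _.
    have -> : (\1_(D `&` Pos) z)%:E = (\1_D z)%:E * (\1_Pos z)%:E :> \bar R by rewrite !indicE in_setI -EFinM -natrM mulnb.
    by rewrite muleAC [(\1_D z)%:E * _]muleC.
  rewrite integral_indicM; under eq_integral do rewrite integral_indicM integral_indic//.
  have c1 : \int[P]_(w in mu @^-1` F) N w (D `&` strip_seq n) @[n --> \oo] -->
      \int[P]_(w in mu @^-1` F) N w (D `&` Pos).
    apply: cvg_integral_ndD => //.
    + by move=> n; apply: measurable_funTS; exact: measurable_count.
    + move=> w _ m n mn; apply: le_measure; rewrite ?inE//.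
      by rewrite -subsetEset; exact: ndD.
    + move=> w _; rewrite -UD; apply: nondecreasing_cvg_mu => //.
      exact: bigcupT_measurable.
  have c2 : \int[nu]_(z in D `&` strip_seq n) G z @[n --> \oo] --> \int[nu]_(z in D `&` Pos) G z.
    by rewrite -UD; apply: cvg_integral_bigcup.
  apply: (cvg_unique _ c1) => //.
  rewrite (_ : (fun n => _) = (fun n => \int[nu]_(z in D `&` strip_seq n) G z))//.
  apply/funext => n; apply: HN => //.
  apply: le_lt_trans (strip_seq_finite n); apply: le_measure; rewrite ?inE//.
  exact: measurable_strip_seq.
have mJ := measurable_jump_fun mA.
have jE z : (\1_Pos z)%:E * jump_fun A z = jump_fun A z.
  rewrite indicE; have [_|zP] := boolP (z \in Pos); first by rewrite mul1e.
  rewrite mul0e /jump_fun (_ : pos z.2 = 0%R) ?mul0e//.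
  apply/max_idPr; rewrite leNgt; apply/negP => z2; move/negP : zP; apply; rewrite inE.
  by split => //=; rewrite in_itv/= z2.
transitivity (\int[nu]_z ((\1_Pos z)%:E * G z * jump_fun A z)); last first.
  by apply: eq_integral => z _; rewrite muleAC jE.
rewrite -H//; last exact: jump_fun_ge0.
rewrite integral_indicM; under [RHS]eq_integral do under eq_integral do rewrite jE.
apply: ge0_ae_eq_integral => //.
- by apply: measurable_funTS; exact: measurable_mu_ev.
- apply: measurable_funTS; apply: measurable_fun_integral_kernel => //.
  + exact: measurable_kernel.
  + exact: jump_fun_ge0.
- by move=> w _; apply: integral_ge0 => z _; exact: jump_fun_ge0.
- by apply: filterS HA => w Hw _; rewrite Hw.
Qed.

End crm.

(** * The Palm formula *)

(** A simple function below f is below g once it is replaced by zero on N0. *)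
Lemma ge0_le_integral_ae {R : realType} d (X : measurableType d) (m : {measure set X -> \bar R})
    (f g : X -> \bar R) (N0 : set X) : measurable N0 -> m N0 = 0 ->
  (forall x, 0 <= f x) -> (forall x, 0 <= g x) -> (forall x, ~ N0 x -> f x <= g x) ->
  \int[m]_x f x <= \int[m]_x g x.
Proof.
move=> mN m0 f0 g0 fg; rewrite [leLHS]ge0_integralTE// [leRHS]ge0_integralTE//.
apply: ge_ereal_sup => _ [h /= hf <-].
pose h' := proj_nnsfun h (measurableC mN).
apply: ereal_sup_ubound; exists h'.
  move=> x; rewrite (_ : h' x = h x * \1_(~` N0) x)%R// indicE.
  have [/set_mem xN|xN] := boolP (x \in ~` N0).
    by rewrite mulr1; apply: le_trans (hf x) _; exact: fg.
  by rewrite mulr0.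
rewrite -!integralT_nnsfun; apply: ge0_ae_eq_integral => //.
- exact/measurable_EFinP.
- exact/measurable_EFinP.
- by move=> x _; rewrite lee_fin.
- by move=> x _; rewrite lee_fin.
exists N0; split => // x /=; apply: contra_notP => nN.
move=> _; rewrite mindicE mem_set ?mulr1//.
Qed.

Section good_kernel.
Context {R : realType} {d : measure_display} {T : polishType R d}.
Variables (eta : probability T R) (rho : R.-sigmafker T ~> R).
Variable (nu : {measure set (T * R) -> \bar R}).
Hypothesis Hnu : crm_intensity eta rho nu.

Let I (n : nat) : set R := `]n.+1%:R^-1%R, +oo[%classic.
Let band := seqDU I.

Let mI n : measurable (I n). Proof. exact: measurable_itv. Qed.

Let mband n : measurable (band n).
Proof. by apply: measurableD => //; exact: bigsetU_measurable. Qed.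

Let UI : \bigcup_n I n = `]0%R, +oo[%classic.
Proof.
apply/seteqP; split => [s [n _]|s]; rewrite /I /= !in_itv/= !andbT.
  by apply: lt_trans; rewrite invr_gt0.
move=> s0; have [n hn] : exists k, (0 + k.+1%:R^-1 < s)%R by exact: ltr_add_invr.
by exists n => //=; rewrite in_itv/= andbT -[X in (X < _)%R]add0r.
Qed.

Let G : set T := [set x | forall n, rho x (I n) < +oo].

Let mG : measurable G.
Proof.
rewrite (_ : G = \bigcap_n [set x | rho x (I n) < +oo]).
  apply: bigcap_measurable => // n _; rewrite -[X in measurable X]setTI.
  by apply: emeasurable_fun_infty_o => //; exact: measurable_kernel.
by apply/seteqP; split => x h n; [move=> _|]; exact: h.
Qed.

Let Goo x n : G x -> rho x (band n) < +oo.
Proof.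
move=> /(_ n); apply: le_lt_trans; apply: le_measure; rewrite ?inE//.
by move=> s [].
Qed.

Let B (n j : nat) : set T :=
  G `&` [set x | j%:R%:E <= rho x (band n)] `&` [set x | rho x (band n) < j.+1%:R%:E].

Let mB n j : measurable (B n j).
Proof.
apply: measurableI; first apply: measurableI => //.
- rewrite -[X in measurable X]setTI; apply: emeasurable_fun_c_infty => //.
  exact: measurable_kernel.
- rewrite -[X in measurable X]setTI; apply: emeasurable_fun_infty_o => //.
  exact: measurable_kernel.
Qed.

Let piece (n j : nat) (x : T) : {measure set R -> \bar R} :=
  mscale (NngNum (ler0n R (x \in B n j))) (mrestr (rho x) (mband n)).

Let pieceE n j x U : piece n j x U = ((x \in B n j)%:R)%:E * rho x (U `&` band n).
Proof. by []. Qed.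

Let piece_kernel n j U : measurable U -> measurable_fun setT (piece n j ^~ U).
Proof.
move=> mU; apply: emeasurable_funM.
  apply/measurable_EFinP; exact: (measurable_indic (mB n j)).
by apply: measurable_kernel; exact: measurableI.
Qed.

HB.instance Definition _ n j := isKernel.Build _ _ _ _ R (piece n j) (@piece_kernel n j).

Let piece_uub n j : measure_fam_uub (piece n j).
Proof.
exists j.+1%:R%R => x; rewrite /= pieceE setTI.
have [/set_mem[_ /= h]|_] := boolP (x \in B n j); first by rewrite mul1e.
by rewrite mul0e lte_fin.
Qed.

HB.instance Definition _ n j := Kernel_isFinite.Build _ _ _ _ R (piece n j) (@piece_uub n j).

Let r : R.-sfker T ~> R := kseries (fun n => kseries (fun j => piece n j : R.-sfker T ~> R) : R.-sfker T ~> R).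

Let rE x U : r x U = \sum_(n <oo) \sum_(j <oo) ((x \in B n j)%:R)%:E * rho x (U `&` band n).
Proof. by []. Qed.

Let r_bad x U : ~ G x -> r x U = 0.
Proof.
move=> nG; rewrite rE eseries0// => n _ _; rewrite eseries0// => j _ _.
rewrite memNset ?mul0e// => -[[]]//.
Qed.

Let r_good x U : G x -> measurable U -> r x U = rho x U.
Proof.
move=> Gx mU; rewrite rE.
have -> : (fun N : nat => \sum_(0 <= n < N) \sum_(0 <= j <oo) ((x \in B n j)%:R)%:E * rho x (U `&` band n)) =
    (fun N => \sum_(0 <= n < N) rho x (U `&` band n)).
  apply/funext => N; apply: eq_bigr => n _.
  have fin : rho x (band n) \is a fin_num by rewrite ge0_fin_numE// Goo.
  pose j0 := Num.truncn (fine (rho x (band n))).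
  have /andP[j0l j0r] : (j0%:R <= fine (rho x (band n)) < j0.+1%:R)%R.
    by apply: truncn_itv; exact: fine_ge0.
  rewrite (nneseriesD1 (n := j0))//.
  rewrite mem_set; last first.
    by split; [split => //|]; rewrite /= -[rho x _]fineK// ?lee_fin ?lte_fin.
  rewrite mul1e eseries0 ?adde0// => j _ /= jj0.
  rewrite memNset ?mul0e// => -[[_ /=]].
  rewrite -[rho x _]fineK// lee_fin lte_fin => h1 h2.
  case/negP: jj0; rewrite eqn_leq; apply/andP; split; rewrite -ltnS -(ltr_nat R).
    exact: le_lt_trans h1 j0r.
  exact: le_lt_trans j0l h2.
rewrite -measure_semi_bigcup//.
- rewrite -setI_bigcupr -seqDU_bigcup_eq UI.
  have -> : rho x U = rho x (U `&` `]0%R, +oo[) + rho x (U `&` `]-oo, 0%R]).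
    rewrite -measureU//; last 3 first.
    + exact: measurableI.
    + exact: measurableI.
    + by rewrite setIACA -subset0 => s [_ [/=]]; rewrite !in_itv/= andbT => s0; rewrite leNgt s0.
    rewrite -setIUr (_ : _ `|` _ = setT) ?setIT//.
    apply/seteqP; split => // s _ /=; rewrite !in_itv/= andbT.
    by have [|] := ltP 0%R s; [left|right].
  rewrite [X in _ = _ + X](_ : _ = 0) ?adde0//.
  apply/eqP; rewrite eq_le measure_ge0 andbT -(rho_positive Hnu x).
  by apply: le_measure; rewrite ?inE//; exact: measurableI.
- by move=> n; exact: measurableI.
- by apply: trivIset_setIl; exact: trivIset_seqDU.
- by apply: bigcupT_measurable => n; exact: measurableI.
Qed.

Let eta_bad : exists N0, [/\ measurable N0, eta N0 = 0 & forall x, ~ N0 x -> G x].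
Proof.
have H n : {ae eta, forall x, cball n x -> rho x (I n) < +oo}.
  have mr : measurable_fun setT (fun x => rho x (I n)) by exact: measurable_kernel.
  have : eta.-integrable (cball n) (fun x => rho x (I n)).
    apply/integrableP; split; first exact: measurable_funTS.
    apply: le_lt_trans (strip_seq_finite Hnu n).
    rewrite (intensityE Hnu (measurable_strip_seq n)) integral_mkcond.
    rewrite le_eqVlt; apply/orP; left; apply/eqP; apply: eq_integral => x _.
    rewrite patchE; have [xn|xn] := boolP (x \in cball n).
      by rewrite gee0_abs// in_xsectionX.
    by rewrite notin_xsectionX// measure0.
  move/(integrable_ae (measurable_cball n)); apply: filterS => x h /h.
  by rewrite ge0_fin_numE.
have : {ae eta, forall x, forall n, cball n x -> rho x (I n) < +oo} by exact/ae_foralln.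
move=> [N0 [mN0 eN0 sub]]; exists N0; split => // x nN m.
have h : forall n, cball n x -> rho x (I n) < +oo.
  by apply: contrapT => nh; apply: nN; apply: sub.
have : (\bigcup_k cball k) x by rewrite cball_cover.
move=> [k _ xk].
apply: (@le_lt_trans _ _ (rho x (I (maxn k m)))).
  apply: le_measure; rewrite ?inE// /I => s /=; rewrite !in_itv/= !andbT.
  by apply: le_lt_trans; rewrite lef_pV2 ?posrE// ler_nat ltnS leq_maxr.
apply: h; have := @cball_nd R d T _ _ (leq_maxl k m); rewrite subsetEset; exact.
Qed.

(** A kernel of sigma-finite measures need not be a countable sum of finite
kernels, and Tonelli's theorem can fail for it.  As nu is finite on strips, for
almost every x all the masses rho_x(1/(n+1), +oo) are finite.  For such x the
half-line is cut into bands, and for each band the points x are sorted by the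
integer part of the mass of the band: the restrictions are uniformly bounded
kernels.  The other points x receive the zero measure. *)
Lemma good_kernel : exists r : R.-sfker T ~> R,
  [/\ forall x, (forall U, measurable U -> r x U = rho x U) \/ (forall U, r x U = 0)
    & forall C, measurable C -> nu C = \int[eta]_x r x (xsection C x)].
Proof.
exists r; split.
  move=> x; have [Gx|nGx] := pselect (G x); [left|right] => U.
    exact: r_good.
  exact: r_bad.
move=> C mC; rewrite (intensityE Hnu mC).
have [N0 [mN0 eN0 NG]] := eta_bad.
apply/eqP; rewrite eq_le; apply/andP; split; apply: (ge0_le_integral_ae mN0 eN0) => // x /NG Gx.
  by rewrite r_good//; exact: measurable_xsection.
by rewrite r_good//; exact: measurable_xsection.
Qed.
End good_kernel.

Section palm.
Context {R : realType} {d : measure_display} {T : polishType R d}.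
Local Notation M := (bfmeasure T).
Variables (eta : probability T R) (rho : R.-sigmafker T ~> R).
Variable (nu : {measure set (T * R) -> \bar R}).
Hypothesis Hnu : crm_intensity eta rho nu.
Variable r : R.-sfker T ~> R.
Hypothesis rnu : forall C, measurable C -> nu C = \int[eta]_x r x (xsection C x).
Context {dW : measure_display} {W : measurableType dW}.
Variables (P : probability W R) (mu : {RV P >-> M}).
Hypothesis Hmu : crm_with_intensity nu mu.

Lemma measurable_int_kernel (u : T * R -> \bar R) : measurable_fun setT u ->
  (forall z, 0 <= u z) -> measurable_fun setT (fun x => \int[r x]_s u (x, s)).
Proof. by move=> mu' u0; exact: measurable_fun_integral_sfinite_kernel. Qed.

Lemma int_intensity (u : T * R -> \bar R) : measurable_fun setT u -> (forall z, 0 <= u z) ->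
  \int[nu]_z u z = \int[eta]_x \int[r x]_s u (x, s).
Proof.
move: u; apply: integral_like_unique; first exact: integral_like_integral.
- apply: (integral_like_int eta (I := fun x u => \int[r x]_s u (x, s))) => [x|u mu' u0].
    apply: (integral_like_int (r x) (I := fun s u => u (x, s))) => [s|u mu' u0].
      exact: integral_like_eval.
    exact: measurableT_comp mu' _.
  exact: measurable_int_kernel.
- move=> D mD; rewrite integral_indic// setIT rnu//; apply: eq_integral => x _.
  have mDx : measurable (xsection D x) by exact: measurable_xsection.
  rewrite -[xsection D x]setIT -integral_indic//; apply: eq_integral => s _.
  by rewrite !indicE mem_xsection.
Qed.

Lemma measurable_shift (F : M -> \bar R) : measurable_fun setT F -> (forall m, 0 <= F m) ->
  measurable_fun setT (fun z : T * R => \int[P]_w F (addatom (mu w) z.1 z.2)).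
Proof.
move=> mF F0.
apply: (@measurable_fun_fubini_tonelli_F _ _ _ _ _ P
  (fun p => F (addatom (mu p.2) p.1.1 p.1.2))) => //.
exact: measurableT_comp mF (measurable_addatom_mu mu).
Qed.

Lemma palm_nu (A : set T) (F : M -> \bar R) : measurable A -> measurable_fun setT F ->
  (forall m, 0 <= F m) ->
  \int[P]_w (mu w A * F (mu w)) =
  \int[nu]_z (jump_fun A z * \int[P]_w F (addatom (mu w) z.1 z.2)).
Proof.
move=> mA; move: F.
have mmA : measurable_fun setT (fun w => mu w A) by exact: measurable_mu_ev.
have maa z : measurable_fun setT (fun w => addatom (mu w) z.1 z.2).
  by apply: measurable_addatom => //; exact: measurable_cst.
have mFmu (F : M -> \bar R) : measurable_fun setT F -> measurable_fun setT (fun w => F (mu w)).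
  by move=> mF; exact: (measurableT_comp mF).
have mJ := measurable_jump_fun mA.
have J0 := @jump_fun_ge0 R d T A.
apply: integral_like_unique.
- apply: (integral_like_int P (I := fun w F => mu w A * F (mu w))) => [w|F mF F0].
    by apply: integral_likeZ => //; exact: integral_like_eval.
  by apply: emeasurable_funM => //; exact: mFmu.
- apply: (integral_like_int nu (I := fun z F => jump_fun A z * \int[P]_w F (addatom (mu w) z.1 z.2))) => [z|F mF F0].
    apply: integral_likeZ => //.
    apply: (integral_like_int P (I := fun w F => F (addatom (mu w) z.1 z.2))) => [w|F mF F0].
      exact: integral_like_eval.
    exact: (measurableT_comp mF (maa z)).
  by apply: emeasurable_funM => //; exact: measurable_shift.
- move=> F mF; have H := palm_event Hnu Hmu mA mF.
  transitivity (\int[P]_(w in mu @^-1` F) mu w A).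
    by rewrite -[RHS]integral_indicM; apply: eq_integral => w _; rewrite muleC.
  rewrite H; apply: eq_integral => z _; congr (_ * _).
  have mS : measurable [set w | F (addatom (mu w) z.1 z.2)].
    by have := maa z measurableT _ mF; rewrite setTI.
  by rewrite -[X in P X]setIT -integral_indic.
Qed.

(** Size-biasing by mu(A) adds an atom s delta_x at a point x of A, with the mass s
that it contributes to mu(A) as a factor. *)
Theorem palm (A : set T) (F : M -> \bar R) : measurable A -> measurable_fun setT F ->
  (forall m, 0 <= F m) ->
  \int[P]_w (mu w A * F (mu w)) =
  \int[eta]_(x in A) \int[r x]_s ((pos s)%:E * \int[P]_w F (addatom (mu w) x s)).
Proof.
move=> mA mF F0; rewrite palm_nu// int_intensity; last 2 first.
- apply: emeasurable_funM; first exact: measurable_jump_fun.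
  exact: measurable_shift.
- by move=> z; rewrite mule_ge0 ?jump_fun_ge0// integral_ge0.
rewrite -[RHS]integral_indicM; apply: eq_integral => x _; rewrite /jump_fun/= !indicE.
case: (x \in A); rewrite ?mul1e ?mul0e.
  by under eq_integral do rewrite mule1.
by under eq_integral do rewrite mule0 mul0e; rewrite integral0.
Qed.
End palm.

(** * Mixed moments *)

Section kernel_comap.
Context {R : realType} dX dY dZ (X : measurableType dX) (Y : measurableType dY) (Z : measurableType dZ).
Variables (g : Y -> X) (mg : measurable_fun setT g).

Definition kcomap (k : X -> {measure set Z -> \bar R}) (y : Y) : {measure set Z -> \bar R} := k (g y).

Section ker.
Variable k : R.-ker X ~> Z.
Let mk U : measurable U -> measurable_fun setT (kcomap k ^~ U).
Proof. by move=> mU; exact: (measurableT_comp (measurable_kernel k U mU) mg). Qed.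
HB.instance Definition _ := isKernel.Build _ _ _ _ R (kcomap k) mk.
End ker.

Section fker.
Variable k : R.-fker X ~> Z.
Let uub : measure_fam_uub (kcomap k).
Proof. by have [c hc] := measure_uub k; exists c => y; exact: hc. Qed.
HB.instance Definition _ := Kernel_isFinite.Build _ _ _ _ R (kcomap k) uub.
End fker.

(** A decomposition of k into finite kernels is transported along g. *)
Lemma measurable_int_kcomap (k : R.-sfker X ~> Z) (f : Y * Z -> \bar R) :
  measurable_fun setT f -> (forall z, 0 <= f z) ->
  measurable_fun setT (fun y => \int[k (g y)]_z f (y, z)).
Proof.
move=> mf f0.
have [s hs] := sfinite_kernel k.
pose s' n : R.-fker Y ~> Z := kcomap (s n).
have sf : exists s : (R.-fker Y ~> Z)^nat, forall y U, measurable U ->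
    kcomap k y U = kseries s y U.
  by exists s' => y U mU; rewrite [LHS]hs.
pose k' : R.-sfker Y ~> Z := HB.pack_for (SFiniteKernel.type Y Z R) (kcomap k)
  (Kernel_isSFinite.Build _ _ _ _ R (kcomap k) sf).
exact: (@measurable_fun_integral_sfinite_kernel _ _ _ _ R f k').
Qed.
End kernel_comap.

(** Tonelli's theorem for measures, such as the values of a kernel, whose
s-finiteness is a proof and not part of their structure. *)
Lemma sfinite_swap {R : realType} d d' (X : measurableType d) (Y : measurableType d')
    (m1 : {measure set X -> \bar R}) (m2 : {measure set Y -> \bar R}) (f : X * Y -> \bar R) :
  sfinite_measure m1 -> sfinite_measure m2 -> measurable_fun setT f -> (forall z, 0 <= f z) ->
  \int[m1]_x \int[m2]_y f (x, y) = \int[m2]_y \int[m1]_x f (x, y).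
Proof.
move=> s1 s2 mf f0.
pose H1 := isSFinite.Build _ _ _ _ s1.
pose H2 := isSFinite.Build _ _ _ _ s2.
pose n1 := HB.pack_for (SFiniteMeasure.type X R) (Measure.sort m1) H1.
pose n2 := HB.pack_for (SFiniteMeasure.type Y R) (Measure.sort m2) H2.
have E1 : m1 = n1 by exact: eq_measure.
have E2 : m2 = n2 by exact: eq_measure.
rewrite E1 E2.
exact: (sfinite_Fubini n1 n2 f f0 mf).
Qed.

Section increments.
Variable T : eqType.

Definition incr (y : T) (l : seq (T * nat)) := [seq (z.1, ((z.1 == y) + z.2)%N) | z <- l].

Lemma incr_id y l : y \notin map fst l -> incr y l = l.
Proof.
move=> yl; rewrite /incr -[RHS]map_id; apply/eq_in_map => -[z k] zl /=.
case: eqP => // zy; case/negP: yl; rewrite -zy; apply/mapP; by exists (z, k).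
Qed.

End increments.

Section mixed_moments.
Context {R : realType} {d : measure_display} {T : polishType R d}.
Local Notation M := (bfmeasure T).
Variable r : R.-sfker T ~> R.
Context {dW : measure_display} {W : measurableType dW}.
Variables (P : probability W R) (mu : {RV P >-> M}).

(** For the list of pairs (y_k, m_k), the integral against the product of the
measures s_k^(m_k) r_(y_k)(ds_k) of the expectation of
F(mu + sum_k s_k delta_(y_k)). *)
Fixpoint mixed (l : seq (T * nat)) (F : M -> \bar R) : \bar R :=
  if l is (y, m) :: l' then
    \int[r y]_s ((pos s ^+ m)%:E * mixed l' (fun m0 => F (addatom m0 y s)))
  else \int[P]_w F (mu w).

Lemma mixed_ge0 l F : (forall m, 0 <= F m) -> 0 <= mixed l F.
Proof.
elim: l F => [|[y m] l ih] F F0 /=; first exact: integral_ge0.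
apply: integral_ge0 => s _; apply: mule_ge0; first by rewrite lee_fin exprn_ge0// pos_ge0.
exact: ih.
Qed.

Lemma measurable_pos_exp k dZ (Z : measurableType dZ) (f : Z -> R) : measurable_fun setT f ->
  measurable_fun setT (fun z => (pos (f z) ^+ k)%:E).
Proof.
move=> mf; apply/measurable_EFinP; apply: measurable_funX.
exact: measurableT_comp measurable_pos mf.
Qed.

(** The points of the list may depend on the parameter, the exponents do not: the
multiplicities in a sample are constant on each set where the same entries
coincide. *)
Lemma measurable_mixed (I : Type) (rs : seq I) (c : I -> nat) dY (Y : measurableType dY)
    (g : I -> Y -> T) (F : Y * M -> \bar R) :
  (forall i, measurable_fun setT (g i)) -> measurable_fun setT F -> (forall z, 0 <= F z) ->
  measurable_fun setT (fun y => mixed [seq (g i y, c i) | i <- rs] (fun m => F (y, m))).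
Proof.
elim: rs dY Y g F => [|i rs ih] dY Y g F mg mF F0 /=.
  have mG : measurable_fun setT (fun p : Y * W => F (p.1, mu p.2)).
    apply: measurableT_comp mF _; apply: measurable_fun_pair => //.
    exact: measurableT_comp.
  exact: (@measurable_fun_fubini_tonelli_F _ _ _ _ _ P _ mG).
apply: (@measurable_int_kcomap R _ _ _ _ _ _ _ (mg i) r (fun p : Y * R => (pos p.2 ^+ c i)%:E *
   mixed [seq (g j p.1, c j) | j <- rs] (fun m0 => F (p.1, addatom m0 (g i p.1) p.2)))).
  apply: emeasurable_funM.
    apply/measurable_EFinP; apply: measurable_funX.
    exact: measurableT_comp measurable_pos _.
  pose G (z : (Y * R) * M) := F (z.1.1, addatom z.2 (g i z.1.1) z.1.2).
  have mG : measurable_fun setT G.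
    apply: measurableT_comp mF _; apply: measurable_fun_pair.
      exact: measurableT_comp.
    apply: measurable_addatom => //.
      apply: measurableT_comp (mg i) _; exact: measurableT_comp.
    exact: measurableT_comp.
  apply: (ih _ _ (fun j (p : Y * R) => g j p.1) G) => //.
    by move=> j; apply: measurableT_comp (mg j) _.
  by move=> z; exact: F0.
by move=> z; apply: mule_ge0; [rewrite lee_fin exprn_ge0// pos_ge0|exact: mixed_ge0].
Qed.

Lemma measurable_mixed_param (l : seq (T * nat)) dY (Y : measurableType dY) (F : Y * M -> \bar R) :
  measurable_fun setT F -> (forall z, 0 <= F z) ->
  measurable_fun setT (fun y => mixed l (fun m => F (y, m))).
Proof.
move=> mF F0.
have := @measurable_mixed _ l snd _ Y (fun z _ => z.1) F (fun i => measurable_cst _) mF F0.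
by rewrite (_ : [seq (i.1, i.2) | i <- l] = l)// -[RHS]map_id; apply: eq_map; case.
Qed.

Lemma measurable_mixed_atom l (y : T) (F : M -> \bar R) : measurable_fun setT F ->
  (forall m, 0 <= F m) ->
  measurable_fun setT (fun s => mixed l (fun m => F (addatom m y s))).
Proof.
move=> mF F0.
apply: (@measurable_mixed_param l _ _ (fun z : R * M => F (addatom z.2 y z.1))) => //.
apply: measurableT_comp mF _; exact: measurable_addatom.
Qed.

Lemma mixed_integral_like l : integral_like (mixed l).
Proof.
elim: l => [|[y m] l ih] /=.
  apply: integral_like_int => [w|F mF F0]; first exact: integral_like_eval.
  exact: measurableT_comp.
apply: (@integral_like_int _ _ _ _ _ _ (fun s F => (pos s ^+ m)%:E * mixed l (fun m0 => F (addatom m0 y s)))).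
  move=> s; apply: integral_likeZ; first by rewrite lee_fin exprn_ge0// pos_ge0.
  apply: (integral_like_comp (phi := fun m0 : M => addatom m0 y s) _ ih).
  by apply: measurable_addatom => //; exact: measurable_cst.
move=> F mF F0; apply: emeasurable_funM; last exact: measurable_mixed_atom.
apply/measurable_EFinP; apply: measurable_funX; exact: measurable_pos.
Qed.

Lemma mixedD l F G : measurable_fun setT F -> (forall m, 0 <= F m) ->
  measurable_fun setT G -> (forall m, 0 <= G m) ->
  mixed l (fun m => F m + G m) = mixed l F + mixed l G.
Proof.
move=> mF F0 mG G0; have [_ _ _ h _] := mixed_integral_like l.
by rewrite -[X in X + _]mul1e -h//; congr mixed; apply/funext => m; rewrite mul1e.
Qed.

Lemma mixedZ l (a : R) F : (0 <= a)%R -> measurable_fun setT F -> (forall m, 0 <= F m) ->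
  mixed l (fun m => a%:E * F m) = a%:E * mixed l F.
Proof.
move=> a0 mF F0; have [h0 _ _ h _] := mixed_integral_like l.
rewrite -[RHS]adde0 -h0 -h//.
by congr mixed; apply/funext => m; rewrite adde0.
Qed.

Variable eta : probability T R.
Hypothesis Hpalm : forall (A : set T) (F : M -> \bar R), measurable A -> measurable_fun setT F ->
  (forall m, 0 <= F m) ->
  \int[P]_w (mu w A * F (mu w)) =
  \int[eta]_(x in A) \int[r x]_s ((pos s)%:E * \int[P]_w F (addatom (mu w) x s)).

Lemma measurable_mixed_cons l dY (Y : measurableType dY) (g : Y -> T) (F : Y * M -> \bar R) :
  measurable_fun setT g -> measurable_fun setT F -> (forall z, 0 <= F z) ->
  measurable_fun setT (fun y => mixed ((g y, 1%N) :: l) (fun m => F (y, m))).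
Proof.
move=> mg mF F0.
have := @measurable_mixed _ (None :: map Some l)
  (fun o : option (T * nat) => if o is Some z then z.2 else 1%N)
  _ Y (fun o y => if o is Some z then z.1 else g y) F.
move=> h; under eq_fun => y.
  rewrite (_ : (g y, 1%N) :: l = [seq ((if o is Some z then z.1 else g y),
    (if o is Some z then z.2 else 1%N)) | o <- None :: map Some l]).
  over.
  by rewrite /= -map_comp; congr cons; rewrite -[LHS]map_id; apply: eq_map; case.
by apply: h => // -[z|//]; exact: measurable_cst.
Qed.

(** A factor m(A) under mixed sees the measure mu + sum_k s_k delta_(y_k).  The part
mu contributes a new atom by the Palm formula, and the mass s_k, for y_k in A,
raises the exponent at y_k by one. *)
Lemma mixed_ev l (A : set T) F : measurable A -> measurable_fun setT F -> (forall m, 0 <= F m) ->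
  uniq (map fst l) ->
  mixed l (fun m : M => m A * F m) =
  \int[eta]_(x in A) mixed ((x, 1%N) :: l) F +
  \sum_(y <- map fst l) (\1_A y)%:E * mixed (incr y l) F.
Proof.
move=> mA; elim: l F => [|[y m] l ih] F mF F0 /= => [_|/andP[yl ul]].
  by rewrite big_nil adde0 Hpalm.
have ma s : measurable_fun setT (fun m0 : M => addatom m0 y s).
  by apply: measurable_addatom => //; exact: measurable_cst.
have mFa s : measurable_fun setT (fun m0 : M => F (addatom m0 y s)).
  exact: measurableT_comp mF (ma s).
have mev : measurable_fun setT (fun m0 : M => m0 A) by exact: ev_measurable.
have p0 s k : 0 <= (pos s ^+ k)%:E by rewrite lee_fin exprn_ge0// pos_ge0.
have mp k : measurable_fun setT (fun s : R => (pos s ^+ k)%:E : \bar R).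
  exact: (measurable_pos_exp k (@measurable_id _ R setT)).
(* The mass of A is split into that of the inner measure, covered by the
   induction hypothesis, and that of the outermost atom. *)
have E1 s : mixed l (fun m0 => addatom m0 y s A * F (addatom m0 y s)) =
   \int[eta]_(x in A) mixed ((x, 1%N) :: l) (fun m0 => F (addatom m0 y s)) +
   (\sum_(k <- map fst l) (\1_A k)%:E * mixed (incr k l) (fun m0 => F (addatom m0 y s)) +
   (\1_A y)%:E * ((pos s)%:E * mixed l (fun m0 => F (addatom m0 y s)))).
  rewrite addeA -ih// muleA [(\1_A y)%:E * _]muleC -EFinM -mixedZ//; last first.
    by rewrite mulr_ge0// pos_ge0.
  rewrite -mixedD//.
  - congr mixed; apply/funext => m0; rewrite addatomE ge0_muleDl//.
    by rewrite mule_ge0// lee_fin pos_ge0.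
  - exact: emeasurable_funM.
  - by move=> m0; rewrite mule_ge0.
  - exact: measurable_funeM.
  - by move=> m0; rewrite mule_ge0// lee_fin mulr_ge0// pos_ge0.
under eq_integral => s _ do rewrite E1.
pose G s := mixed l (fun m0 => F (addatom m0 y s)).
pose H k s := mixed (incr k l) (fun m0 => F (addatom m0 y s)).
pose K s x := mixed ((x, 1%N) :: l) (fun m0 => F (addatom m0 y s)).
have mG : measurable_fun setT G by exact: measurable_mixed_atom.
have mH k : measurable_fun setT (H k) by exact: measurable_mixed_atom.
have mK : measurable_fun setT (fun z : R * T => K z.1 z.2).
  apply: (@measurable_mixed_cons l _ (R * T)%type snd (fun z => F (addatom z.2 y z.1.1))) => //.
  by apply: measurableT_comp mF _; apply: measurable_addatom => //; exact: measurableT_comp.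
have G0 s : 0 <= G s by apply: mixed_ge0.
have H0 k s : 0 <= H k s by apply: mixed_ge0.
have K0 s x : 0 <= K s x by apply: mixed_ge0.
have E2 s : (pos s ^+ m)%:E * (\int[eta]_(x in A) K s x + (\sum_(k <- map fst l) (\1_A k)%:E * H k s + (\1_A y)%:E * ((pos s)%:E * G s))) =
  \int[eta]_(x in A) ((pos s ^+ m)%:E * K s x) + (\sum_(k <- map fst l) (\1_A k)%:E * ((pos s ^+ m)%:E * H k s) + (\1_A y)%:E * ((pos s ^+ m.+1)%:E * G s)).
  have S0 : 0 <= \sum_(k <- map fst l) (\1_A k)%:E * H k s.
    by apply: sume_ge0 => k _; rewrite mule_ge0.
  have S1 : 0 <= (\1_A y)%:E * ((pos s)%:E * G s).
    by rewrite !mule_ge0// lee_fin pos_ge0.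
  have S2 : 0 <= \int[eta]_(x in A) K s x by exact: integral_ge0.
  rewrite (ge0_muleDr _ S2 (adde_ge0 S0 S1)) (ge0_muleDr _ S0 S1).
  congr (_ + _).
    rewrite ge0_integralZl//.
    exact: measurable_funTS (measurableT_comp mK (measurable_pair1 s)).
  rewrite ge0_sume_distrr; last by move=> k _; rewrite mule_ge0.
  congr (_ + _); first by apply: eq_bigr => k _; rewrite muleCA.
  by rewrite muleCA; congr (_ * _); rewrite muleA -EFinM exprSr.
under eq_integral => s _ do rewrite [_ * _]E2.
have mcK : measurable_fun setT (fun z : R * T => (pos z.1 ^+ m)%:E * K z.1 z.2).
  by apply: emeasurable_funM => //; exact: (measurable_pos_exp m measurable_fst).
have mcKA : measurable_fun setT (fun z : R * T => (pos z.1 ^+ m)%:E * K z.1 z.2 * (\1_A z.2)%:E).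
  apply: emeasurable_funM => //; apply/measurable_EFinP.
  exact: (measurableT_comp (measurable_indic mA) measurable_snd).
have mcH k : measurable_fun setT (fun s => (\1_A k)%:E * ((pos s ^+ m)%:E * H k s)).
  by apply: measurable_funeM; exact: emeasurable_funM.
have mcG : measurable_fun setT (fun s => (pos s ^+ m.+1)%:E * G s) by exact: emeasurable_funM.
have mint : measurable_fun setT (fun s => \int[eta]_(x in A) ((pos s ^+ m)%:E * K s x)).
  rewrite (_ : (fun s => _) = (fun s => \int[eta]_x ((pos s ^+ m)%:E * K s x * (\1_A x)%:E))).
    apply: (@measurable_fun_fubini_tonelli_F _ _ _ _ _ eta _ mcKA).
    by move=> z; rewrite !mule_ge0.
  by apply/funext => s; rewrite integral_mkcond epatch_indic.
rewrite ge0_integralD//; last 3 first.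
- by move=> s _; apply: integral_ge0 => x _; rewrite mule_ge0.
- move=> s _; rewrite adde_ge0 ?mule_ge0 ?sume_ge0// => k _; by rewrite !mule_ge0.
- by apply: emeasurable_funD; [apply: emeasurable_sum|exact: measurable_funeM].
congr (_ + _).
  (* The new atom, created inside the integral over the atom at y, is moved
     outside. *)
  under eq_integral => s _ do rewrite integral_mkcond epatch_indic.
  have sr z : sfinite_measure (r z) by exact: sfinite_kernel_measure.
  rewrite (@sfinite_swap _ _ _ _ _ (r y) eta (fun z => (pos z.1 ^+ m)%:E * K z.1 z.2 * (\1_A z.2)%:E))//=; last 2 first.
  - exact: s_finite.
  - by move=> z; rewrite !mule_ge0.
  rewrite [RHS]integral_mkcond; apply: eq_integral => x _.
  rewrite patchE indicE; case: ifPn => xA; last first.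
    by rewrite integral0_eq// => s _; rewrite mule0.
  under eq_integral do rewrite mule1.
  pose L s t := mixed l (fun m0 => F (addatom (addatom m0 x t) y s)).
  have mL : measurable_fun setT (fun z : R * R => L z.1 z.2).
    apply: (@measurable_mixed_param l _ _ (fun z : (R * R) * M => F (addatom (addatom z.2 x z.1.2) y z.1.1))) => //.
    apply: measurableT_comp mF _; apply: measurable_addatom.
    + apply: measurable_addatom => //; exact: measurableT_comp.
    + exact: measurable_cst.
    + exact: measurableT_comp.
  have L0 s t : 0 <= L s t by apply: mixed_ge0.
  have p10 t : 0 <= (pos t ^+ 1)%:E by exact: p0.
  transitivity (\int[r y]_s \int[r x]_t ((pos s ^+ m)%:E * ((pos t ^+ 1)%:E * L s t))).
    apply: eq_integral => s _; rewrite ge0_integralZl//.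
    - by apply: emeasurable_funM => //; exact: measurableT_comp mL (measurable_pair1 s).
    - by move=> t _; rewrite mule_ge0.
  rewrite (@sfinite_swap _ _ _ _ _ (r y) (r x) (fun z => (pos z.1 ^+ m)%:E * ((pos z.2 ^+ 1)%:E * L z.1 z.2)))//=; last 2 first.
  - apply: emeasurable_funM; first exact: (measurable_pos_exp m measurable_fst).
    by apply: emeasurable_funM => //; exact: (measurable_pos_exp 1 measurable_snd).
  - by move=> z; rewrite !mule_ge0.
  have LE s t : mixed l (fun m0 => F (addatom (addatom m0 y s) x t)) = L s t.
    by congr mixed; apply/funext => m0; rewrite addatomC.
  apply: eq_integral => t _.
  under [in RHS]eq_integral do rewrite LE.
  rewrite -ge0_integralZl//.
  - by apply: eq_integral => s _; rewrite muleCA.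
  - by apply: emeasurable_funM => //; exact: measurableT_comp mL (measurable_pair2 t).
  - by move=> s _; rewrite mule_ge0.
rewrite big_cons eqxx/= addeC ge0_integralD//; last 4 first.
- by move=> s _; apply: sume_ge0 => k _; rewrite !mule_ge0.
- exact: emeasurable_sum.
- by move=> s _; rewrite mule_ge0 ?mule_ge0.
- exact: measurable_funeM.
have incrl := incr_id yl.
congr (_ + _); last first.
  rewrite -/(incr y l) incrl ge0_integralZl// => s _; by rewrite mule_ge0.
rewrite ge0_integral_sum//; last by move=> k s _; rewrite !mule_ge0.
apply: eq_big_seq => k kl.
have -> : (y == k) = false by apply/negbTE; apply: contraNneq yl => ->.
rewrite add0n ge0_integralZl//; first exact: emeasurable_funM.
by move=> s _; rewrite mule_ge0.
Qed.
End mixed_moments.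

(** * The moment measure of a sample *)

Section cells.
Variable T : eqType.

Definition cells (x : seq T) := [seq (y, count_mem y x) | y <- undup x].

Lemma cells_keys x : map fst (cells x) = undup x.
Proof. by rewrite /cells -map_comp -[RHS]map_id; apply: eq_map. Qed.

(** The indices kept by undup, which retains last occurrences.  They are computed
from the relation of equality between entries and do not involve the entries
themselves. *)
Fixpoint last_occurrences (I : Type) (e : rel I) (s : seq I) :=
  if s is i :: s' then
    if has (e i) s' then last_occurrences e s' else i :: last_occurrences e s'
  else [::].

Lemma undup_map (I : eqType) (e : rel I) (f : I -> T) (s : seq I) :
  (forall i j, e i j = (f i == f j)) ->
  undup (map f s) = map f (last_occurrences e s).
Proof.
move=> ef; elim: s => //= i s ih.
have -> : (f i \in map f s) = has (e i) s.
  apply/mapP/hasP => -[j js]; first by move=> fij; exists j; rewrite ?ef ?fij.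
  by rewrite ef => /eqP fij; exists j.
by case: ifP => _; rewrite ih.
Qed.

Lemma cells_map (I : eqType) (e : rel I) (f : I -> T) (s : seq I) :
  (forall i j, e i j = (f i == f j)) ->
  cells (map f s) = [seq (f i, count (e^~ i) s) | i <- last_occurrences e s].
Proof.
move=> ef; rewrite /cells (undup_map _ ef) -map_comp; apply: eq_map => i /=.
by congr pair; rewrite count_map; apply: eq_count => j /=; rewrite ef.
Qed.

Lemma last_occurrences_uniq (I : eqType) (e : rel I) (s : seq I) :
  uniq s -> uniq (last_occurrences e s).
Proof.
move=> us; apply: subseq_uniq us.
elim: s => //= i s ih; case: ifP => _; last by rewrite eqxx.
exact: subseq_trans ih (subseq_cons _ _).
Qed.

Lemma cells_fresh y x : y \notin x -> cells (y :: x) = (y, 1%N) :: cells x.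
Proof.
move=> yx; rewrite /cells /= (negbTE yx) /= eqxx (count_memPn yx) addn0; congr cons.
apply/eq_in_map => z; rewrite mem_undup => zx; rewrite (_ : (y == z) = false)//.
by apply: contraNF yx => /eqP ->.
Qed.
Lemma cells_repeat y x : y \in x -> cells (y :: x) = incr y (cells x).
Proof.
move=> yx; rewrite /cells /= yx /incr -map_comp; apply: eq_map => z /=.
by rewrite eq_sym.
Qed.
End cells.

Section polish_equality.
Context {R : realType} {d : measure_display} {T : polishType R d}.

Lemma eq_mdistP (x y : T) : (forall n, mdist (dense_pt n) x = mdist (dense_pt n) y) -> x = y.
Proof.
move=> h; apply: mdist_positivity; apply/eqP; rewrite eq_le mdist_ge0 andbT.
apply/ler_addgt0Pl => e e0; rewrite addr0.
have [|n hn] := @dense_ptP R d T x (e / 2)%R; first by rewrite divr_gt0.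
apply: le_trans (metric_triangle _ (dense_pt n) _) _.
by rewrite (metric_sym x) -h; lra.
Qed.

(** Points are separated by countably many measurable functions, the distances to
a dense sequence. *)
Lemma measurable_eq_polish dY (Y : measurableType dY) (f g : Y -> T) :
  measurable_fun setT f -> measurable_fun setT g -> measurable [set y | f y = g y].
Proof.
move=> mf mg.
rewrite (_ : [set y | _] = \bigcap_n [set y | (mdist (dense_pt n) (f y))%:E = (mdist (dense_pt n) (g y))%:E]).
  apply: bigcapT_measurable => n; rewrite -[X in measurable X]setTI.
  have md : measurable_fun setT (mdist (dense_pt n : T) : T -> R).
    by apply: continuous_measurable; exact: continuous_mdist.
  apply: measurable_eqe => //; apply/measurable_EFinP; exact: measurableT_comp md _.
apply/seteqP; split => y /=; first by move=> fg n _; rewrite /= fg.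
by move=> h; apply: eq_mdistP => n; have [] := h n I.
Qed.

Lemma measurable_point (x : T) : measurable [set x].
Proof. exact: (@measurable_eq_polish _ T id (cst x)). Qed.

Lemma ae_notin (eta : {measure set T -> \bar R}) (s : seq T) :
  (forall x, eta [set x] = 0) -> {ae eta, forall y, y \notin s}.
Proof.
move=> na; elim: s => [|x s ih]; first exact: aeW.
have : {ae eta, forall y, y <> x}.
  exists [set x]; split; [exact: measurable_point|exact: na|].
  by move=> y /=; exact: contrapT.
by move: ih; apply: filterS2 => y ys yx; rewrite inE negb_or ys andbT; exact/eqP.
Qed.
End polish_equality.

Section equality_patterns.
Context {R : realType} {d : measure_display} {T : polishType R d} {n : nat}.

(** The relation of equality between entries takes finitely many values, and fixes
the indices and the multiplicities of the cells. *)
Definition pattern (x : n.-tuple T) : {ffun 'I_n * 'I_n -> bool} :=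
  [ffun p => tnth x p.1 == tnth x p.2].

Lemma measurable_pattern e : measurable [set x | pattern x = e].
Proof.
rewrite (_ : [set x | _] = \bigcap_(p in [set: 'I_n * 'I_n])
    [set x | (tnth x p.1 == tnth x p.2) = e p]).
  apply: fin_bigcap_measurable => // p _.
  have mE : measurable [set x : n.-tuple T | tnth x p.1 = tnth x p.2].
    by apply: measurable_eq_polish; exact: measurable_tnth.
  case: (e p).
    rewrite (_ : [set x | _] = [set x : n.-tuple T | tnth x p.1 = tnth x p.2])//.
    by apply/seteqP; split => x /= /eqP.
  rewrite (_ : [set x | _] = ~` [set x : n.-tuple T | tnth x p.1 = tnth x p.2]).
    exact: measurableC.
  by apply/seteqP; split => x /=; [move=> /negbT/eqP|move=> h; apply/negbTE/eqP].
apply/seteqP; split => x /=; first by move=> <- p _ /=; rewrite ffunE.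
by move=> h; apply/ffunP => p; rewrite ffunE; exact: h.
Qed.

Lemma measurable_by_pattern (F : n.-tuple T -> \bar R) G :
  (forall e, measurable_fun setT (G e)) -> (forall x, F x = G (pattern x) x) ->
  measurable_fun setT F.
Proof.
move=> mG FG.
rewrite (_ : F = fun x => \sum_e (\1_[set x | pattern x = e] x)%:E * G e x).
  apply: emeasurable_sum => e _; apply: emeasurable_funM => //; apply/measurable_EFinP.
  exact: measurable_indic (measurable_pattern e).
apply/funext => x; rewrite (bigD1 (pattern x))//= indicE mem_set// mul1e big1 ?adde0//.
by move=> e ex; rewrite indicE memNset ?mul0e//= => xe; rewrite xe eqxx in ex.
Qed.

Definition pattern_rel (e : {ffun 'I_n * 'I_n -> bool}) : rel 'I_n := fun i j => e (i, j).
Definition representatives (x : n.-tuple T) := last_occurrences (pattern_rel (pattern x)) (enum 'I_n).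

Lemma undup_tuple (x : n.-tuple T) : undup x = map (tnth x) (representatives x).
Proof.
rewrite -[X in undup X]map_tnth_enum; apply: undup_map => i j.
by rewrite /pattern_rel ffunE.
Qed.

Lemma cells_tuple (x : n.-tuple T) :
  cells x = [seq (tnth x i, count (pattern_rel (pattern x) ^~ i) (enum 'I_n)) | i <- representatives x].
Proof.
rewrite -[X in cells X]map_tnth_enum; apply: cells_map => i j.
by rewrite /pattern_rel ffunE.
Qed.
End equality_patterns.

Section mixed_cells.
Context {R : realType} {d : measure_display} {T : polishType R d}.
Local Notation M := (bfmeasure T).
Variable r : R.-sfker T ~> R.
Context {dW : measure_display} {W : measurableType dW}.
Variables (P : probability W R) (mu : {RV P >-> M}).
Local Notation mixed := (mixed r mu).

Lemma measurable_mixed_cells n (F : M -> \bar R) : measurable_fun setT F -> (forall m, 0 <= F m) ->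
  measurable_fun setT (fun x : n.-tuple T => mixed (cells x) F).
Proof.
move=> mF F0.
apply: (measurable_by_pattern (G := fun e x => mixed [seq (tnth x i,
    count (pattern_rel e ^~ i) (enum 'I_n)) | i <- last_occurrences (pattern_rel e) (enum 'I_n)] F)).
  move=> e; apply: (@measurable_mixed _ _ _ r _ _ _ mu _ _ _ _ _ (fun i (x : n.-tuple T) => tnth x i) (F \o snd)).
  - by move=> i; exact: measurable_tnth.
  - exact: measurableT_comp.
  - by move=> z /=.
by move=> x; rewrite cells_tuple.
Qed.

Variable eta : probability T R.
Hypothesis eta_na : forall x, eta [set x] = 0.
Hypothesis Hpalm : forall (A : set T) (F : M -> \bar R), measurable A -> measurable_fun setT F ->
  (forall m, 0 <= F m) ->
  \int[P]_w (mu w A * F (mu w)) =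
  \int[eta]_(x in A) \int[r x]_s ((pos s)%:E * \int[P]_w F (addatom (mu w) x s)).

Definition ind_rect n (A : 'I_n -> set T) (x : n.-tuple T) : R :=
  (\prod_i \1_(A i) (tnth x i))%R.

Lemma ind_rect_ge0 n (A : 'I_n -> set T) x : (0 <= ind_rect A x)%R.
Proof. by apply: prodr_ge0 => i _. Qed.

Lemma ind_rect_cons n (A : 'I_n.+1 -> set T) y (x : n.-tuple T) :
  ind_rect A [tuple of y :: x] = (\1_(A ord0) y * ind_rect (fun i => A (lift ord0 i)) x)%R.
Proof. by rewrite /ind_rect big_ord_recl; congr (_ * _)%R; apply: eq_bigr => i _; rewrite tnthS. Qed.

Lemma measurable_ind_rect n (A : 'I_n -> set T) : (forall i, measurable (A i)) ->
  measurable_fun setT (ind_rect A).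
Proof.
move=> mA; apply: measurable_prod => i _.
exact: measurableT_comp (measurable_indic (mA i)) (measurable_tnth i).
Qed.

(** One more sample point either opens a new cell or enlarges an existing one.  As
eta has no atoms, almost every point opens a new cell. *)
Lemma mixed_ev_cells n (A : set T) F (x : n.-tuple T) : measurable A -> measurable_fun setT F ->
  (forall m, 0 <= F m) ->
  mixed (cells x) (fun m : M => m A * F m) =
  \int[eta]_y ((\1_A y)%:E * mixed (cells (y :: x)) F) +
  \sum_(i < n) (i \in representatives x)%:R%:E *
     ((\1_A (tnth x i))%:E * mixed (cells (tnth x i :: x)) F).
Proof.
move=> mA mF F0; rewrite (mixed_ev Hpalm)// ?cells_keys ?undup_uniq//; congr (_ + _).
  rewrite integral_mkcond epatch_indic; apply: ge0_ae_eq_integral => //.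
  - apply: emeasurable_funM; last by apply/measurable_EFinP.
    apply: (@measurable_mixed_cons _ _ _ r _ _ P mu _ _ _ id (F \o snd)) => //=.
    exact: measurableT_comp.
  - apply: emeasurable_funM; first exact/measurable_EFinP.
    have := @measurable_mixed_cells n.+1 F mF F0.
    move=> /(measurableT_comp); apply.
    by apply: measurable_cons => //; exact: measurable_cst.
  - by move=> y _; rewrite mule_ge0 ?mixed_ge0//= lee_fin.
  - by move=> y _; rewrite mule_ge0// mixed_ge0.
  - apply: filterS (ae_notin x eta_na) => y yx _.
    by rewrite cells_fresh// muleC.
rewrite undup_tuple big_map big_uniq ?last_occurrences_uniq ?enum_uniq//=.
rewrite big_mkcond/=; apply: eq_bigr => i _; case: ifP => _; last by rewrite mul0e.
by rewrite mul1e cells_repeat ?mem_tnth.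
Qed.

(** By induction on n, a new point being either integrated against eta or placed at
one of the values already taken, each with weight one; the powers of the jumps
are accounted for by mixed. *)
Lemma moment_measure n : exists Lam : {measure set (n.-tuple T) -> \bar R},
  forall (A : 'I_n -> set T) F, (forall i, measurable (A i)) -> measurable_fun setT F ->
  (forall m, 0 <= F m) ->
  \int[P]_w ((\prod_(i < n) mu w (A i)) * F (mu w)) =
  \int[Lam]_x ((ind_rect A x)%:E * mixed (cells x) F).
Proof.
elim: n => [|n [Lam HLam]].
  exists (\d_[tuple] : {measure set (0.-tuple T) -> \bar R}) => A F _ mF F0.
  rewrite integral_dirac//; last first.
    apply: emeasurable_funM; last exact: measurable_mixed_cells.
    by apply/measurable_EFinP; apply: measurable_ind_rect; case.
  rewrite diracT mul1e /ind_rect big_ord0 mul1e.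
  by apply: eq_integral => w _; rewrite big_ord0 mul1e.
(* The functional which appends one point to a sample; the representatives are
   there to count each value already taken once. *)
pose I f := \int[Lam]_x (\int[eta]_y f [tuple of y :: x] +
  \sum_(i < n) (i \in representatives x)%:R%:E * f [tuple of tnth x i :: x]) : \bar R.
have mrep i : measurable_fun setT (fun x : n.-tuple T => (i \in representatives x)%:R%:E : \bar R).
  apply: (measurable_by_pattern (G := fun e _ =>
    (i \in last_occurrences (pattern_rel e) (enum 'I_n))%:R%:E)) => //.
have mcons : measurable_fun setT (fun z : n.-tuple T * T => [tuple of z.2 :: z.1]).
  exact: (@measurable_cons _ _ _ _ snd n fst).
have mconst (i : 'I_n) : measurable_fun setT (fun x : n.-tuple T => [tuple of tnth x i :: x]).
  by apply: (@measurable_cons _ _ _ _ (fun x : n.-tuple T => tnth x i) n id) => //; exact: measurable_tnth.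
have HI : integral_like I.
  apply: integral_like_int.
    move=> x; apply: integral_likeD.
      apply: integral_like_int; first by move=> y; exact: integral_like_eval.
      move=> f mf f0.
      exact: (measurableT_comp (measurableT_comp mf mcons) (measurable_pair1 x)).
    apply: integral_like_sum => i; apply: integral_likeZ => //.
  move=> f mf f0; apply: emeasurable_funD.
    apply: (@measurable_fun_fubini_tonelli_F _ _ _ _ _ eta _ (measurableT_comp mf mcons)).
    by move=> z /=.
  apply: emeasurable_sum => i _; apply: emeasurable_funM => //.
  exact: measurableT_comp.
have [Lam' HLam'] := integral_like_measure HI.
exists Lam' => A F mA mF F0.
have mmc := @measurable_mixed_cells n.+1 F mF F0.
have mir := measurable_ind_rect mA.
rewrite -HLam'; last 2 first.
- by apply: emeasurable_funM => //; exact/measurable_EFinP.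
- by move=> x; rewrite mule_ge0 ?lee_fin ?ind_rect_ge0// mixed_ge0.
have mev : measurable_fun setT (fun m : M => m (A ord0)) by exact: ev_measurable.
transitivity (\int[P]_w ((\prod_(i < n) mu w (A (lift ord0 i))) * (mu w (A ord0) * F (mu w)))).
  by apply: eq_integral => w _; rewrite big_ord_recl muleCA muleA.
rewrite (HLam (fun i => A (lift ord0 i)) (fun m => m (A ord0) * F m)) => //; last 2 first.
- exact: emeasurable_funM.
- by move=> m; rewrite mule_ge0.
apply: eq_integral => x _.
set B := fun i => A (lift ord0 i).
rewrite mixed_ev_cells// ge0_muleDr; last 2 first.
- by apply: integral_ge0 => y _; rewrite mule_ge0// mixed_ge0.
- by apply: sume_ge0 => i _; rewrite !mule_ge0// mixed_ge0.
have mcx : measurable_fun setT (fun y : T => [tuple of y :: x]).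
  exact: (measurableT_comp mcons (measurable_pair1 x)).
congr (_ + _).
  rewrite -ge0_integralZl//; last 3 first.
  - apply: emeasurable_funM; first exact/measurable_EFinP.
    exact: measurableT_comp mmc mcx.
  - by move=> y _; rewrite mule_ge0// mixed_ge0.
  - by rewrite lee_fin ind_rect_ge0.
  apply: eq_integral => y _.
  by rewrite ind_rect_cons EFinM muleCA muleA.
rewrite ge0_sume_distrr; last by move=> i _; rewrite !mule_ge0// mixed_ge0.
apply: eq_bigr => i _.
by rewrite ind_rect_cons EFinM muleCA; congr (_ * _); rewrite muleCA muleA.
Qed.
End mixed_cells.

(** * Bayes' formula *)

Section tuple_rectangles.
Context {d : measure_display} {T : measurableType d} {n : nat}.

Definition tuple_rects : set (set (n.-tuple T)) :=
  [set C | exists A : 'I_n -> set T, (forall i, measurable (A i)) /\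
    C = [set x | forall i, A i (tnth x i)]].

Lemma measurable_tuple_rect (A : 'I_n -> set T) : (forall i, measurable (A i)) ->
  measurable [set x : n.-tuple T | forall i, A i (tnth x i)].
Proof.
move=> mA; rewrite (_ : [set x | _] = \bigcap_(i in [set: 'I_n]) ((tnth (T := T))^~ i @^-1` A i)).
  apply: fin_bigcap_measurable => // i _; rewrite -[X in measurable X]setTI.
  by apply: measurable_tnth => //; exact: mA.
by apply/seteqP; split => x /= h i; [move=> _|]; exact: h.
Qed.

Lemma tuple_rectsE : (@measurable _ (n.-tuple T)) = <<s tuple_rects >>.
Proof.
apply/seteqP; split.
  apply: smallest_sub; first exact: smallest_sigma_algebra.
  move=> C; rewrite -bigcup_seq => -[i _ [B mB <-]].
  apply: sub_sigma_algebra; exists (fun j => if j == i then B else setT); split.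
    by move=> j; case: ifP.
  apply/seteqP; split => x /=.
    by move=> [_ Bx] j; case: eqP => // ->.
  by move=> /(_ i); rewrite eqxx.
apply: smallest_sub; first exact: sigma_algebra_measurable.
by move=> _ [A [mA ->]]; exact: measurable_tuple_rect.
Qed.

Lemma tuple_rects_setI_closed : setI_closed tuple_rects.
Proof.
move=> _ _ [A [mA ->]] [B [mB ->]]; exists (fun i => A i `&` B i); split.
  by move=> i; exact: measurableI.
apply/seteqP; split => x /=; first by move=> [h1 h2] i; split.
by move=> h; split => i; have [] := h i.
Qed.

Lemma tuple_rectsT : tuple_rects setT.
Proof. by exists (fun=> setT); split => //; apply/seteqP; split. Qed.
End tuple_rectangles.

Lemma measurable_eprod {R : realType} d (Y : measurableType d) (I : Type) (s : seq I)
    (f : I -> Y -> \bar R) : (forall i, measurable_fun setT (f i)) ->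
  measurable_fun setT (fun y => \prod_(i <- s) f i y).
Proof.
move=> mf; elim: s => [|i s ih]; first by under eq_fun do rewrite big_nil; exact: measurable_cst.
by under eq_fun do rewrite big_cons; exact: emeasurable_funM.
Qed.

Section bayes.
Context {R : realType} {d : measure_display} {T : polishType R d}.
Local Notation M := (bfmeasure T).
Variables (h' : R -> R) (q : R).
Hypothesis h'_meas : measurable_fun (`[0%R, +oo[%classic : set R) h'.
Hypothesis h'_pos : forall x : R, (0 <= x)%R -> (0 < h' x)%R.
Hypothesis q_ge0 : (0 <= q)%R.

Lemma measurable_tilt (p : R) : measurable_fun setT (fun m : M => (h' (total_mass m) * total_mass m `^ p)%R).
Proof.
apply: measurable_funM.
  apply: (measurable_comp (F := `[0%R, +oo[%classic : set R)) => //.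
    by move=> _ [m _ <-] /=; rewrite in_itv/= total_mass_ge0.
  exact: measurable_total_mass.
exact: measurableT_comp (measurable_powR _) measurable_total_mass.
Qed.

Lemma tilt_ge0 (p : R) (m : M) : (0 <= h' (total_mass m) * total_mass m `^ p)%R.
Proof. by rewrite mulr_ge0 ?powR_ge0// ltW// h'_pos// total_mass_ge0. Qed.

Definition weight (n : nat) (m : M) : \bar R :=
  (h' (total_mass m) * total_mass m `^ (- (n%:R + q)))%:E.

Lemma measurable_weight n : measurable_fun setT (weight n).
Proof. by apply/measurable_EFinP; exact: measurable_tilt. Qed.

Lemma weight_ge0 n m : 0 <= weight n m.
Proof. by rewrite lee_fin tilt_ge0. Qed.

(** Each factor mu(A_i) / mu(X) contributes one power of the total mass. *)
Lemma weight_norm n (A : 'I_n -> set T) (m : M) : (0 < n)%N -> 0 < m setT -> m setT < +oo ->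
  (\prod_(i < n) normalization m (A i)) * (h' (total_mass m) * total_mass m `^ (- q))%:E =
  (\prod_(i < n) m (A i)) * weight n m.
Proof.
move=> n0 m0 moo.
have t0 : (0 < total_mass m)%R by rewrite fine_gt0// m0.
under eq_bigr do rewrite normalizationE//.
rewrite big_split/= prodEFin prodr_const card_ord -muleA; congr (_ * _).
rewrite /weight -EFinM opprD powRD; last by rewrite (gt_eqF t0) implybT.
rewrite [in RHS]powRN powR_mulrn ?ltW// exprVn; congr (_%:E).
by rewrite mulrCA.
Qed.

Context {d0 : measure_display} {W0 : measurableType d0} (P0 : probability W0 R).
Variable mu : {RV P0 >-> M}.
Hypothesis Hmass : {ae P0, forall w, 0 < mu w [set: T] < +oo}.
Context {d1 : measure_display} {W : measurableType d1} (P : probability W R).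
Variable mut : {RV P >-> M}.
Let h x := (h' x * x `^ (- q))%R.
Let c := tilting_constant (distribution P0 mu) h.
Hypothesis Hmut : tilted_law (distribution P0 mu) h (distribution P mut).

Let c_fin : c \is a fin_num.
Proof. by have [/andP[c0 coo] _] := Hmut; rewrite ge0_fin_numE// ltW. Qed.

Let ci := (fine c)^-1%R.

Let ci_gt0 : (0 < ci)%R.
Proof. by have [/andP[c0 coo] _] := Hmut; rewrite invr_gt0 fine_gt0// c0. Qed.

Let ciE : c^-1 = ci%:E.
Proof. by rewrite -(fineK c_fin) inver gt_eqF// -invr_gt0. Qed.

Lemma integral_tilted (f : M -> \bar R) : measurable_fun setT f -> (forall m, 0 <= f m) ->
  \int[P]_w f (mut w) = ci%:E * \int[P0]_w (f (mu w) * (h (total_mass (mu w)))%:E).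
Proof.
move=> mf f0.
have mh : measurable_fun setT (fun m : M => (h (total_mass m))%:E).
  by apply/measurable_EFinP; exact: measurable_tilt.
have h0 (m : M) : 0 <= (h (total_mass m))%:E by rewrite lee_fin tilt_ge0.
pose D : {measure set M -> \bar R} := mdens_measure (distribution P0 mu : {measure set M -> \bar R}) mh h0.
have ci0 : (0 <= ci)%R by exact: ltW.
transitivity (\int[distribution P mut]_m f m); first by rewrite ge0_integral_distribution.
rewrite (eq_measure_integral (mscale (NngNum ci0) D)); last first.
  by move=> A mA _; have [_ E] := Hmut; rewrite [LHS](E A mA) -/c ciE.
rewrite ge0_integral_mscale//= integral_mdens//.
by rewrite ge0_integral_distribution//; [exact: emeasurable_funM|move=> m; rewrite mule_ge0].
Qed.

Variables (n : nat) (X : {RV P >-> n.-tuple T}).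
Hypothesis n_ge1 : (1 <= n)%N.
Hypothesis HX : conditionally_iid (normalization \o mut) X.

(** Conditional independence of the sample and the definition of the tilted law
express the joint law of the sample and of the normalized measure by the
untilted measure mu. *)
Lemma joint_rect (B : set M) (A : 'I_n -> set T) : measurable B -> (forall i, measurable (A i)) ->
  P [set w | B (normalization (mut w)) /\ forall i, A i (tnth (X w) i)] =
  ci%:E * \int[P0]_w ((\prod_(i < n) mu w (A i)) *
    ((\1_B (normalization (mu w)))%:E * weight n (mu w))).
Proof.
move=> mB mA; rewrite HX//.
pose f (m : M) := (\1_B (normalization m))%:E * \prod_(i < n) normalization m (A i).
have mnA i : measurable_fun setT (fun m : M => normalization m (A i)).
  exact: measurableT_comp (ev_measurable (mA i)) measurable_normalization.
have mf : measurable_fun setT f.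
  apply: emeasurable_funM.
    apply/measurable_EFinP; exact: measurableT_comp (measurable_indic mB) measurable_normalization.
  exact: measurable_eprod.
have f0 m : 0 <= f m by rewrite mule_ge0// prode_ge0.
transitivity (\int[P]_w f (mut w)).
  by rewrite -integral_indicM.
rewrite integral_tilted//; congr (_ * _).
have mwt : measurable_fun setT (fun w => weight n (mu w)).
  by apply: measurableT_comp (measurable_weight n) _.
apply: ge0_ae_eq_integral => //.
- apply: emeasurable_funM; first exact: measurableT_comp.
  by apply/measurable_EFinP; apply: measurableT_comp (measurable_tilt _) _.
- apply: emeasurable_funM.
    by apply: measurable_eprod => i; exact: measurableT_comp (ev_measurable (mA i)) _.
  apply: emeasurable_funM => //; apply/measurable_EFinP.
  apply: measurableT_comp (measurable_indic mB) _.
  exact: measurableT_comp measurable_normalization _.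
- by move=> w _; rewrite mule_ge0// lee_fin tilt_ge0.
- by move=> w _; rewrite !mule_ge0 ?prode_ge0 ?weight_ge0.
apply: filterS Hmass => w /andP[m0 moo] _.
by rewrite /f -muleA weight_norm// muleCA.
Qed.

Variable r : R.-sfker T ~> R.
Local Notation mixed := (mixed r mu).
Variable Lam : {measure set (n.-tuple T) -> \bar R}.
Hypothesis HLam : forall (A : 'I_n -> set T) F, (forall i, measurable (A i)) ->
  measurable_fun setT F -> (forall m, 0 <= F m) ->
  \int[P0]_w ((\prod_(i < n) mu w (A i)) * F (mu w)) =
  \int[Lam]_x ((ind_rect A x)%:E * mixed (cells x) F).

(** The unnormalized posterior law, with respect to the dominating measure Lam. *)
Definition posterior_weight (B : set M) (x : n.-tuple T) :=
  mixed (cells x) (fun m => (\1_B (normalization m))%:E * weight n m).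

Let mpw (B : set M) : measurable B ->
  measurable_fun setT (fun m : M => (\1_B (normalization m))%:E * weight n m).
Proof.
move=> mB; apply: emeasurable_funM; last exact: measurable_weight.
apply/measurable_EFinP; exact: measurableT_comp (measurable_indic mB) measurable_normalization.
Qed.

Let pw0 (B : set M) m : 0 <= (\1_B (normalization m))%:E * weight n m.
Proof. by rewrite mule_ge0// weight_ge0. Qed.

Lemma posterior_weight_ge0 B x : 0 <= posterior_weight B x.
Proof. exact: mixed_ge0. Qed.

Lemma measurable_posterior_weight B : measurable B -> measurable_fun setT (posterior_weight B).
Proof. by move=> mB; apply: measurable_mixed_cells => //; exact: mpw. Qed.

Lemma joint_law (C : set (n.-tuple T)) (B : set M) : measurable C -> measurable B ->
  P (X @^-1` C `&` (normalization \o mut) @^-1` B) =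
  ci%:E * \int[Lam]_(x in C) posterior_weight B x.
Proof.
move=> mC mB.
have mG : measurable ((normalization \o mut) @^-1` B).
  rewrite -[X in measurable X]setTI.
  exact: (measurableT_comp (@measurable_normalization R d T) (measurable_funPT mut)).
have ci0 : (0 <= ci)%R by exact: ltW.
pose m1 := pushm (mrestr P mG) (measurable_funPT X).
pose m2 : {measure set (n.-tuple T) -> \bar R} := mscale (NngNum ci0)
  (mdens_measure Lam (measurable_posterior_weight mB) (posterior_weight_ge0 B)).
apply: (@finite_measure_unique R _ _ tuple_rects m1 m2) => //.
- exact: tuple_rectsE.
- exact: tuple_rects_setI_closed.
- exact: tuple_rectsT.
- apply: (@le_lt_trans _ _ 1); last exact: ltry.
  apply: (probability_le1 P (A := X @^-1` setT `&` _)); apply: measurableI => //.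
  by rewrite preimage_setT.
move=> _ [A [mA ->]].
transitivity (P [set w | B (normalization (mut w)) /\ forall i, A i (tnth (X w) i)]).
  by congr (P _); apply/seteqP; split => w [].
rewrite joint_rect//; congr (_ * _).
rewrite (HLam mA (mpw mB) (pw0 B)).
rewrite [RHS]integral_mkcond; apply: eq_integral => x _.
rewrite patchE; case: ifPn => [/set_mem/= xA|/negP xA].
  rewrite /ind_rect big1 ?mul1e// => i _; rewrite indicE mem_set//; exact: xA.
have [i nAi] : exists i, ~ A i (tnth x i).
  by apply/existsNP => allA; apply: xA; rewrite inE.
by rewrite /ind_rect (bigD1 i)//= indicE memNset// mul0r mul0e.
Qed.

Let kappa := posterior_weight setT.

Lemma integral_distribution_data (f : n.-tuple T -> \bar R) (C : set (n.-tuple T)) :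
  measurable C -> measurable_fun setT f -> (forall x, 0 <= f x) ->
  \int[distribution P X]_(x in C) f x = ci%:E * \int[Lam]_(x in C) (f x * kappa x).
Proof.
move=> mC mf f0; have ci0 : (0 <= ci)%R by exact: ltW.
have mk := measurable_posterior_weight (@measurableT _ M).
pose D := mdens_measure Lam mk (posterior_weight_ge0 setT).
rewrite (eq_measure_integral (mscale (NngNum ci0) D)); last first.
  move=> A mA _; transitivity (P (X @^-1` A `&` (normalization \o mut) @^-1` setT)).
    by rewrite preimage_setT setIT.
  by rewrite joint_law.
rewrite ge0_integral_mscale//; last exact: measurable_funTS.
congr (_ * _); rewrite [LHS]integral_mkcond epatch_indic.
have mfC : measurable_fun setT (fun x => f x * (\1_C x)%:E).
  by apply: emeasurable_funM => //; exact/measurable_EFinP.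
rewrite [LHS](@integral_mdens _ _ _ Lam kappa mk (posterior_weight_ge0 setT) _ mfC); last first.
  by move=> x; rewrite mule_ge0.
rewrite [RHS]integral_mkcond epatch_indic; apply: eq_integral => x _.
by rewrite muleAC.
Qed.

Lemma kappa_finite : {ae Lam, forall x, kappa x < +oo}.
Proof.
have mk := measurable_posterior_weight (@measurableT _ M).
have : Lam.-integrable setT kappa.
  apply/integrableP; split => //.
  rewrite (eq_integral kappa); last by move=> x _; rewrite gee0_abs// posterior_weight_ge0.
  have := joint_law (@measurableT _ (n.-tuple T)) (@measurableT _ M).
  rewrite 2!preimage_setT setIT probability_setT => tot.
  rewrite ltey; apply/eqP => totoo; move: tot; rewrite totoo gt0_muley ?lte_fin//.
move/(integrable_ae measurableT); apply: filterS => x /(_ I).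
by rewrite ge0_fin_numE// posterior_weight_ge0.
Qed.

(** Up to a constant, kappa is the density of the sample with respect to Lam: it is
integrable, and the sample avoids its zeros. *)
Lemma kappa_good : {ae distribution P X, forall x, 0 < kappa x < +oo}.
Proof.
have mk := measurable_posterior_weight (@measurableT _ M).
have PX0 N : measurable N -> \int[Lam]_(x in N) kappa x = 0 -> distribution P X N = 0.
  move=> mN kN; transitivity (P (X @^-1` N `&` (normalization \o mut) @^-1` setT)).
    by rewrite preimage_setT setIT.
  by rewrite joint_law// kN mule0.
have A1 : {ae distribution P X, forall x, kappa x < +oo}.
  have [N [mN LN sub]] := kappa_finite; exists N; split => //.
  by apply: PX0 => //; apply: null_set_integral => //; exact: measurable_funTS.
have A2 : {ae distribution P X, forall x, kappa x != 0}.
  exists [set x | kappa x = 0]; split.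
  - by rewrite -[X in measurable X]setTI; exact: measurable_eqe.
  - apply: PX0; last by apply: integral0_eq.
    by rewrite -[X in measurable X]setTI; exact: measurable_eqe.
  - by move=> x /= /negP; rewrite negbK => /eqP.
by move: A1 A2; apply: filterS2 => x -> k0; rewrite lt_neqAle eq_sym k0 posterior_weight_ge0.
Qed.

(** For each x the functional mixed (cells x) is the integral against a measure on
the space of measures.  With the weight as density, its image under the
normalization map is a kernel in x of total mass kappa x. *)
Lemma posterior_exists : exists Q, posterior_law (normalization \o mut) X Q /\
  {ae distribution P X, forall x, 0 < kappa x < +oo /\
    forall B, measurable B -> Q x B = posterior_weight B x * ((fine (kappa x))^-1)%:E}.
Proof.
have /choice[K HK] : forall x : n.-tuple T, exists m : {measure set M -> \bar R},
    forall f, measurable_fun setT f -> (forall m, 0 <= f m) ->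
    mixed (cells x) f = \int[m]_x f x.
  move=> x; exact: integral_like_measure (mixed_integral_like r mu (cells x)).
pose nx x : {measure set M -> \bar R} :=
  pushm (mdens_measure (K x) (measurable_weight n) (weight_ge0 n)) (@measurable_normalization R d T).
have nxE x B : measurable B -> nx x B = posterior_weight B x.
  move=> mB; rewrite /posterior_weight HK//; last exact: mpw.
  by rewrite -[LHS]integral_indicM.
have mnx B : measurable B -> measurable_fun setT (nx ^~ B).
  move=> mB; under eq_fun do rewrite nxE//.
  exact: measurable_posterior_weight.
pose nk : R.-ker (n.-tuple T) ~> M :=
  HB.pack_for (Kernel.type (n.-tuple T) M R) nx (isKernel.Build _ _ _ _ R nx mnx).
pose Q : R.-pker (n.-tuple T) ~> M := knormalize nk (\d_(point : M)).
have QE x B : measurable B -> Q x B = if (kappa x == 0) || (kappa x == +oo) then \d_(point : M) B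
    else posterior_weight B x * ((fine (kappa x))^-1)%:E.
  have E : Q x B = (if (nx x setT == 0) || (nx x setT == +oo) then fun U => \d_(point : M) U
      else fun U => nx x U * ((fine (nx x setT))^-1)%:E) B by [].
  by move=> mB; rewrite E (nxE x _ measurableT); case: ifP => _ //; rewrite nxE.
exists Q; split; last first.
  apply: filterS kappa_good => x /[dup] kx /andP[k0 koo]; split => // B mB.
  by rewrite QE// gt_eqF// lt_eqF.
move=> C B mC mB; rewrite joint_law// integral_distribution_data//; last first.
  exact: measurable_kernel.
congr (_ * _).
have mQ : measurable_fun setT (fun x => Q x B) by exact: measurable_kernel.
have mk := measurable_posterior_weight (@measurableT _ M).
apply: ge0_ae_eq_integral => //.
- exact: measurable_funTS (measurable_posterior_weight mB).
- by apply: measurable_funTS; exact: emeasurable_funM.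
- by move=> x _; exact: posterior_weight_ge0.
- by move=> x _; rewrite mule_ge0// posterior_weight_ge0.
apply: filterS kappa_finite => x koo _; rewrite QE//.
have le : posterior_weight B x <= kappa x.
  by rewrite -(nxE x B mB) /kappa -(nxE x _ measurableT); apply: le_measure; rewrite ?inE.
have [k0|k0] := eqVneq (kappa x) 0.
  rewrite k0 mule0; apply/eqP; rewrite eq_le posterior_weight_ge0 andbT.
  by rewrite -k0.
rewrite lt_eqF//= -[X in _ * X]fineK ?ge0_fin_numE ?posterior_weight_ge0//.
rewrite -muleA -EFinM mulVf ?mule1// gt_eqF// fine_gt0// koo andbT.
by rewrite lt_neqAle eq_sym k0 posterior_weight_ge0.
Qed.

(** Two versions agree almost surely on each event, hence on all the events of a
countable generator closed under intersection. *)
Lemma posterior_unique Q Q' : posterior_law (normalization \o mut) X Q ->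
  posterior_law (normalization \o mut) X Q' ->
  {ae distribution P X, forall x B, measurable B -> Q x B = Q' x B}.
Proof.
move=> HQ HQ'.
have mK (K : R.-pker (n.-tuple T) ~> M) B : measurable B -> measurable_fun setT (fun x => K x B).
  by move=> mB; exact: measurable_kernel.
have ev (B : set M) : measurable B -> {ae distribution P X, forall x, Q x B = Q' x B}.
  move=> mB.
  have : ae_eq (distribution P X) setT (fun x => Q x B) (fun x => Q' x B).
    apply: integral_ae_eq => //.
    - apply/integrableP; split; first exact: mK.
      apply: (@le_lt_trans _ _ (\int[distribution P X]_x 1)).
        apply: ge0_le_integral => //; first by apply: measurableT_comp => //; exact: mK.
        move=> x _; rewrite gee0_abs// -(@prob_kernel _ _ _ _ _ Q x).
        by apply: le_measure; rewrite ?inE.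
      by rewrite integral_cst// mul1e (le_lt_trans (probability_le1 _ _))// ltry.
    - exact: mK.
    - by move=> E _ mE; rewrite -HQ// -HQ'.
  by apply: filterS => x /(_ I).
have mg l : measurable (gevents l : set M).
  by rewrite bf_measurableE; apply: sub_sigma_algebra; exists l.
have : {ae distribution P X, forall x, forall k : nat,
    forall l, unpickle k = Some l -> Q x (gevents l) = Q' x (gevents l)}.
  apply/ae_foralln => k; case: (unpickle k) => [l|]; last exact: aeW.
  by apply: filterS (ev _ (mg l)) => x Ql l' [<-].
apply: filterS => x QQ' B mB.
apply: (@finite_measure_unique R _ _ (range gevents) (Q x) (Q' x)) => //.
- exact: bf_measurableE.
- exact: gevents_setI_closed.
- by exists [::] => //; exact: gevents_nil.
- by rewrite prob_kernel ltry.
by move=> _ [l _ <-]; apply: (QQ' (pickle l)); rewrite pickleK.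
Qed.
End bayes.

(** * Jumps on a product space *)

Section addatoms.
Context {R : realType} {d : measure_display} {T : polishType R d}.
Local Notation M := (bfmeasure T).

Fixpoint addatoms (m : M) (l : seq T) (z : nat -> R) : M :=
  if l is y :: l' then addatom (addatoms m l' (fun i => z i.+1)) y (z 0%N) else m.

Lemma addatomsE m l z A y0 : addatoms m l z A =
  m A + \sum_(i < size l) (pos (z i))%:E * (\1_A (nth y0 l i))%:E.
Proof.
elim: l z => [|y l ih] z /=; first by rewrite big_ord0 adde0.
by rewrite addatomE ih big_ord_recl/= -addeA [X in _ + X]addeC.
Qed.

Lemma measurable_addatoms dY (Y : measurableType dY) (f : Y -> M) (l : seq T) (z : nat -> Y -> R) :
  measurable_fun setT f -> (forall i, measurable_fun setT (z i)) ->
  measurable_fun setT (fun y => addatoms (f y) l (z ^~ y)).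
Proof.
elim: l z => [|x l ih] z mf mz //=.
apply: measurable_addatom => //.
by apply: (ih (fun i => z i.+1)) => // i; exact: mz.
Qed.
End addatoms.

Section jump_space.
Context {R : realType} {d : measure_display} {T : polishType R d}.
Local Notation M := (bfmeasure T).
Variable r : R.-sfker T ~> R.

(** Jumps are to be positive everywhere and not just almost surely.  The size-biased
law with a positive exponent does not charge the nonpositive numbers, so that
its image under posmod is the same law. *)
Definition posmod (s : R) : R := if (0 < s)%R then s else 1%R.

Lemma posmod_gt0 s : (0 < posmod s)%R.
Proof. by rewrite /posmod; case: ifP. Qed.

Lemma measurable_posmod : measurable_fun setT posmod.
Proof.
apply: measurable_fun_ifT => //; exact: measurable_fun_ltr.
Qed.

Definition moment (z : T * nat) : \bar R := \int[r z.1]_s (pos s ^+ z.2)%:E.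

Definition jump_dist (z : T * nat) (B : set R) : \bar R :=
  (\int[r z.1]_(s in posmod @^-1` B) (pos s ^+ z.2)%:E) * ((fine (moment z))^-1)%:E.

Let mpos k : measurable_fun setT (fun s : R => (pos s ^+ k)%:E : \bar R).
Proof. exact: (measurable_pos_exp k (@measurable_id _ R setT)). Qed.

Let pos0 k (s : R) : 0 <= (pos s ^+ k)%:E.
Proof. by rewrite lee_fin exprn_ge0// pos_ge0. Qed.

Definition size_biased (z : T * nat) : probability R R :=
  mnormalize (mdens_measure (r z.1) (mpos z.2) (pos0 z.2)) (\d_(0%R : R)).

Lemma size_biasedE z U : 0 < moment z < +oo -> measurable U ->
  size_biased z U = (\int[r z.1]_(s in U) (pos s ^+ z.2)%:E) * ((fine (moment z))^-1)%:E.
Proof.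
move=> /andP[m0 moo] mU; rewrite /size_biased/= /mnormalize/= /mdens -/(moment z).
by rewrite gt_eqF// lt_eqF.
Qed.

Lemma integral_size_biased z (f : R -> \bar R) : 0 < moment z < +oo ->
  measurable_fun setT f -> (forall s, 0 <= f s) ->
  moment z * \int[size_biased z]_s f s = \int[r z.1]_s ((pos s ^+ z.2)%:E * f s).
Proof.
move=> mz mf f0; have /andP[m0 moo] := mz.
have mfin : moment z \is a fin_num by rewrite ge0_fin_numE// ltW.
have f1 : (0 < fine (moment z))%R by rewrite fine_gt0// m0.
have i0 : (0 <= (fine (moment z))^-1)%R by rewrite invr_ge0 ltW.
rewrite (@eq_measure_integral _ _ R setT (mscale (NngNum i0) (mdens_measure (r z.1) (mpos z.2) (pos0 z.2))) (size_biased z)); last first.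
  by move=> U mU _; rewrite [LHS]size_biasedE// muleC.
rewrite ge0_integral_mscale//= muleA -[X in X * _ * _]fineK// -EFinM mulfV ?gt_eqF// mul1e.
rewrite [LHS](@integral_mdens _ _ _ (r z.1) _ (mpos z.2) (pos0 z.2) f mf f0).
by apply: eq_integral => s _; rewrite muleC.
Qed.

Context {d0 : measure_display} {W0 : measurableType d0} (P0 : probability W0 R).
Variable mu : {RV P0 >-> M}.

Let z0 : T * nat := (point, 0%N).

(** By induction on the list: at each entry the probability space is multiplied by
the size-biased law of one more jump, and the nested integrals of mixed become a
single expectation, with the moments as normalizing constants.  The sequence Z
is indexed by all the natural numbers to keep its type independent of the list. *)
Lemma jump_space (l : seq (T * nat)) :
  (forall z, z \in l -> 0 < moment z < +oo /\ (0 < z.2)%N) ->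
  exists (d2 : measure_display) (W2 : measurableType d2) (P2 : probability W2 R)
    (pr : W2 -> W0) (Z : nat -> W2 -> R),
  [/\ measurable_fun setT pr, forall i, measurable_fun setT (Z i), forall i w, (0 < Z i w)%R,
    forall (A : set W0) (B : nat -> set R), measurable A -> (forall i, measurable (B i)) ->
      P2 [set w | A (pr w) /\ forall i, (i < size l)%N -> B i (Z i w)] =
      P0 A * \prod_(i < size l) jump_dist (nth z0 l i) (B i)
  & forall F, measurable_fun setT F -> (forall m : M, 0 <= F m) ->
      mixed r mu l F = (\prod_(z <- l) moment z) *
        \int[P2]_w F (addatoms (mu (pr w)) (map fst l) (Z ^~ w))].
Proof.
elim: l => [_|z l ih Hl].
  exists d0, W0, P0, id, (fun _ _ => 1%R); split => //.
  - move=> A B mA mB; rewrite big_ord0 mule1; congr (P0 _).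
    by apply/seteqP; split => [w []//|w Aw]; split.
  - by move=> F mF F0; rewrite big_nil mul1e.
have [|d2 [W2 [P2 [pr [Z [mpr mZ Zp Hprod Hmix]]]]]] := ih.
  by move=> y yl; apply: Hl; rewrite inE yl orbT.
have [mz z2] : 0 < moment z < +oo /\ (0 < z.2)%N by apply: Hl; rewrite inE eqxx.
pose Z' i (w : W2 * R) := if i is i'.+1 then Z i' w.1 else posmod w.2.
have mZ' i : measurable_fun setT (Z' i).
  by case: i => [|i]; [exact: measurableT_comp measurable_posmod _|exact: measurableT_comp].
exists _, (W2 * R)%type, (P2 \x size_biased z : probability _ _), (pr \o fst), Z'; split => //.
- exact: measurableT_comp.
- by case=> [|i] w /=; [exact: posmod_gt0|exact: Zp].
- move=> A B mA mB.
  set C := [set w | A (pr w) /\ forall i, (i < size l)%N -> B i.+1 (Z i w)].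
  have mC : measurable C.
    rewrite (_ : C = pr @^-1` A `&` \bigcap_(i in [set i | (i < size l)%N]) (Z i @^-1` B i.+1)).
      apply: measurableI; first by rewrite -[X in measurable X]setTI; exact: mpr.
      apply: bigcap_measurableType => i _; rewrite -[X in measurable X]setTI; exact: mZ.
    by apply/seteqP; split => w [].
  have mB0 : measurable (posmod @^-1` B 0%N).
    by rewrite -[X in measurable X]setTI; exact: measurable_posmod.
  rewrite (_ : [set w | _] = C `*` (posmod @^-1` B 0%N)); last first.
    apply/seteqP; split => -[w s] /=.
      by move=> [Aw Bw]; split; [split => // i il; exact: (Bw i.+1)|exact: (Bw 0%N)].
    by move=> [[Aw Bw] Bs]; split => // -[|i] //= il; exact: Bw.
  transitivity (P2 C * size_biased z (posmod @^-1` B 0%N)); first exact: product_measure1E.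
  have -> : P2 C = P0 A * \prod_(i < size l) jump_dist (nth z0 l i) (B i.+1).
    exact: (Hprod A (fun i => B i.+1)).
  rewrite size_biasedE// big_ord_recl -muleA.
  by congr (_ * _); rewrite muleC.
- move=> F mF F0.
  have Pfin : 0 <= \prod_(y <- l) moment y.
    by apply: prode_ge0 => y _; apply: integral_ge0.
  pose G s := \int[P2]_w F (addatom (addatoms (mu (pr w)) (map fst l) (Z ^~ w)) z.1 s).
  have mFz : measurable_fun setT (fun w : W2 * R => F (addatom (addatoms (mu (pr w.1)) (map fst l) (Z ^~ w.1)) z.1 w.2)).
    apply: measurableT_comp mF _; apply: measurable_addatom => //.
    apply: (@measurable_addatoms _ _ _ _ _ (fun w : W2 * R => mu (pr w.1)) _ (fun i w => Z i w.1)).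
      by apply: measurableT_comp => //; exact: measurableT_comp.
    by move=> i; exact: measurableT_comp.
  have mG : measurable_fun setT G.
    exact: (@measurable_fun_fubini_tonelli_G _ _ _ _ _ P2 _ mFz).
  have G0 s : 0 <= G s by exact: integral_ge0.
  rewrite big_cons; case: z => y m in Hl mz z2 Z' mZ' G mFz mG G0 *.
  rewrite /=.
  transitivity (\int[r y]_s ((\prod_(y <- l) moment y) * ((pos s ^+ m)%:E * G s))).
    apply: eq_integral => s _.
    rewrite muleCA Hmix//.
    apply: measurableT_comp mF _; apply: measurable_addatom => //; exact: measurable_cst.
  rewrite ge0_integralZl//; last 2 first.
  - exact: emeasurable_funM.
  - by move=> s _; rewrite mule_ge0.
  rewrite [RHS]muleAC -[LHS]muleC; congr (_ * _).
  transitivity (\int[r y]_s ((pos s ^+ m)%:E * G (posmod s))).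
    apply: eq_integral => s _; rewrite /posmod; case: ltP => // s0.
    have -> : pos s = 0%R by rewrite /pos max_r.
    by rewrite expr0n/= gtn_eqF// !mul0e.
  rewrite -(@integral_size_biased (y, m))//; last exact: measurableT_comp measurable_posmod.
  congr (_ * _).
  rewrite (@fubini_tonelli2 _ _ _ _ _ P2 (size_biased (y, m)) (fun w => F _))//.
  apply: measurableT_comp mF _.
  apply: (@measurable_addatoms _ _ _ _ _ (fun w : W2 * R => mu (pr w.1)) (y :: map fst l) Z') => //.
  by apply: measurableT_comp => //; exact: measurableT_comp.
Qed.
End jump_space.

(** * Independence on an extended probability space *)

Lemma mutually_independent_inj {R : realType} dW (W : measurableType dW) (P : probability W R)
    (I K : finType) (f : K -> I) (F : I -> set (set W)) : injective f ->
  mutually_independent P F -> mutually_independent P (F \o f).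
Proof.
move=> finj iF J A FA.
(* The events A, moved along f, with setT outside its range. *)
pose A' i := if [pick k in J | f k == i] is Some k then A k else setT.
have A'E k : k \in J -> A' (f k) = A k.
  move=> kJ; rewrite /A'; case: pickP => [k' /andP[_ /eqP/finj -> //]|/(_ k)].
  by rewrite kJ eqxx.
have -> : \bigcap_(k in [set` J]) A k = \bigcap_(i in [set` (f @: J)%SET]) A' i.
  apply/seteqP; split => w h.
    by move=> _ /= /finset.imsetP[k kJ ->]; rewrite A'E//; exact: h.
  by move=> k /= kJ; rewrite -A'E//; apply: h => /=; exact: finset.imset_f.
rewrite iF; last by move=> _ /finset.imsetP[k kJ ->]; rewrite A'E//; exact: FA.
rewrite big_imset/=; last by move=> k k' _ _; exact: finj.
by apply: eq_bigr => k kJ; rewrite A'E.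
Qed.

Section independent_extension.
Context {R : realType} {d0 : measure_display} {W0 : measurableType d0} (P0 : probability W0 R).
Context {d2 : measure_display} {W2 : measurableType d2} (P2 : probability W2 R).
Variables (pr : W2 -> W0) (c : nat) (Z : 'I_c -> W2 -> R) (law : 'I_c -> set R -> \bar R).
Hypothesis mpr : measurable_fun setT pr.
Hypothesis lawT : forall i, law i setT = 1.
Hypothesis Hprod : forall (A : set W0) (B : 'I_c -> set R), measurable A -> (forall i, measurable (B i)) ->
  P2 [set w | A (pr w) /\ forall i, B i (Z i w)] = P0 A * \prod_i law i (B i).

Lemma extension_base A : measurable A -> P2 (pr @^-1` A) = P0 A.
Proof.
move=> mA; have := Hprod mA (fun _ => measurableT).
under eq_bigr do rewrite lawT.
rewrite big1// mule1 => <-; congr (P2 _).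
by apply/seteqP; split => [w Aw|w []//]; split.
Qed.

Lemma extension_law k B : measurable B -> P2 (Z k @^-1` B) = law k B.
Proof.
move=> mB; pose B' i := if i == k then B else setT.
have mB' i : measurable (B' i) by rewrite /B'; case: ifP.
have BE : B' k = B by rewrite /B' eqxx.
have := Hprod measurableT mB'; rewrite probability_setT mul1e (bigD1 k)//= BE.
rewrite big1 ?mule1; last by move=> i ik; rewrite /B' (negbTE ik) lawT.
move=> <-; congr (P2 _); apply/seteqP; split => w /=.
  by move=> Zw; split => // i; rewrite /B'; case: eqP => // ->.
by move=> [_ /(_ k)]; rewrite /B' eqxx.
Qed.

Definition extension_fields (I : finType) (F : I -> set (set W0)) (s : I + 'I_c) : set (set W2) :=
  match s with
  | inl i => [set pr @^-1` A | A in F i]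
  | inr j => g_sigma_algebra_preimage (Z j)
  end.

(** With setT for the missing indices, an intersection of events is the set
measured by Hprod. *)
Lemma extension_independent (I : finType) (F : I -> set (set W0)) :
  (forall i, F i `<=` measurable) -> mutually_independent P0 F ->
  mutually_independent P2 (extension_fields F).
Proof.
move=> Fm iF J A FA.
have /choice[B0 HB0] : forall i, exists B, (inl i \in J -> F i B /\ A (inl i) = pr @^-1` B) /\
    (inl i \notin J -> B = setT).
  move=> i; have [iJ|iJ] := boolP (inl i \in J); last by exists setT.
  by have /= [B FB BA] := FA _ iJ; exists B; split.
have /choice[B1 HB1] : forall j, exists B : set R, [/\ measurable B,
    inr j \in J -> A (inr j) = Z j @^-1` B & inr j \notin J -> B = setT].
  move=> j; have [jJ|jJ] := boolP (inr j \in J); last by exists setT.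
  by have /= [B mB BA] := FA _ jJ; exists B; split => //; rewrite -BA setTI.
have mB1 j : measurable (B1 j) by have [] := HB1 j.
pose J0 := [set i | inl i \in J]%SET.
have mB0 i : i \in J0 -> measurable (B0 i).
  by rewrite finset.inE => iJ; apply: (Fm i); have [/(_ iJ)[]] := HB0 i.
have -> : \bigcap_(s in [set` J]) A s = [set w | (\bigcap_(i in [set` J0]) B0 i) (pr w) /\ forall j, B1 j (Z j w)].
  apply/seteqP; split => w.
    move=> h; split.
      move=> i /=; rewrite finset.inE => iJ; have := h _ iJ.
      by have [/(_ iJ)[_ ->]] := HB0 i.
    move=> j; have [_ h1 h2] := HB1 j; have [jJ|jJ] := boolP (inr j \in J).
      by have := h _ jJ; rewrite h1.
    by rewrite h2.
  move=> [h0 h1] [i|j] /= sJ.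
    by have [/(_ sJ)[_ ->] _] := HB0 i; apply: h0 => /=; rewrite finset.inE.
  by have [_ -> // _] := HB1 j; exact: h1.
rewrite Hprod//; last exact: measurable_bigcaps.
rewrite iF; last by move=> i; rewrite finset.inE => iJ; have [/(_ iJ)[]] := HB0 i.
rewrite [RHS](big_sumType _ (mem J)); congr (_ * _).
  apply: eq_big => [i|i]; first by rewrite finset.inE.
  rewrite finset.inE => iJ; have [/(_ iJ)[_ ->] _] := HB0 i.
  by rewrite extension_base//; apply: mB0; rewrite finset.inE.
rewrite [RHS]big_mkcond; apply: eq_bigr => j _; have [_ h1 h2] := HB1 j.
rewrite -[mem J (inr j)]/(inr j \in J); case: ifPn => jJ; last by rewrite h2// lawT.
by rewrite h1// extension_law.
Qed.

Lemma extension_preimage d (V : measurableType d) (f : W0 -> V) :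
  g_sigma_algebra_preimage (f \o pr) `<=` [set pr @^-1` A | A in g_sigma_algebra_preimage f].
Proof.
move=> _ [B mB <-]; exists (f @^-1` B); first by exists B => //; rewrite setTI.
by rewrite setTI.
Qed.

Lemma extension_independent_base (I : finType) (F : I -> set (set W0)) :
  (forall i, F i `<=` measurable) -> mutually_independent P0 F ->
  mutually_independent P2 (fun i => [set pr @^-1` A | A in F i]).
Proof.
move=> Fm iF; have := extension_independent Fm iF.
by move/(mutually_independent_inj (f := inl)); apply => i j [].
Qed.

Lemma extension_independent_option d (V : measurableType d) (f : W0 -> V) :
  measurable_fun setT f ->
  mutually_independent P2 (fun o : option 'I_c => if o is Some k then g_sigma_algebra_preimage (Z k)
    else g_sigma_algebra_preimage (f \o pr)).
Proof.
move=> mf.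
have iF : mutually_independent P0 (fun _ : unit => g_sigma_algebra_preimage f).
  move=> J A _; have [->|[u uJ]] := finset.set_0Vmem J.
    by rewrite big_set0 (_ : \bigcap_(i in _) _ = setT) ?probability_setT//;
      apply/seteqP; split => // w _ i /=; rewrite finset.inE.
  have -> : J = [set tt]%SET by apply/finset.setP => -[]; rewrite finset.inE eqxx; case: u uJ.
  rewrite big_set1; congr (P0 _); apply/seteqP; split => w.
    by apply => /=; rewrite finset.inE.
  by move=> Aw [].
have := extension_independent (fun _ => preimage_measurable mf) iF.
pose g (o : option 'I_c) : unit + 'I_c := if o is Some k then inr k else inl tt.
have ginj : injective g by move=> [k|] [k'|] //= [->].
move/(mutually_independent_inj ginj); apply: mutually_independentS => -[k|] //=.
exact: extension_preimage.
Qed.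

Lemma extension_poisson dE (E : measurableType dE) (nu : {measure set E -> \bar R}) (N : R.-ker W0 ~> E) :
  poisson_process P0 nu N ->
  exists N2 : R.-ker W2 ~> E, poisson_process P2 nu N2 /\ forall w, N2 w = N (pr w).
Proof.
move=> [N1 N2 N3].
have mN C : measurable C -> measurable_fun setT (fun w => N w C) by move=> mC; exact: measurable_kernel.
have mN2 C : measurable C -> measurable_fun setT (fun w => N (pr w) C).
  by move=> mC; exact: measurableT_comp (mN C mC) mpr.
pose K : W2 -> {measure set E -> \bar R} := fun w => N (pr w).
exists (HB.pack_for (Kernel.type W2 E R) K (isKernel.Build _ _ _ _ R K mN2)); split => //.
split.
- move=> C mC Coo U; rewrite -(N1 _ mC Coo).
  rewrite -[RHS]extension_base//.
  rewrite (_ : [set w | _] = \bigcup_(m in U) [set w | N w C = m%:R%:E]).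
    apply: bigcup_measurable => m _; rewrite -[X in measurable X]setTI.
    by apply: measurable_eqe => //; exact: mN.
  by apply/seteqP; split => w [m Um Nm]; exists m.
- move=> C mC Coo; rewrite -(N2 _ mC Coo) -[RHS]extension_base//.
  by rewrite -[X in measurable X]setTI; apply: measurable_eqe => //; exact: mN.
- move=> k C mC tC.
  have := extension_independent_base (fun i => preimage_measurable (mN _ (mC i))) (N3 k C mC tC).
  by apply: mutually_independentS => i; exact: extension_preimage.
Qed.

Section fixed_jumps.
Context {d : measure_display} {T : polishType R d}.
Variables (mu : {RV P0 >-> bfmeasure T}) (y : 'I_c -> T) (mux : W2 -> bfmeasure T).
Hypothesis mZ : forall i, measurable_fun setT (Z i).
Hypothesis muxE : forall w A, measurable A ->
  mux w A = mu (pr w) A + \sum_(j < c) (Z j w)%:E * (\1_A (y j))%:E.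

(** An atom at y j changes the mass of A i only if y j belongs to A i.  As the sets
A i are disjoint, each jump is grouped with at most one of them; the group None
collects the other jumps. *)
Lemma extension_completely_random (k : nat) (A : 'I_k -> set T) :
  (forall i, measurable (A i)) -> trivIset [set: 'I_k] A ->
  mutually_independent P0 (fun i => g_sigma_algebra_preimage (fun w => mu w (A i))) ->
  mutually_independent P2 (fun i => g_sigma_algebra_preimage (fun w => mux w (A i))).
Proof.
move=> mA tA iF.
have mmu i : measurable_fun setT (fun w => mu w (A i)).
  exact: measurableT_comp (ev_measurable (mA i)) _.
pose F := extension_fields (fun i => g_sigma_algebra_preimage (fun w => mu w (A i))).
have iE : mutually_independent P2 F.
  by apply: extension_independent => // i; exact: preimage_measurable.
pose g (s : 'I_k + 'I_c) : option 'I_k :=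
  match s with inl i => Some i | inr j => [pick i | y j \in A i] end.
have Fm s : F s `<=` measurable.
  case: s => [i|j]; last exact: preimage_measurable.
  move=> _ [B FB <-]; rewrite -[X in measurable X]setTI; apply: mpr => //.
  exact: preimage_measurable (mmu i) _ FB.
have FI s : setI_closed (F s).
  case: s => [i|j]; last exact: preimage_field_setI_closed.
  move=> _ _ [B FB <-] [C FC <-]; exists (B `&` C) => //.
  exact: preimage_field_setI_closed.
have FT s : F s setT.
  by case: s => [i|j]; [exists setT => //|]; exact: preimage_field_setT.
have iG := mutually_independent_group (g := g) Fm FI FT iE.
have := mutually_independent_inj (f := Some) _ iG; move/(_ (fun _ _ => (@Some_inj _ _ _))).
apply: mutually_independentS => i /=.
set C := \bigcup_(s in _) F s.
apply: preimage_generated.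
rewrite (_ : (fun w => mux w (A i)) = (fun w => mu (pr w) (A i) + \sum_(j < c) (Z j w)%:E * (\1_(A i) (y j))%:E)).
  apply: emeasurable_funD.
    apply: generated_measurable => B FB; exists (inl i) => //.
    exact: (extension_preimage (f := fun w => mu w (A i))).
  apply: emeasurable_sum => j.
  have [yA|yA] := boolP (y j \in A i); last first.
    by rewrite indicE (negbTE yA); under eq_fun do rewrite mule0; exact: measurable_cst.
  rewrite (_ : (fun w => _) = (fun w => (Z j w)%:E)); last first.
    by apply/funext => w; rewrite indicE yA mule1.
  apply/measurable_EFinP; apply: generated_measurable => B FB; exists (inr j) => //=.
  rewrite /g; case: pickP => [i' yA'|/(_ i)]; last by rewrite yA.
  congr Some; apply/eqP/negPn/negP => ii'.
  have /trivIsetP := tA => /(_ i' i Logic.I Logic.I ii') A0.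
  have : (A i' `&` A i) (y j) by split; apply/set_mem.
  by rewrite A0.
by apply/funext => w; rewrite muxE.
Qed.
End fixed_jumps.
End independent_extension.

(** * The posterior as a tilted random measure *)

Definition mfun_of d d' (aT : measurableType d) (rT : measurableType d') (f : aT -> rT)
    (mf : measurable_fun setT f) : {mfun aT >-> rT} :=
  HB.pack_for {mfun aT >-> rT} f (isMeasurableFun.Build _ _ _ _ f mf).

Lemma inve_fine {R : realType} (y : \bar R) : 0 < y < +oo -> y^-1 = ((fine y)^-1)%:E.
Proof.
by case: y => [y| |]//=; rewrite ?ltxx ?andbF// => /andP[y0 _]; rewrite inver gt_eqF.
Qed.

Section cell_enumeration.
Context {R : realType} {d : measure_display} {T : polishType R d} {n : nat}.
Variable x : n.-tuple T.

Lemma size_cells : size (cells x) = ncells x.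
Proof. by rewrite size_map. Qed.

Lemma cell_sizeE (k : 'I_(ncells x)) : cell_size k = count_mem (distinct_value k) x.
Proof.
rewrite /cell_size /cell -[X in _ = count _ X]map_tnth_enum count_map cardsE cardE -size_filter.
by congr size; rewrite enumT; apply: eq_filter => i; rewrite inE.
Qed.

Lemma nth_cells z0 (k : 'I_(ncells x)) : nth z0 (cells x) k = (distinct_value k, cell_size k).
Proof.
rewrite cell_sizeE (nth_map z0.1); last exact: ltn_ord.
by rewrite /distinct_value (tnth_nth z0.1).
Qed.

Lemma cellsP z : z \in cells x -> exists k : 'I_(ncells x), z = (distinct_value k, cell_size k).
Proof.
move=> zx; have il : (index z (cells x) < ncells x)%N by rewrite -size_cells index_mem.
by exists (Ordinal il); rewrite -(nth_cells z) nth_index.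
Qed.

Lemma cell_size_gt0 (k : 'I_(ncells x)) : (0 < cell_size k)%N.
Proof.
rewrite cell_sizeE -has_count; apply/hasP; exists (distinct_value k) => //=.
by rewrite -mem_undup; exact: mem_tnth.
Qed.
End cell_enumeration.

Section jump_moments.
Context {R : realType} {d : measure_display} {T : polishType R d}.
Variables (rho : R.-sigmafker T ~> R) (r : R.-sfker T ~> R).

(** Where s is not positive, pos s is zero and so is its power, the exponent being
positive. *)
Lemma integral_pos_exp (y : T) (m : nat) (A : set R) : (0 < m)%N -> measurable A ->
  (forall U, measurable U -> r y U = rho y U) ->
  \int[r y]_(s in posmod @^-1` A) (pos s ^+ m)%:E = \int[rho y]_(s in A `&` `]0%R, +oo[) (s ^+ m)%:E.
Proof.
move=> m0 mA rE; rewrite (@eq_measure_integral _ _ _ _ (rho y)); last by move=> U mU _; exact: rE.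
rewrite integral_mkcond [RHS]integral_mkcond; apply: eq_integral => s _; rewrite !patchE.
have [s0|s0] := ltP 0%R s.
  have -> : (s \in posmod @^-1` A) = (s \in A).
    by apply/idP/idP; rewrite !inE /= /posmod s0.
  have -> : (s \in A `&` `]0%R, +oo[) = (s \in A).
    by apply/idP/idP; rewrite !inE /=; [case|move=> As; split => //; rewrite in_itv/= s0].
  by rewrite /pos max_l// ltW.
rewrite [X in _ = if X then _ else _]memNset; last first.
  by move=> [_ /=]; rewrite in_itv/= andbT ltNge s0.
by rewrite /pos max_r// expr0n/= gtn_eqF//; case: ifP.
Qed.

Context {dW : measure_display} {W : measurableType dW} (P : probability W R).
Variable mu : {RV P >-> bfmeasure T}.

(** A moment that vanishes makes the corresponding power of s zero almost
everywhere. *)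
Lemma mixed_moment0 l z F : z \in l -> moment r z = 0 -> measurable_fun setT F ->
  (forall m, 0 <= F m) -> mixed r mu l F = 0.
Proof.
move=> zl z0; elim: l zl F => // -[y m] l ih; rewrite inE => zl F mF F0 /=.
have ma s : measurable_fun setT (fun m0 : bfmeasure T => F (addatom m0 y s)).
  by apply: measurableT_comp mF _; apply: measurable_addatom => //; exact: measurable_cst.
have p0 s : 0 <= (pos s ^+ m)%:E :> \bar R by rewrite lee_fin exprn_ge0// pos_ge0.
have [zym|] := eqVneq z (y, m); last first.
  move=> zn; rewrite (negbTE zn) in zl.
  by rewrite integral0_eq// => s _; rewrite ih// mule0.
have mp : measurable_fun setT (fun s : R => (pos s ^+ m)%:E : \bar R).
  exact: (measurable_pos_exp m (@measurable_id _ R setT)).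
have mG : measurable_fun setT (fun s => mixed r mu l (fun m0 => F (addatom m0 y s))).
  exact: measurable_mixed_atom.
transitivity (\int[r y]_s (cst 0 s : \bar R)); last by rewrite integral0.
apply: ge0_ae_eq_integral => //.
- exact: emeasurable_funM.
- by move=> s _; rewrite mule_ge0// mixed_ge0.
have : ae_eq (r y) setT (fun s => (pos s ^+ m)%:E) (cst 0).
  apply/ae_eq_integral_abs => //; rewrite -[RHS]z0 zym; apply: eq_integral => s _.
  by rewrite gee0_abs.
by apply: filterS => s /(_ I) /= -> _; rewrite mul0e.
Qed.
End jump_moments.

Section posterior_structure.
Context {R : realType} {d : measure_display} {T : polishType R d}.
Local Notation M := (bfmeasure T).
Variables (eta : probability T R) (rho : R.-sigmafker T ~> R).
Variable (nu : {measure set (T * R) -> \bar R}).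
Hypothesis Hnu : crm_intensity eta rho nu.
Context {d0 : measure_display} {W0 : measurableType d0} (P0 : probability W0 R).
Variable mu : {RV P0 >-> M}.
Hypothesis Hmu : crm_with_intensity nu mu.
Variables (h' : R -> R) (q : R).
Hypothesis h'_meas : measurable_fun (`[0%R, +oo[%classic : set R) h'.
Hypothesis h'_pos : forall x : R, (0 <= x)%R -> (0 < h' x)%R.
Variable r : R.-sfker T ~> R.
Hypothesis r_good : forall x, (forall U, measurable U -> r x U = rho x U) \/ (forall U, r x U = 0).
Variables (n : nat) (x : n.-tuple T).
Local Notation wgt := (weight h' q n).
Local Notation pw B := (posterior_weight h' q mu r B x).
Hypothesis kappa_x : 0 < pw setT < +oo.
Hypothesis moments_x : forall k : 'I_(ncells x), jump_moment rho k < +oo.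

(** A vanishing moment would annihilate the posterior weight.  In particular r is
not zero at the values of the sample, and is therefore equal to rho there. *)
Lemma posterior_cells_good z : z \in cells x ->
  [/\ 0 < moment r z < +oo, (0 < z.2)%N & forall U, measurable U -> r z.1 U = rho z.1 U].
Proof.
move=> zx; have [k zk] := cellsP zx.
have m0 : 0 < moment r z.
  rewrite lt_neqAle; apply/andP; split; last first.
    by apply: integral_ge0 => s _; rewrite lee_fin exprn_ge0// pos_ge0.
  apply/eqP => z0; move: kappa_x; rewrite /posterior_weight (mixed_moment0 mu zx (esym z0))// ?ltxx//.
  - apply: emeasurable_funM; last exact: measurable_weight.
    apply/measurable_EFinP; exact: measurableT_comp (measurable_indic measurableT) (@measurable_normalization R d T).
  - by move=> m; rewrite mule_ge0// weight_ge0.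
have rE : forall U, measurable U -> r z.1 U = rho z.1 U.
  have [//|r0] := r_good z.1; move: m0; rewrite /moment.
  rewrite (@eq_measure_integral _ _ _ _ mzero); last by move=> U _ _; rewrite r0.
  by rewrite integral_measure_zero ltxx.
have z2 : (0 < z.2)%N by rewrite zk cell_size_gt0.
split => //; rewrite m0/=.
have := @integral_pos_exp _ _ _ rho r z.1 z.2 setT z2 measurableT rE.
rewrite preimage_setT setTI -/(moment r z) => ->.
by have := moments_x k; rewrite /jump_moment zk.
Qed.

(** The product of the moments is a common factor of the posterior weights of B and
of the whole space.  After its cancellation the posterior is the image under
normalization of the law of mux weighted by h'(t) t^(-(n+q)), and the tilted
measure is realized as the identity map of the space of measures. *)
Lemma posterior_structure (Qx : set M -> \bar R) :
  (forall B, measurable B -> Qx B = pw B * ((fine (pw setT))^-1)%:E) ->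
  exists (d2 : measure_display) (W2 : measurableType d2)
      (P2 : probability W2 R)
      (mu2 : {RV P2 >-> bfmeasure T}) (J : 'I_(ncells x) -> {RV P2 >-> R})
      (mux : {RV P2 >-> bfmeasure T})
      (d3 : measure_display) (W3 : measurableType d3)
      (P3 : probability W3 R) (mutx : {RV P3 >-> bfmeasure T}),
      [/\ forall B, measurable B ->
            Qx B = P3 ((normalization \o mutx) @^-1` B),
          tilted_law (distribution P2 mux)
            (fun y => h' y * y `^ (- (n%:R + q)))%R (distribution P3 mutx),
          [/\ completely_random mux,
              crm_with_intensity nu mu2,
              forall B, measurable B ->
                distribution P2 mu2 B = distribution P0 mu B,
              add_fixed_jumps mu2 J mux
            & forall k : 'I_(ncells x), fixed_atom mux (distinct_value k)],
          forall k, jump_law rho k (J k)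
        & independent_jumps mu2 J].
Proof.
move=> HQ.
have good := posterior_cells_good.
have [z zx|d2 [W2 [P2 [pr [Z [mpr mZ Zp Hprod Hmix]]]]]] := @jump_space R d T r _ _ P0 mu (cells x).
  by have [] := good z zx.
pose z0 : T * nat := (point, 0%N).
pose c := ncells x.
pose law (k : 'I_c) := jump_dist r (nth z0 (cells x) k).
have nth_in (k : 'I_c) : nth z0 (cells x) k \in cells x by rewrite mem_nth// size_cells.
have lawT k : law k setT = 1.
  have [/andP[m0 moo] _ _] := good _ (nth_in k).
  transitivity (moment r (nth z0 (cells x) k) * ((fine (moment r (nth z0 (cells x) k)))^-1)%:E).
    by rewrite /law /jump_dist preimage_setT.
  have mfin : moment r (nth z0 (cells x) k) \is a fin_num by rewrite ge0_fin_numE// ltW.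
  by rewrite -[X in X * _]fineK// -EFinM mulfV// gt_eqF// fine_gt0// m0.
have Hprod' (A : set W0) (B : 'I_c -> set R) : measurable A -> (forall i, measurable (B i)) ->
    P2 [set w | A (pr w) /\ forall i : 'I_c, B i (Z i w)] = P0 A * \prod_i law i (B i).
  move=> mA mB; pose B' i := if insub i is Some j then B j else setT.
  have B'E (i : 'I_c) : B' i = B i by rewrite /B' valK.
  have mB' i : measurable (B' i) by rewrite /B'; case: insubP.
  have := Hprod A B' mA mB'.
  rewrite -(big_mkord xpredT (fun i => jump_dist r (nth z0 (cells x) i) (B' i))) size_cells big_mkord.
  under eq_bigr do rewrite B'E.
  move=> <-; congr (P2 _); apply/seteqP; split => w [Aw Bw]; split => //.
    by move=> i ic; have := Bw (Ordinal ic); rewrite -B'E.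
  by move=> i; have := Bw i (ltn_ord i); rewrite B'E.
pose mu2 : {mfun W2 >-> M} := mfun_of (measurableT_comp (measurable_funPT mu) mpr).
pose J (k : 'I_c) : {mfun W2 >-> R} := mfun_of (mZ k).
have mmux : measurable_fun setT (fun w => addatoms (mu (pr w)) (map fst (cells x)) (Z ^~ w)).
  by apply: measurable_addatoms => //; exact: measurableT_comp.
pose mux : {mfun W2 >-> M} := mfun_of mmux.
have muxE w A : measurable A -> mux w A = mu (pr w) A +
    \sum_(j < c) (Z j w)%:E * (\1_A (distinct_value j))%:E.
  move=> mA; rewrite /mux/= (addatomsE _ _ _ _ point); congr (_ + _).
  rewrite -(big_mkord xpredT (fun i => (pos (Z i w))%:E * (\1_A (nth point [seq i.1 | i <- cells x] i))%:E)).
  rewrite cells_keys -/(ncells x) big_mkord; apply: eq_bigr => j _.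
  by rewrite /distinct_value (tnth_nth point) /pos max_l// ltW.
have mw : measurable_fun setT (wgt : M -> \bar R) by exact: measurable_weight.
have w0 := @weight_ge0 R d T h' q h'_pos n.
pose L2 : {measure set M -> \bar R} := distribution P2 mux.
pose D : {measure set M -> \bar R} := mdens_measure L2 mw w0.
pose c2 := \int[L2]_m wgt m.
pose pm := \prod_(z <- cells x) moment r z.
have mnB (B : set M) : measurable B -> measurable_fun setT (fun m : M => (\1_B (normalization m))%:E * wgt m).
  move=> mB; apply: emeasurable_funM => //; apply/measurable_EFinP.
  exact: measurableT_comp (measurable_indic mB) (@measurable_normalization R d T).
have pwE B : measurable B -> pw B = pm * D (normalization @^-1` B).
  move=> mB; rewrite /posterior_weight Hmix//; last 2 first.
  - exact: mnB.
  - by move=> m; rewrite mule_ge0.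
  congr (_ * _).
  transitivity (\int[L2]_m ((\1_B (normalization m))%:E * wgt m)).
    by rewrite ge0_integral_distribution//; [exact: mnB|move=> m; rewrite mule_ge0].
  by rewrite mdens_measureE -[RHS]integral_indicM.
have pm_gt0 : 0 < pm /\ pm \is a fin_num.
  rewrite /pm; elim: (cells x) good => [|z l ih] good; first by rewrite big_nil.
  have [|i1 i2] := ih; first by move=> y yl; apply: good; rewrite inE yl orbT.
  have [/andP[m0 moo] _ _] := good z (mem_head _ _).
  rewrite big_cons; split; first exact: mule_gt0.
  by apply: fin_numM => //; rewrite ge0_fin_numE// ltW.
have kE : pw setT = pm * c2.
  by rewrite pwE// preimage_setT mdens_measureE.
have [pm0 pmfin] := pm_gt0.
have c20 : 0 <= c2 by exact: integral_ge0.
have c2P : 0 < c2 < +oo.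
  move: kappa_x; rewrite kE => /andP[k0 koo]; apply/andP; split.
    by rewrite lt_neqAle c20 andbT eq_sym; apply/eqP => c2z; rewrite c2z mule0 ltxx in k0.
  by rewrite ltey; apply/eqP => c2oo; rewrite c2oo gt0_muley// in koo.
pose P3 : probability M R := mnormalize D \d_(point : M).
have P3E A : measurable A -> P3 A = D A * ((fine c2)^-1)%:E.
  move=> mA; rewrite /P3/= /mnormalize/= /mdens -/c2.
  by case/andP: c2P => c2p c2oo; rewrite gt_eqF// lt_eqF.
pose mutx : {mfun M >-> M} := mfun_of (@measurable_id _ M setT).
exists d2, W2, P2, mu2, J, mux, _, M, P3, mutx; split.
- move=> B mB; rewrite HQ//.
  have mnormB : measurable (normalization @^-1` B : set M).
    by rewrite -[X in measurable X]setTI; exact: measurable_normalization.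
  rewrite [RHS]P3E// pwE// kE fineM ?invfM//; last first.
    by rewrite ge0_fin_numE//; case/andP: c2P.
  rewrite EFinM muleACA -[X in X * _ * _]fineK// -EFinM mulfV ?mul1e//.
  by rewrite gt_eqF// fine_gt0// pm0 ltey_eq pmfin.
- split; first exact: c2P.
  move=> A mA; rewrite [LHS]P3E// muleC; congr (_ * _).
  by rewrite -inve_fine.
- split.
  + move=> k A mA bA tA.
    apply: (@extension_completely_random _ _ _ P0 _ _ P2 pr c (fun k => Z k) law mpr lawT Hprod' _ _ mu (fun j => distinct_value j) mux).
    * by move=> i; exact: mZ.
    * exact: muxE.
    * by [].
    * by [].
    * exact: (crm_independent Hmu).
  + have [N HN HA] := Hmu.
    have [N2 [HN2 N2E]] := extension_poisson mpr lawT Hprod' HN.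
    exists N2 => //.
    have [E [mE PE sub]] := HA.
    exists (pr @^-1` E); split.
    * by rewrite -[X in measurable X]setTI; exact (mpr measurableT E mE).
    * by rewrite (extension_base lawT Hprod').
    * move=> w; apply: contra_notP => nE A mA; rewrite N2E.
      by apply: contrapT => nA; apply: nE; apply: sub => /(_ A mA).
  + move=> B mB; apply: (extension_base lawT Hprod' (A := mu @^-1` B)).
    by rewrite -[X in measurable X]setTI; exact: measurable_funPT.
  + by move=> w A mA; rewrite muxE.
  + move=> k; rewrite /fixed_atom (_ : [set w | _] = setT) ?probability_setT//.
    apply/seteqP; split => // w _ /=; rewrite muxE; last exact: measurable_point.
    rewrite (bigD1 k)//= indicE mem_set// mule1.
    apply: (@lt_le_trans _ _ (Z k w)%:E); first by rewrite lte_fin.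
    rewrite addeCA leeDl// adde_ge0// sume_ge0// => j _.
    by rewrite mule_ge0// lee_fin ltW.
- move=> k; split; first by move=> w; exact: Zp.
  move=> A mA; transitivity (law k A); first exact: (extension_law lawT Hprod' k mA).
  rewrite /law /jump_dist.
  have [mom zp rE] := good _ (nth_in k).
  rewrite nth_cells in mom zp rE *.
  rewrite (@integral_pos_exp _ _ _ rho)// -inve_fine//; congr (_ * _^-1).
  have := @integral_pos_exp _ _ _ rho r _ _ setT zp measurableT rE.
  by rewrite preimage_setT setTI.
- exact: (extension_independent_option lawT Hprod' (measurable_funPT mu)).
Qed.
End posterior_structure.

Theorem theorem3p1 (R : realType) (d : measure_display) (T : polishType R d)
  (eta : probability T R) (rho : R.-sigmafker T ~> R)
  (nu : {measure set (T * R) -> \bar R})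
  (Hnu : crm_intensity eta rho nu)
  (d0 : measure_display) (W0 : measurableType d0) (P0 : probability W0 R)
  (mu : {RV P0 >-> bfmeasure T})
  (Hmu : crm_with_intensity nu mu)
  (Hmass : {ae P0, forall w, 0 < mu w [set: T] < +oo})
  (h' : R -> R) (q : R)
  (h'_meas : measurable_fun (`[0%R, +oo[%classic : set R) h')
  (h'_pos : forall x : R, (0 <= x)%R -> (0 < h' x)%R)
  (q_ge0 : (0 <= q)%R)
  (Hfin : \int[P0]_w (h' (total_mass (mu w)) *
                      total_mass (mu w) `^ (- q))%:E < +oo)
  (d1 : measure_display) (W : measurableType d1) (P : probability W R)
  (mut : {RV P >-> bfmeasure T})
  (Hmut : tilted_law (distribution P0 mu)
            (fun x => h' x * x `^ (- q))%R (distribution P mut))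
  (n : nat) (n_ge1 : (1 <= n)%N)
  (X : {RV P >-> n.-tuple T})
  (HX : conditionally_iid (normalization \o mut) X) :
  (exists Q, posterior_law (normalization \o mut) X Q) /\
  forall Q, posterior_law (normalization \o mut) X Q ->
  {ae distribution P X, forall x : n.-tuple T,
    (forall k : 'I_(ncells x), jump_moment rho k < +oo) ->
    exists (d2 : measure_display) (W2 : measurableType d2)
      (P2 : probability W2 R)
      (mu2 : {RV P2 >-> bfmeasure T}) (J : 'I_(ncells x) -> {RV P2 >-> R})
      (mux : {RV P2 >-> bfmeasure T})
      (d3 : measure_display) (W3 : measurableType d3)
      (P3 : probability W3 R) (mutx : {RV P3 >-> bfmeasure T}),
      [/\ forall B, measurable B ->
            Q x B = P3 ((normalization \o mutx) @^-1` B),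
          tilted_law (distribution P2 mux)
            (fun y => h' y * y `^ (- (n%:R + q)))%R (distribution P3 mutx),
          [/\ completely_random mux,
              crm_with_intensity nu mu2,
              forall B, measurable B ->
                distribution P2 mu2 B = distribution P0 mu B,
              add_fixed_jumps mu2 J mux
            & forall k : 'I_(ncells x), fixed_atom mux (distinct_value k)],
          forall k, jump_law rho k (J k)
        & independent_jumps mu2 J]}.
Proof.
have [r [r_good rnu]] := good_kernel Hnu.
have Hpalm := palm Hnu rnu Hmu.
have [Lam HLam] := moment_measure (eta_nonatomic Hnu) Hpalm n.
have [Q [HQ Qgood]] := posterior_exists h'_meas h'_pos Hmass Hmut n_ge1 HX HLam.
split; first by exists Q.
move=> Q' HQ'.
move: Qgood (posterior_unique HQ' HQ); apply: filterS2 => x [kx Qx] QQ moments.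
apply: (posterior_structure Hmu h'_meas h'_pos r_good kx moments) => B mB.
by rewrite QQ// Qx.
Qed.
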